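(* Let $Z$ be a standard normal random variable. For each natural number $k$ there exist independent identically distributed real random variables $W_1,\dots,W_k$ such that $Z\overset{D}{=}W_1\cdots W_k$ (i.e. the standard normal distribution, viewed as a distribution on the multiplicative group $\mathbb R\setminus\{0\}$, is infinitely divisible). More specifically, one may take each $W_i$ distributed as $$\varepsilon\,\exp\Big\{\frac{\ln2}{2k}-G_{1/k,0}-\sum_{j=1}^\infty\Big[\frac{G_{1/k,j}}{2j+1}-\frac1{2k}\ln\Big(1+\frac1j\Big)\Big]\Big\},$$ where $G_{1/k,0},G_{1/k,1},\dots$ are independent identically distributed random variables each with the gamma distribution $\mathrm{Gamma}(1/k,1)$ (shape $1/k$, scale $1$), $\varepsilon$ is a Rademacher random variable ($\mathbb P(\varepsilon=1)=\mathbb P(\varepsilon=-1)=1/2$) independent of the $G_{1/k,j}$, and the series converges almost surely.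
   Context: $\overset{D}{=}$ denotes equality in distribution. *)

(* Defs.v *)
From HB Require Import structures.
From mathcomp Require Import all_boot all_order all_algebra.
From mathcomp Require Import all_classical all_reals all_analysis.
From mathcomp Require Import normal_distribution.
Set Implicit Arguments. Unset Strict Implicit. Unset Printing Implicit Defensive.
Import Order.TTheory GRing.Theory Num.Theory.
Import numFieldNormedType.Exports.
Local Open Scope classical_set_scope.
Local Open Scope ring_scope.

Definition gamma_fun {R : realType} (a : R) : R :=
  fine (\int[@lebesgue_measure R]_(x in `]0%R, +oo[) (x `^ (a - 1) * expR (- x))%:E)%E.

Definition gamma_pdf {R : realType} (a : R) (x : R) : R :=
  if 0 < x then x `^ (a - 1) * expR (- x) / gamma_fun a else 0.

Definition is_gamma {d} {T : measurableType d} {R : realType}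
  (P : probability T R) (a : R) (X : T -> R) : Prop :=
  forall A : set R, measurable A ->
    P (X @^-1` A) = (\int[@lebesgue_measure R]_(x in A) (gamma_pdf a x)%:E)%E.

Definition is_std_normal {d} {T : measurableType d} {R : realType}
  (P : probability T R) (X : T -> R) : Prop :=
  forall A : set R, measurable A -> P (X @^-1` A) = normal_prob 0 1 A.

Definition is_rademacher {d} {T : measurableType d} {R : realType}
  (P : probability T R) (X : T -> R) : Prop :=
  P (X @^-1` [set 1]) = (2%:R^-1)%:E /\ P (X @^-1` [set -1]) = (2%:R^-1)%:E.

Definition mutually_independent {d} {T : measurableType d} {R : realType}
  (P : probability T R) {I : eqType} (X : I -> T -> R) : Prop :=
  forall (J : seq I), uniq J ->
  forall A : I -> set R, (forall i, measurable (A i)) ->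
    P (\big[setI/setT]_(j <- J) (X j @^-1` A j)) =
    (\prod_(j <- J) P (X j @^-1` A j))%E.

Definition W_term {R : realType} {T : Type} (k : nat) (G : nat -> T -> R)
  (j : nat) (w : T) : R :=
  G j w / (j.*2.+1)%:R - (k.*2)%:R^-1 * ln (1 + j%:R^-1).

Definition W_partial {R : realType} {T : Type} (k : nat) (G : nat -> T -> R)
  (w : T) (n : nat) : R := \sum_(1 <= j < n) W_term k G j w.

Definition W_of {R : realType} {T : Type} (k : nat) (G : nat -> T -> R)
  (eps : T -> R) (w : T) : R :=
  if `[< cvgn (W_partial k G w) >] then
    eps w * expR (ln 2 / (k.*2)%:R - G 0 w - limn (W_partial k G w))
  else 0.

(* Main.v *)
Require Import Defs.
From HB Require Import structures.
From mathcomp Require Import all_boot all_order all_algebra.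
From mathcomp Require Import all_classical all_reals all_analysis.
From mathcomp Require Import measurable_realfun normal_distribution.
From mathcomp Require Import ring lra zify.
Set Implicit Arguments. Unset Strict Implicit. Unset Printing Implicit Defensive.
Import Order.TTheory GRing.Theory Num.Theory.
Import numFieldNormedType.Exports.
Local Open Scope classical_set_scope.
Local Open Scope ring_scope.

(** The law of a product of independent variables is computed by composing the
    operators [f |-> (y |-> E f (y X))], which commute; so the law of the
    product of [k] independent copies of [W] is the [k]-th power of the
    operator of [W].  Truncating the series after [m] terms, the operator of
    [W] factors over [eps] and the [G j], and its [k]-th power turns each
    Gamma(1/k) into a Gamma(1), since gamma shapes add up.  The operator of [exp (c - p E)] with [E]
    exponential is an explicit power density, and the composition of these
    operators for [p = 1, 1/3, ..., 1/(2m+1)] is, by induction on [m], the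
    density of a rescaled coordinate of a uniform point on a sphere, which is
    proportional to a power of [1 - x^2]; when [m] goes to infinity it
    converges to the Gaussian density (Maxwell-Poincare).  On the other side,
    the series converges almost surely: the centred gamma variables are summed
    over the blocks [m^3 <= j < (m+1)^3], and the second moments of the block
    sums, weighted by [(m+1)^2], are summable.

    The independent families are built on the unit interval by splitting a uniform
    variable into its even and odd binary digits, iterating, and applying
    quantile functions. *)

(** Origin of the constants: in dimension n a sphere coordinate has density proportional to (1 -
    x^2/r^2)^((n-3)/2), used here for n = 2m+3 and r^2 = 2(m+1). Multiplying it by U^(1/(2m+3)),
    with U uniform, raises m by one: the factor u^(2m+2) of the power density clears the
    denominators of (1 - t/u^2)^m and leaves an exact derivative. This dictates the weights
    1/(2j+1). The logarithms adjust the radius: sqrt 2 for the first sphere, then a factor sqrt(1 +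
    1/j) from one sphere to the next. Normalising constants are fixed by testing against the
    constant function 1, for the beta integral as for the spheres.

    In the almost sure convergence, second moments control the partial sums only along a sparse
    subsequence. The gaps are filled because the [G j] are nonnegative, so the uncompensated sums
    increase, while the logarithmic compensator hardly moves between consecutive cubes. Cubes suit
    the weight (m+1)^2: a block has O(m^2) terms of size O(m^-3), so the weighted variances are
    O(m^-2), whereas blocks between squares would leave a harmonic series. *)

Section density.
Local Open Scope ereal_scope.
Context d (X : measurableType d) (R : realType).
Import HBNNSimple.

(** Simple approximations of [f] and monotone convergence on both sides. [nu] is known only through
    its values on measurable sets, which is how [is_gamma] presents a law. *)
Lemma ge0_integral_density (mu nu : {measure set X -> \bar R}) (g : X -> R)
    (f : X -> \bar R) :
  measurable_fun setT g -> (forall x, (0 <= g x)%R) ->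
  (forall A, measurable A -> nu A = \int[mu]_(x in A) (g x)%:E) ->
  measurable_fun setT f -> (forall x, 0 <= f x) ->
  \int[nu]_x f x = \int[mu]_x ((g x)%:E * f x).
Proof.
move=> mg g0 nuE mf f0.
pose h := nnsfun_approx measurableT mf.
have hf x : (EFin \o h^~ x) n @[n --> \oo] --> f x.
  by apply: cvg_nnsfun_approx.
have mh n : measurable_fun setT (fun x => (h n x)%:E).
  by apply/measurable_EFinP; exact/measurable_funP.
have mgE : measurable_fun setT (EFin \o g) by exact/measurable_EFinP.
transitivity (limn (fun n => \int[nu]_x (h n x)%:E)).
  rewrite -monotone_convergence//.
  - by apply: eq_integral => x _; apply/esym/cvg_lim => //; exact: hf.
  - by move=> n x _; rewrite lee_fin.
  - by move=> x _ m n mn; rewrite lee_fin; exact/lefP/nd_nnsfun_approx.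
transitivity (limn (fun n => \int[mu]_x ((g x)%:E * (h n x)%:E))); last first.
  rewrite -monotone_convergence//.
  - apply: eq_integral => x _; apply/cvg_lim => //; apply: cvgeZl => //.
    exact: hf.
  - by move=> n; exact: emeasurable_funM.
  - by move=> n x _; rewrite mule_ge0// lee_fin.
  - move=> x _ m n mn; rewrite lee_wpmul2l ?lee_fin//.
    exact/lefP/nd_nnsfun_approx.
apply: congr_lim; apply/funext => n.
have mi r : measurable_fun setT (fun x => (r * \1_(h n @^-1` [set r]) x)%:E).
  by apply/measurable_EFinP; exact: measurable_funM.
under eq_integral do rewrite fimfunE -fsumEFin//.
rewrite ge0_integral_fsum//; last by move=> r x _; exact: nnfun_muleindic_ge0.
under [RHS]eq_integral do rewrite fimfunE -fsumEFin// muleC.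
under [RHS]eq_integral do (rewrite ge0_mule_fsuml; last by
  move=> r; exact: nnfun_muleindic_ge0).
rewrite ge0_integral_fsum//; last 2 first.
  - by move=> r; apply: emeasurable_funM.
  - by move=> r x _; apply: mule_ge0; [exact: nnfun_muleindic_ge0|rewrite lee_fin].
apply: eq_fsbigr => r rhn.
rewrite integralZl_indic_nnsfun// integral_indic// setIT.
under [RHS]eq_integral do rewrite EFinM -muleA.
have [r0|r0] := leP 0%R r; last first.
  have -> : h n @^-1` [set r] = set0 by exact: preimage_nnfun0.
  rewrite measure0 mule0 integral0_eq// => x _.
  by rewrite indicE in_set0 mul0e mule0.
rewrite ge0_integralZl_EFin//; last 2 first.
  - by move=> x _; rewrite mule_ge0 ?lee_fin.
  - by apply: emeasurable_funM => //; apply/measurable_EFinP.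
congr (_ * _); rewrite nuE// integral_mkcond.
apply: eq_integral => x _; rewrite patchE indicE.
by case: ifPn => xh; rewrite ?mul1e ?mul0e.
Qed.

End density.

(** * Scaling of Lebesgue measure *)

Section lebesgue_scaling.
Local Open Scope ereal_scope.
Context {R : realType}.
Local Notation mu := (@lebesgue_measure R).

Lemma lebesgue_measureZ (c : R) (A : set R) : (0 < c)%R -> measurable A ->
  mu A = c%:E * mu [set x | A (c * x)%R].
Proof.
move=> c0 mA.
have mc : measurable_fun setT (fun x : measurableTypeR R => (c * x)%R : measurableTypeR R).
  by apply: measurable_funM => //.
pose m1 := @mscale _ (measurableTypeR R) R (NngNum (ltW c0))
  (pushforward mu (fun x : measurableTypeR R => (c * x)%R : measurableTypeR R)).
have := @lebesgue_measure_unique R (m1 mc); apply => // _ [[a b]] _ <-.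
rewrite /m1/= /mscale/= /pushforward/=.
rewrite (_ : _ @^-1` _ = `](c^-1 * a)%R, (c^-1 * b)%R]%classic); last first.
  apply/seteqP; split => x /=; rewrite !in_itv/=;
  by rewrite ltr_pdivrMl// ler_pdivlMl.
rewrite !lebesgue_measure_itv/= !lte_fin ltr_pM2l ?invr_gt0//.
case: ifPn => ab; last by rewrite mule0.
by rewrite -!EFinD -EFinM; congr EFin; field; rewrite gt_eqF.
Qed.

Lemma ge0_integralZ_lebesgue (c : R) (f : R -> \bar R) : (0 < c)%R ->
  measurable_fun setT f -> (forall x, 0 <= f x) ->
  \int[mu]_x f x = c%:E * \int[mu]_x f (c * x)%R.
Proof.
move=> c0 mf f0.
have mc : measurable_fun setT (fun x : measurableTypeR R => (c * x)%R : measurableTypeR R).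
  by apply: measurable_funM => //.
pose m1 := @mscale _ (measurableTypeR R) R (NngNum (ltW c0))
  (pushforward mu (fun x : measurableTypeR R => (c * x)%R : measurableTypeR R)).
rewrite (eq_measure_integral (m1 mc)); last first.
  by move=> A mA _; rewrite /m1 /= /mscale/= /pushforward/= -lebesgue_measureZ.
rewrite ge0_integral_mscale//=; congr (_ * _).
by rewrite ge0_integral_pushforward//.
Qed.

End lebesgue_scaling.

(** * Finite measures determined by rays or by rectangles *)

Section uniqueness.
Local Open Scope ereal_scope.
Context {R : realType}.

(** The open rays ]x, +oo[ form a generating pi-system, and finite total mass gives access to them
    by complementation. *)
Lemma finite_measure_eq_rays (m1 m2 : {measure set R -> \bar R}) :
  m1 setT < +oo -> m1 setT = m2 setT ->
  (forall x : R, m1 `]-oo, x]%classic = m2 `]-oo, x]%classic) ->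
  forall A : set R, measurable A -> m1 A = m2 A.
Proof.
move=> fin m12T m12 A mA.
apply: (measure_unique (@RGenOInfty.G R) (fun n => `](- n%:R)%R, +oo[%classic)).
- exact: RGenOInfty.measurableE.
- move=> _ _ [x ->] [y ->]; exists (Num.max x y).
  by apply/seteqP; split => z /=; rewrite !in_itv/= !andbT gt_max => /andP.
- by move=> n; exists (- n%:R)%R.
- apply/seteqP; split => // x _; exists (Num.truncn `|x|%R).+1 => //=.
  by rewrite in_itv/= andbT; have := truncnS_gt `|x|%R; rewrite ltr_norml => /andP[].
- move=> _ [x ->]; rewrite -setCitvl.
  have E (m : {measure set R -> \bar R}) : m setT < +oo ->
      m (~` `]-oo, x]) = m setT - m `]-oo, x]%classic.
    by move=> mT; rewrite -setTD measureD// ?setTI.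
  by rewrite !E -?m12T// m12.
- move=> n; apply: le_lt_trans fin; apply: le_measure => //; rewrite inE//.
- exact: mA.
Qed.

Lemma finite_measure_eq_rects d1 d2 (T1 : measurableType d1)
    (T2 : measurableType d2) (m1 m2 : {measure set (T1 * T2) -> \bar R}) :
  m1 setT < +oo ->
  (forall A B, measurable A -> measurable B -> m1 (A `*` B) = m2 (A `*` B)) ->
  forall A, measurable A -> m1 A = m2 A.
Proof.
move=> fin m12 A mA.
apply: (measure_unique [set A1 `*` A2 | A1 in measurable & A2 in measurable]
  (fun=> setT)).
- by rewrite measurable_prod_measurableType.
- move=> _ _ [X1 mX1 [X2 mX2 <-]] [Y1 mY1 [Y2 mY2 <-]].
  rewrite -setXI; exists (X1 `&` Y1); first exact: measurableI.
  by exists (X2 `&` Y2) => //; exact: measurableI.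
- by move=> _; exists setT => //; exists setT => //; rewrite setXTT.
- by apply/seteqP; split => // x _; exists 0%N.
- by move=> _ [X1 mX1 [X2 mX2 <-]]; exact: m12.
- by [].
- exact: mA.
Qed.

End uniqueness.

(** * Products of independent variables as operators *)

Section independence.
Local Open Scope ereal_scope.
Context d (T : measurableType d) {R : realType}.
Implicit Type P : probability T R.

(** Independence makes the law of the pair a product measure, so Tonelli applies. Integrating twice
    over [P] itself prepares the reading as a composition of operators [mop]. *)
Lemma ge0_integral_indep2 d1 d2 (T1 : measurableType d1) (T2 : measurableType d2)
    P (X : T -> T1) (Y : T -> T2) (F : T1 * T2 -> \bar R) :
  measurable_fun setT X -> measurable_fun setT Y ->
  (forall A B, measurable A -> measurable B ->
    P (X @^-1` A `&` Y @^-1` B) = P (X @^-1` A) * P (Y @^-1` B)) ->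
  measurable_fun setT F -> (forall z, 0 <= F z) ->
  \int[P]_w F (X w, Y w) = \int[P]_w \int[P]_v F (X w, Y v).
Proof.
move=> mX mY XY mF F0.
pose X' : {mfun T >-> T1} := HB.pack X (isMeasurableFun.Build _ _ _ _ _ mX).
pose Y' : {mfun T >-> T2} := HB.pack Y (isMeasurableFun.Build _ _ _ _ _ mY).
have mXY : measurable_fun setT (fun w => (X w, Y w)).
  by apply: measurable_fun_pair.
have -> : \int[P]_w F (X w, Y w) =
    \int[pushforward P (fun w => (X w, Y w))]_z F z.
  by rewrite ge0_integral_pushforward.
pose pm := pushforward P (fun w => (X w, Y w)) : {measure set _ -> \bar R}.
rewrite (eq_measure_integral (distribution P X' \x distribution P Y'));
  last first.
  move=> A mA _.
  apply/esym; apply: (@product_measure_unique _ _ _ _ _ (distribution P X')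
     (distribution P Y') (pm mXY)); [exact: XY|exact: mA].
rewrite fubini_tonelli1// ge0_integral_distribution/=.
- apply: eq_integral => w _; rewrite /fubini_F.
  rewrite ge0_integral_distribution//.
  by apply: measurableT_comp => //; exact: measurable_pair1.
- exact: measurable_fun_fubini_tonelli_F.
- by move=> x; exact: integral_ge0.
Qed.

(** Induction on [s]. The list [J] of remaining events is kept general because the head [i] of the
    product is moved into it when the induction hypothesis is used. *)
Lemma mutually_independent_prod P (I : eqType) (X : I -> T -> R) (s J : seq I)
    (A : set R) (B : I -> set R) :
  (forall i, measurable_fun setT (X i)) -> mutually_independent P X ->
  uniq (s ++ J) -> measurable A -> (forall i, measurable (B i)) ->
  P ((fun w => \prod_(i <- s) X i w)%R @^-1` A `&`
     \big[setI/setT]_(j <- J) (X j @^-1` B j)) =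
  P ((fun w => \prod_(i <- s) X i w)%R @^-1` A) *
  P (\big[setI/setT]_(j <- J) (X j @^-1` B j)).
Proof.
move=> mX iX; elim: s J A B => [|i s IH] J A B usJ mA mB.
  have [A1|A1] := pselect (A 1%R).
    rewrite (_ : _ @^-1` A = setT); last first.
      by apply/seteqP; split => // w _ /=; rewrite big_nil.
    by rewrite setTI probability_setT mul1e.
  rewrite (_ : _ @^-1` A = set0); last first.
    by apply/seteqP; split => // w /=; rewrite big_nil.
  by rewrite set0I measure0 mul0e.
have /= /andP[iNsJ usJ'] := usJ.
have iNs : i \notin s by move: iNsJ; rewrite mem_cat negb_or => /andP[].
have iNJ : i \notin J by move: iNsJ; rewrite mem_cat negb_or => /andP[].
have uJ : uniq J by move: usJ'; rewrite cat_uniq => /and3P[].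
have us : uniq s by move: usJ'; rewrite cat_uniq => /and3P[].
set D := \big[setI/setT]_(j <- J) (X j @^-1` B j).
have mXB j C : measurable C -> measurable (X j @^-1` C).
  by move=> mC; rewrite -[X in measurable X]setTI; exact: mX.
have mD : measurable D by apply: bigsetI_measurable => j _; exact: mXB.
have mY : measurable_fun setT (fun w => \prod_(i <- s) X i w)%R.
  exact: measurable_prod.
pose Y w := (\prod_(i <- s) X i w)%R.
have mZY : measurable_fun setT (fun w => (X i w, Y w)).
  by apply: measurable_fun_pair.
(* For the fixed event [D], the measures P((X i, Y) in E, D) and P(D) P((X i, Y) in E) of a planar
   set E agree on rectangles, hence everywhere, in particular on the set where the product of the
   coordinates lies in [A]. *)
pose m1 := pushforward (mrestr P mD) (fun w => (X i w, Y w))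
  : {measure set _ -> \bar R}.
have PD0 : (0 <= fine (P D))%R by exact/fine_ge0.
pose m2 := mscale (NngNum PD0) (pushforward P (fun w => (X i w, Y w)))
  : {measure set _ -> \bar R}.
have m12 : forall E, measurable E -> m1 mZY E = m2 mZY E.
  apply: finite_measure_eq_rects.
    rewrite /m1/= /pushforward/= /mrestr/= (le_lt_trans (probability_le1 _ _))//.
      by rewrite ?preimage_setT ?setTI.
    by rewrite ltry.
  move=> C E mC mE; rewrite /m1 /m2/= /mscale/= /pushforward/= /mrestr/=.
  rewrite fineK ?fin_num_measure//.
  have -> : (fun w => (X i w, Y w)) @^-1` (C `*` E) = Y @^-1` E `&` X i @^-1` C.
    by apply/seteqP; split => w /= [].
  pose B' j := if j == i then C else B j.
  have mB' j : measurable (B' j) by rewrite /B'; case: ifP.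
  have DE : D = \big[setI/setT]_(j <- J) (X j @^-1` B' j).
    rewrite /D; apply: eq_big_seq => j jJ; rewrite /B' ifF//.
    by apply/negbTE; apply: contraNneq iNJ => <-.
  have IH1 : P (Y @^-1` E `&` (X i @^-1` C `&` D)) =
      P (Y @^-1` E) * P (X i @^-1` C `&` D).
    have := IH (i :: J) E B' _ mE mB'; rewrite big_cons -DE {1 2}/B' eqxx; apply.
    by rewrite (perm_uniq (_ : perm_eq _ (i :: s ++ J)))// -cat1s -(cat1s i (s ++ J)) perm_catCA.
  have IH2 : P (Y @^-1` E `&` X i @^-1` C) = P (Y @^-1` E) * P (X i @^-1` C).
    have := IH [:: i] E B' _ mE mB'; rewrite big_seq1 {1 2}/B' eqxx; apply.
    by rewrite cats1 rcons_uniq iNs us.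
  rewrite -setIA IH1 IH2.
  have := iX (i :: J) _ B' mB'; rewrite /= iNJ uJ => /(_ isT).
  rewrite !big_cons -DE {1 2}/B' eqxx => ->.
  have := iX J uJ B' mB'; rewrite -DE => <-.
  by rewrite muleA muleC.
have mm : measurable_fun setT (fun z : R * R => (z.1 * z.2)%R).
  by apply: measurable_funM.
have mE : measurable [set z : R * R | A (z.1 * z.2)%R].
  by rewrite -[X in measurable X]setTI; exact: mm.
have := m12 _ mE; rewrite /m1 /m2/= /mscale/= /pushforward/= /mrestr/=.
rewrite fineK ?fin_num_measure//.
have -> : (fun w => (X i w, Y w)) @^-1` [set z | A (z.1 * z.2)%R] =
   (fun w => (\prod_(i <- i :: s) X i w)%R) @^-1` A.
  by apply/seteqP; split => w /=; rewrite big_cons.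
by move=> ->; rewrite muleC.
Qed.

End independence.

Section multiplicative_operator.
Local Open Scope ereal_scope.
Context {R : realType}.

Definition nonneg_meas (f : R -> \bar R) :=
  measurable_fun setT f /\ forall x, 0 <= f x.

Lemma nonneg_meas_indic (A : set R) :
  measurable A -> nonneg_meas (fun x => (\1_A x)%:E).
Proof.
by move=> mA; split=> [|x]; [exact/measurable_EFinP/measurable_indic|
  rewrite lee_fin].
Qed.

Definition mop d (T : measurableType d) (P : {measure set T -> \bar R})
  (X : T -> R) (f : R -> \bar R) (y : R) : \bar R := \int[P]_w f (y * X w)%R.

Lemma nonneg_meas_mop d (T : measurableType d)
    (P : {sigma_finite_measure set T -> \bar R}) (X : T -> R) f :
  measurable_fun setT X -> nonneg_meas f -> nonneg_meas (mop P X f).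
Proof.
move=> mX [mf f0]; split; last by move=> x; exact: integral_ge0.
apply: (@measurable_fun_fubini_tonelli_F _ _ _ _ _ P
  (fun z : R * T => f (z.1 * X z.2)%R)) => //.
apply: measurableT_comp => //; apply: measurable_funM => //.
exact: measurableT_comp.
Qed.

Lemma mopC d d' (T : measurableType d) (T' : measurableType d')
    (P : {sigma_finite_measure set T -> \bar R})
    (Q : {sigma_finite_measure set T' -> \bar R}) (X : T -> R) (Y : T' -> R) f :
  measurable_fun setT X -> measurable_fun setT Y -> nonneg_meas f ->
  mop P X (mop Q Y f) = mop Q Y (mop P X f).
Proof.
move=> mX mY [mf f0]; apply/funext => y; rewrite /mop.
rewrite (fubini_tonelli (fun z : T * T' => f (y * X z.1 * Y z.2)%R))//=.
  by apply: eq_integral => v _; apply: eq_integral => w _; rewrite mulrAC.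
apply: measurableT_comp => //; apply: measurable_funM => //.
  by apply: measurable_funM => //; exact: measurableT_comp.
exact: measurableT_comp.
Qed.

Lemma eq_mop d d' (T : measurableType d) (T' : measurableType d')
    (P : {measure set T -> \bar R}) (Q : {measure set T' -> \bar R})
    (X : T -> R) (Y : T' -> R) f :
  measurable_fun setT X -> measurable_fun setT Y -> nonneg_meas f ->
  (forall A, measurable A -> P (X @^-1` A) = Q (Y @^-1` A)) ->
  mop P X f = mop Q Y f.
Proof.
move=> mX mY [mf f0] PQ; apply/funext => y; rewrite /mop.
have mfy : measurable_fun setT (fun x => f (y * x)%R).
  by apply: measurableT_comp => //; apply: measurable_funM.
pose mP := pushforward P X : {measure set _ -> \bar R}.
pose mQ := pushforward Q Y : {measure set _ -> \bar R}.
transitivity (\int[mP mX]_x f (y * x)%R).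
  by rewrite [RHS]ge0_integral_pushforward.
transitivity (\int[mQ mY]_x f (y * x)%R); last first.
  by rewrite [LHS]ge0_integral_pushforward.
by apply: eq_measure_integral => A mA _; exact: PQ.
Qed.

Lemma nonneg_meas_foldr_mop d (T : measurableType d) (P : probability T R)
    (I : Type) (X : I -> T -> R) (s : seq I) f :
  (forall i, measurable_fun setT (X i)) -> nonneg_meas f ->
  nonneg_meas (foldr (fun i => mop P (X i)) f s).
Proof.
by move=> mX nf; elim: s => //= i s; exact: nonneg_meas_mop.
Qed.

Lemma mop_prod d (T : measurableType d) (P : probability T R)
    (I : eqType) (X : I -> T -> R) (s : seq I) f :
  (forall i, measurable_fun setT (X i)) -> mutually_independent P X ->
  uniq s -> nonneg_meas f ->
  mop P (fun w => \prod_(i <- s) X i w)%R f = foldr (fun i => mop P (X i)) f s.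
Proof.
move=> mX iX us nf; elim: s us => [|i s IH] us.
  apply/funext => y /=; rewrite /mop.
  under eq_integral do rewrite big_nil mulr1.
  by rewrite integral_cst//= [P _]probability_setT mule1.
move: us; rewrite cons_uniq => /andP[iNs us'].
rewrite /= -IH//; apply/funext => y; rewrite /mop.
have mY : measurable_fun setT (fun w => \prod_(i <- s) X i w)%R.
  exact: measurable_prod.
have [mf f0] := nf.
under eq_integral do rewrite big_cons.
rewrite (@ge0_integral_indep2 _ _ _ _ _ _ _ P (X i)
  (fun w => \prod_(i <- s) X i w)%R (fun z : R * R => f (y * (z.1 * z.2))%R))//=.
- apply: eq_integral => w _; apply: eq_integral => v _.
  by rewrite mulrA.
- move=> A B mA mB.
  have := @mutually_independent_prod _ _ _ P _ X s [:: i] B (fun=> A) mX iX.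
  rewrite !big_seq1 setIC muleC; apply => //.
  by rewrite cats1 rcons_uniq iNs us'.
- apply: measurableT_comp => //; apply: measurable_funM => //.
  exact: measurable_funM.
Qed.

End multiplicative_operator.

(** * The gamma density *)

Section gamma.
Local Open Scope ereal_scope.
Context {R : realType}.
Local Notation mu := (@lebesgue_measure R).

Definition has_derivative (F : R -> R) (x l : R) :=
  derivable F x 1%R /\ (F^`()%classic x = l)%R.

Lemma is_derive_has_derivative (F : R -> R) (x l : R) :
  is_derive x (1:R)%R F l -> has_derivative F x l.
Proof. by case=> dF dE; split => //; rewrite derive1E. Qed.

Lemma has_derivative_continuous (F : R -> R) (x l : R) :
  has_derivative F x l -> {for x, continuous F}.
Proof. by case=> dF _; apply/differentiable_continuous/derivable1_diffP. Qed.

Lemma continuous_is_derive_FTC2 (f F : R -> R) (a b : R) : (a < b)%R ->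
  (forall x, (a <= x <= b)%R -> has_derivative F x (f x)) ->
  (forall x, (a <= x <= b)%R -> {for x, continuous f}) ->
  \int[mu]_(x in `[a, b]) (f x)%:E = (F b - F a)%:E.
Proof.
move=> ab dF cf; rewrite EFinB; apply: continuous_FTC2 => //.
- apply: continuous_in_subspaceT => x /set_mem/=; rewrite in_itv/=; exact: cf.
- have cF x : (a <= x <= b)%R -> {for x, continuous F}.
    by move/dF/has_derivative_continuous.
  split.
  + move=> x; rewrite in_itv/= => /andP[ax xb].
    by have [|] := dF x; [rewrite !ltW|].
  + by apply: cvg_at_right_filter; apply: cF; rewrite lexx ltW.
  + by apply: cvg_at_left_filter; apply: cF; rewrite lexx ltW.
- move=> x; rewrite in_itv/= => /andP[ax xb].
  by have [|_ ->//] := dF x; rewrite !ltW.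
Qed.

(** The gamma density without its constant, extended by zero to the whole line so that scaling
    substitutions need no bookkeeping of domains. *)
Definition gamma_kernel (a x : R) : R :=
  if (0 < x)%R then (x `^ (a - 1) * expR (- x))%R else 0%R.

Lemma gamma_kernel_ge0 a x : (0 <= gamma_kernel a x)%R.
Proof. by rewrite /gamma_kernel; case: ifP => // _; rewrite mulr_ge0 ?expR_ge0 ?powR_ge0. Qed.

Lemma measurable_gamma_kernel a : measurable_fun setT (gamma_kernel a).
Proof.
apply: measurable_fun_ifT => //.
- exact: measurable_fun_ltr.
- apply: measurable_funM; first exact: measurable_powR.
  by apply: measurableT_comp => //; exact: measurable_expR.
Qed.

Lemma gamma_pdfE a x : gamma_pdf a x = ((gamma_fun a)^-1 * gamma_kernel a x)%R.
Proof.
by rewrite /gamma_pdf /gamma_kernel; case: ifP => _; rewrite ?mulr0// mulrC.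
Qed.

Lemma integral_gamma_kernelE a : \int[mu]_x (gamma_kernel a x)%:E =
  \int[mu]_(x in `]0%R, +oo[) (x `^ (a - 1) * expR (- x))%:E.
Proof.
rewrite [RHS]integral_mkcond; apply: eq_integral => x _.
by rewrite patchE mem_setE in_itv/= andbT /gamma_kernel; case: ifP.
Qed.

Lemma integral_powR_le a : (0 < a)%R ->
  \int[mu]_(x in `]0%R, 1%R]) (x `^ (a - 1))%:E <= (a^-1)%:E.
Proof.
move=> a0.
(* The integrand may blow up at 0, so the interval is exhausted from the right; n+2 keeps the left
   end strictly below 1, as the fundamental theorem of calculus requires. *)
have -> : `]0%R, 1%R]%classic = \bigcup_n `[(n.+2%:R^-1)%R, (1:R)%R]%classic.
  apply/seteqP; split => x /=; rewrite in_itv/=.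
    move=> /andP[x0 x1]; exists (Num.truncn (x^-1)) => //=.
    rewrite in_itv/= x1 andbT invf_ple ?posrE// ltW//.
    by rewrite (lt_le_trans (truncnS_gt _))// ler_nat.
  case=> n _ /=; rewrite in_itv/= => /andP[nx ->]; rewrite andbT.
  by rewrite (lt_le_trans _ nx)// invr_gt0.
have mp : measurable_fun setT (fun x : R => (x `^ (a - 1))%:E).
  by apply/measurable_EFinP; exact: measurable_powR.
have h : \int[mu]_(x in `[(n.+2%:R^-1)%R, 1%R]) (x `^ (a - 1))%:E @[n --> \oo]
    --> \int[mu]_(x in \bigcup_n `[(n.+2%:R^-1)%R, (1:R)%R]%classic) (x `^ (a - 1))%:E.
  apply: ge0_nondecreasing_set_cvg_integral => //.
  - move=> m n mn; apply/subsetPset/subset_itvr; rewrite bnd_simp.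
    by rewrite lef_pV2 ?posrE// ler_nat !ltnS.
  - by move=> n; exact: measurable_funTS.
  - by move=> n x _; rewrite lee_fin powR_ge0.
rewrite -(cvg_lim _ h)//; apply: lime_le; first by apply/cvg_ex; eexists; exact: h.
apply: nearW => n.
have n0 : (0 < n.+2%:R^-1 :> R)%R by rewrite invr_gt0.
rewrite (@continuous_is_derive_FTC2 _ (fun x => a^-1 * x `^ a)%R).
- rewrite lee_fin powR1 mulr1 gerBl.
  by rewrite mulr_ge0 ?powR_ge0// invr_ge0 ltW.
- by rewrite invf_lt1// ltr1n.
- move=> x /andP[nx _]; have x0 := lt_le_trans n0 nx.
  apply: is_derive_has_derivative.
  have dp := @is_derive1_powR R a x x0.
  by apply: is_derive_eq; rewrite /GRing.scale/=; field; rewrite gt_eqF.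
- move=> x /andP[nx _]; have x0 := lt_le_trans n0 nx.
  apply/differentiable_continuous/derivable1_diffP.
  by apply: derivable_powR; rewrite in_itv/= x0.
Qed.

Lemma ge0_is_derive_FTC2y (f F : R -> R) (a l : R) :
  (forall x, (a <= x)%R -> (0 <= f x)%R) ->
  (forall x, (a <= x)%R -> has_derivative F x (f x)) ->
  (forall x, (a <= x)%R -> {for x, continuous f}) ->
  F x @[x --> +oo%R] --> l ->
  \int[mu]_x (if (a < x)%R then f x else 0)%:E = (l - F a)%:E.
Proof.
move=> f0 dF cf Fl.
have cF := has_derivative_continuous (dF _ (lexx a)).
have cfw : {within `[a, +oo[, continuous f}.
  apply: continuous_in_subspaceT => x /set_mem/=; rewrite in_itv/= andbT.
  exact: cf.
rewrite EFinB -(@ge0_continuous_FTC2y _ f F a l)//.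
- rewrite -integral_itv_obnd_cbnd; last first.
    apply/measurable_EFinP.
    apply: open_continuous_measurable_fun => // x /set_mem/=.
    by rewrite in_itv/= andbT => /ltW; exact: cf.
  rewrite [RHS]integral_mkcond; apply: eq_integral => x _.
  by rewrite patchE mem_setE in_itv/= andbT; case: ifP.
- by move=> x /ltW /dF[].
- exact: cvg_at_right_filter.
- by move=> x; rewrite in_itv/= andbT => /ltW /dF[].
Qed.

Lemma cvgr_expRZ (r : R) : (0 < r)%R -> expR (- (r * x))%R @[x --> +oo%R] --> (0:R)%R.
Proof.
move=> r0; apply: (@cvg_comp _ _ _ (fun z => (r * z)%R) (fun z => expR (- z))
  _ (pinfty_nbhs R)); last exact: cvgr_expR.
exact: gt0_cvgMry.
Qed.

Lemma measurable_expRN_if (r : R) :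
  measurable_fun setT (fun x : R => if (0 < x)%R then expR (- (r * x)) else 0%R).
Proof.
apply: measurable_fun_ifT => //; first exact: measurable_fun_ltr.
apply: measurableT_comp; first exact: measurable_expR.
by apply: measurableT_comp => //; exact: measurable_funM.
Qed.

Lemma integral_expRN (r : R) : (0 < r)%R ->
  \int[mu]_x (if (0 < x)%R then expR (- (r * x)) else 0)%:E = (r^-1)%:E.
Proof.
move=> r0.
have dE (x : R) : is_derive x (1:R)%R (fun x => expR (- (r * x))) (- r * expR (- (r * x)))%R.
  apply: is_derive_eq; rewrite /GRing.scale/=; ring.
rewrite (@ge0_is_derive_FTC2y _ (fun x => - r^-1 * expR (- (r * x)))%R 0%R 0%R).
- by rewrite mulr0 oppr0 expR0 sub0r mulr1 opprK.
- by move=> x _; exact: expR_ge0.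
- move=> x _; apply: is_derive_has_derivative.
  have dx := dE x; apply: is_derive_eq; rewrite /GRing.scale/=.
  by field; rewrite gt_eqF.
- move=> x _; apply/differentiable_continuous/derivable1_diffP.
  by have [] := dE x.
- rewrite -[X in _ --> X](mulr0 (- r^-1)%R).
  by apply: cvgMr; exact: cvgr_expRZ.
Qed.

Lemma integral_idM_expRN :
  \int[mu]_x (if (0 < x)%R then x * expR (- x) else 0)%:E = 1.
Proof.
have dE (x : R) : is_derive x (1:R)%R (fun x => - ((x + 1) * expR (- x)))%R (x * expR (- x))%R.
  apply: is_derive_eq; rewrite /GRing.scale/=; ring.
rewrite (@ge0_is_derive_FTC2y _ (fun x => - ((x + 1) * expR (- x)))%R 0%R 0%R).
- by rewrite oppr0 expR0 !add0r mulr1 opprK.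
- by move=> x x0; rewrite mulr_ge0 ?expR_ge0.
- by move=> x _; exact: is_derive_has_derivative.
- move=> x _; apply/differentiable_continuous/derivable1_diffP.
  exact: derivableM.
- rewrite -oppr0; apply: cvgN.
  (* x + 1 <= 2 (1 + x/2) <= 2 exp(x/2), whence the upper bound 2 exp(-x/2). *)
  apply: (@squeeze_cvgr _ _ _ _ (fun=> 0%R) (fun x => 2 * expR (- (2^-1 * x)))%R).
  + near=> x; have x0 : (0 <= x)%R by near: x; exact: nbhs_pinfty_ge.
    rewrite mulr_ge0 ?expR_ge0 ?addr_ge0//=.
    rewrite (_ : (- x = - (2^-1 * x) - (2^-1 * x))%R); last by field.
    rewrite expRD mulrA ler_wpM2r ?expR_ge0// expRN ler_pdivrMr ?expR_gt0//.
    have := expR_ge1Dx (2^-1 * x)%R; lra.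
  + exact: cvg_cst.
  + rewrite -[X in _ --> X](mulr0 2%R).
    by apply: cvgMr; apply: cvgr_expRZ; rewrite invr_gt0.
Unshelve. all: by end_near. Qed.

Lemma integral_sqrM_expRN_lty :
  \int[mu]_x (if (0 < x)%R then x ^+ 2 * expR (- x) else 0)%:E < +oo.
Proof.
(* The 8 comes from exp(x/2) >= (x/2)^2 / 2. *)
apply: (@le_lt_trans _ _ (\int[mu]_x
   (8%:E * (if (0 < x)%R then expR (- (2^-1 * x)) else 0)%:E))); last first.
  rewrite ge0_integralZl//.
  - by rewrite integral_expRN ?invr_gt0// ltry.
  - by apply/measurable_EFinP; exact: measurable_expRN_if.
  - by move=> x _; case: ifP => // _; rewrite lee_fin expR_ge0.
apply: ge0_le_integral => //.
- by move=> x _; case: ifP => // x0; rewrite lee_fin mulr_ge0 ?expR_ge0 ?sqr_ge0.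
- apply/measurable_EFinP; apply: measurable_fun_ifT => //.
    exact: measurable_fun_ltr.
  apply: measurable_funM => //.
  by apply: measurableT_comp; first exact: measurable_expR.
- apply: emeasurable_funM => //.
  by apply/measurable_EFinP; exact: measurable_expRN_if.
- move=> x _; case: ifPn => x0; last by rewrite mule0.
  rewrite -EFinM lee_fin.
  rewrite (_ : (- x = - (2^-1 * x) - (2^-1 * x))%R); last by field.
  rewrite expRD mulrA ler_wpM2r ?expR_ge0// expRN ler_pdivrMr ?expR_gt0//.
  have h : (0 <= 2^-1 * x)%R by rewrite mulr_ge0 ?ltW// invr_ge0.
  have := @expR_ge1Dxn _ (2^-1 * x)%R 1 h.
  rewrite (_ : 2`! = 2)%N//; lra.
Qed.

Lemma gamma_kernel1 (x : R) :
  gamma_kernel 1 x = (if (0 < x)%R then expR (- x) else 0)%R.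
Proof. by rewrite /gamma_kernel subrr powRr0 mul1r. Qed.

(** The kernel is dominated by x^(a-1) on ]0, 1] and, as a <= 1, by exp(-x) beyond. Finiteness
    matters because [fine] in [gamma_fun] would turn an infinite integral into 0. The shapes that
    occur are the m/k with m <= k. *)
Lemma integral_gamma_kernel a : (0 < a <= 1)%R ->
  \int[mu]_x (gamma_kernel a x)%:E = (gamma_fun a)%:E /\ (0 < gamma_fun a)%R.
Proof.
move=> /andP[a0 a1].
have mp : measurable_fun setT (fun x : R => (x `^ (a - 1))%:E).
  by apply/measurable_EFinP; exact: measurable_powR.
have mg : measurable_fun setT (fun x => (gamma_kernel a x)%:E).
  by apply/measurable_EFinP; exact: measurable_gamma_kernel.
have lt : \int[mu]_x (gamma_kernel a x)%:E < +oo.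
  apply: (@le_lt_trans _ _ (\int[mu]_x
     (((fun x : R => (x `^ (a - 1))%:E) \_ `]0%R, 1%R]%classic) x +
       (if (0 < x)%R then expR (- (1 * x)) else 0)%:E))).
    apply: ge0_le_integral => //.
    - by move=> x _; rewrite lee_fin gamma_kernel_ge0.
    - apply: emeasurable_funD.
        by apply/measurable_restrict => //; exact: measurable_funTS.
      by apply/measurable_EFinP; exact: measurable_expRN_if.
    - move=> x _; rewrite patchE mem_setE in_itv/= /gamma_kernel.
      case: ifPn => x0 /=; last by rewrite adde0.
      rewrite mul1r; have [x1|x1] := leP x 1%R.
        rewrite -EFinD lee_fin; apply: ler_wpDr; first exact: expR_ge0.
        by rewrite ler_piMr ?powR_ge0// expR_le1 oppr_le0 ltW.
      rewrite add0e lee_fin ler_piMl ?expR_ge0//.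
      by rewrite -[leRHS](powRr0 x); apply: ler_powR; [exact: ltW|rewrite subr_le0].
  rewrite ge0_integralD//.
  - rewrite integral_expRN// -integral_mkcond lte_add_pinfty ?ltry//.
    by rewrite (le_lt_trans (integral_powR_le a0))// ltry.
  - by move=> x _; rewrite patchE; case: ifP => // _; rewrite lee_fin powR_ge0.
  - by apply/measurable_restrict => //; exact: measurable_funTS.
  - by move=> x _; rewrite lee_fin; case: ifP => // _; exact: expR_ge0.
  - by apply/measurable_EFinP; exact: measurable_expRN_if.
have E : \int[mu]_x (gamma_kernel a x)%:E = (gamma_fun a)%:E.
  rewrite /gamma_fun -integral_gamma_kernelE fineK//.
  by rewrite ge0_fin_numE// integral_ge0// => x _; rewrite lee_fin gamma_kernel_ge0.
split => //; rewrite -lte_fin -E.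
(* Positivity: on ]0, 1] the kernel is at least exp(-1), again because a <= 1. *)
apply: (@lt_le_trans _ _ (\int[mu]_(x in `]0%R, 1%R]) (expR (-1))%:E)).
  rewrite integral_cst//= lebesgue_measure_itv/= lte_fin ltr01.
  by rewrite oppr0 adde0 mule1 lte_fin expR_gt0.
apply: (@le_trans _ _ (\int[mu]_(x in `]0%R, 1%R]) (gamma_kernel a x)%:E)).
  apply: ge0_le_integral => //.
  - exact: measurable_funTS.
  - move=> x /=; rewrite in_itv/= => /andP[x0 x1]; rewrite lee_fin /gamma_kernel x0.
    rewrite -[leLHS]mul1r ler_pM// ?expR_ge0//.
      by rewrite -[leLHS](powRr0 x) ger_powR ?x0// subr_le0.
    by rewrite ler_expR lerN2.
apply: ge0_subset_integral => //.
by move=> x _; rewrite lee_fin gamma_kernel_ge0.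
Qed.

Lemma gamma_fun1 : gamma_fun (1 : R)%R = 1%R.
Proof.
have [|E _] := @integral_gamma_kernel 1%R; first by rewrite ltr01 lexx.
have := integral_expRN (@ltr01 R); rewrite invr1 => h.
apply: EFin_inj; rewrite -E -h; apply: eq_integral => x _.
by rewrite gamma_kernel1 mul1r.
Qed.

Lemma gamma_pdf_ge0 a (x : R) : (0 < a <= 1)%R -> (0 <= gamma_pdf a x)%R.
Proof.
move=> /integral_gamma_kernel[_ g0].
by rewrite gamma_pdfE mulr_ge0 ?gamma_kernel_ge0// invr_ge0 ltW.
Qed.

Lemma measurable_gamma_pdf a : measurable_fun setT (@gamma_pdf R a).
Proof.
rewrite (_ : gamma_pdf a = fun x => ((gamma_fun a)^-1 * gamma_kernel a x)%R).
  by apply: measurable_funM => //; exact: measurable_gamma_kernel.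
by apply/funext => x; rewrite gamma_pdfE.
Qed.

Lemma integral_gamma_pdf a : (0 < a <= 1)%R ->
  \int[mu]_x (gamma_pdf a x)%:E = 1.
Proof.
move=> /integral_gamma_kernel[E g0].
under eq_integral do rewrite gamma_pdfE EFinM.
rewrite ge0_integralZl//.
- by rewrite E -EFinM mulVf// gt_eqF.
- by apply/measurable_EFinP; exact: measurable_gamma_kernel.
- by move=> x _; rewrite lee_fin gamma_kernel_ge0.
- by rewrite lee_fin invr_ge0 ltW.
Qed.

End gamma.

(** * Additivity of gamma shapes *)

Section gamma_convolution.
Local Open Scope ereal_scope.
Context {R : realType}.
Local Notation mu := (@lebesgue_measure R).

Lemma gt0_powRE (x p : R) : (0 < x)%R -> (x `^ p = expR (p * ln x))%R.
Proof. by move=> x0; rewrite /powR gt_eqF. Qed.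

(** The unnormalised density of the ratio of a Gamma(b) to an independent Gamma(a) variable, a beta
    prime law. *)
Let beta_weight (a b v : R) : R :=
  if (0 < v)%R then (v `^ (b - 1) * (1 + v) `^ (- a - b))%R else 0%R.

Let beta_weight_ge0 a b v : (0 <= beta_weight a b v)%R.
Proof. by rewrite /beta_weight; case: ifP => // _; rewrite mulr_ge0 ?powR_ge0. Qed.

Let measurable_beta_weight a b : measurable_fun setT (beta_weight a b).
Proof.
apply: measurable_fun_ifT => //; first exact: measurable_fun_ltr.
apply: measurable_funM; first exact: measurable_powR.
by apply: (measurableT_comp (measurable_powR _)); exact: measurable_funD.
Qed.

(** Here x = s/(1+v) and y = x v, so that x + y = s. The factor x is the Jacobian of y = x v, and
    (1+v)^-1 that of x = s/(1+v). With all powers written as exponentials of logarithms, only the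
    exponents remain to be compared. *)
Lemma gamma_kernel_subst (a b s v : R) : (0 < s)%R -> (0 < v)%R ->
  ((1 + v)^-1 * (gamma_kernel a ((1 + v)^-1 * s) * ((1 + v)^-1 * s) *
    gamma_kernel b ((1 + v)^-1 * s * v)) =
  beta_weight a b v * gamma_kernel (a + b) s)%R.
Proof.
move=> s0 v0.
have v1 : (0 < 1 + v)%R by rewrite addr_gt0.
have c0 : (0 < (1 + v)^-1 * s)%R by rewrite mulr_gt0// invr_gt0.
have cv0 : (0 < (1 + v)^-1 * s * v)%R by rewrite mulr_gt0.
rewrite /gamma_kernel /beta_weight c0 cv0 s0 v0 !gt0_powRE//.
have lnc : ln ((1 + v)^-1 * s)%R = (ln s - ln (1 + v))%R.
  by rewrite lnM ?posrE ?invr_gt0// lnV// addrC.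
rewrite (lnM (x := ((1 + v)^-1 * s)%R)) ?posrE// lnc.
rewrite -{1}(lnK (x := ((1 + v)^-1)%R)) ?posrE ?invr_gt0// lnV ?posrE//.
rewrite -{2}(lnK (x := ((1 + v)^-1 * s)%R)) ?posrE// lnc.
rewrite -!expRD; congr expR.
have vE : ((1 + v)^-1 * s + (1 + v)^-1 * s * v = s)%R.
  by field; rewrite gt_eqF.
set L := ln (1 + v); set S := ln s; set V := ln v.
rewrite -[in RHS]vE; ring.
Qed.

(** The pair (x, y) is replaced by the ratio v = y/x and the sum s one variable at a time, with
    Tonelli in between, so that one-dimensional scalings suffice; in these coordinates the integrand
    factors. *)
Lemma gamma_kernel_conv (a b : R) (h : R -> \bar R) : nonneg_meas h ->
  \int[mu]_x \int[mu]_y ((gamma_kernel a x)%:E * (gamma_kernel b y)%:E * h (x + y)%R) =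
  \int[mu]_v (beta_weight a b v)%:E * \int[mu]_s ((gamma_kernel (a + b) s)%:E * h s).
Proof.
move=> [mh h0].
have mg c : measurable_fun setT (fun x => (gamma_kernel c x)%:E).
  by apply/measurable_EFinP; exact: measurable_gamma_kernel.
have g0 c x : 0 <= (gamma_kernel c x)%:E by rewrite lee_fin gamma_kernel_ge0.
pose K (x v : R) := (gamma_kernel a x * x * gamma_kernel b (x * v))%:E *
  h (x * (1 + v))%R.
have K1 x v : (0 <= gamma_kernel a x * x * gamma_kernel b (x * v))%R.
  have [x0|x0] := ltP 0%R x.
    by rewrite !mulr_ge0 ?gamma_kernel_ge0// ltW.
  by rewrite /gamma_kernel ltNge x0 /= !mul0r.
have K0 x v : 0 <= K x v by rewrite mule_ge0// lee_fin.
have mK : measurable_fun setT (fun z : R * R => K z.1 z.2).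
  apply: emeasurable_funM.
    apply/measurable_EFinP; apply: measurable_funM.
      apply: measurable_funM => //.
      by apply: measurableT_comp => //; exact: measurable_gamma_kernel.
    apply: measurableT_comp; first exact: measurable_gamma_kernel.
    exact: measurable_funM.
  apply: measurableT_comp => //; apply: measurable_funM => //.
  exact: measurable_funD.
transitivity (\int[mu]_x \int[mu]_v K x v).
  apply: eq_integral => x _.
  have [x0|x0] := ltP 0%R x; last first.
    rewrite !integral0_eq// => v _; rewrite /K {1}/gamma_kernel ltNge x0/=.
      by rewrite !mul0r mul0e.
    by rewrite !mul0e.
  rewrite (@ge0_integralZ_lebesgue _ x)//; last 2 first.
  - apply: emeasurable_funM.
      by apply: emeasurable_funM; [exact: measurable_cst|exact: mg].
    by apply: measurableT_comp => //; exact: measurable_funD.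
  - by move=> y; rewrite !mule_ge0.
  rewrite -ge0_integralZl//.
  - apply: eq_integral => v _; rewrite /K muleA -!EFinM mulrDr mulr1.
    by congr (_%:E * _); ring.
  - apply: emeasurable_funM.
      apply: emeasurable_funM => //.
      apply/measurable_EFinP; apply: measurableT_comp.
        exact: measurable_gamma_kernel.
      exact: measurable_funM.
    by apply: measurableT_comp => //; apply: measurable_funD => //; exact: measurable_funM.
  - by move=> y _; rewrite !mule_ge0.
  - by rewrite lee_fin ltW.
rewrite [LHS](@fubini_tonelli _ _ (measurableTypeR R) (measurableTypeR R) R
  mu mu (fun z : R * R => K z.1 z.2))//=.
set I := (X in _ = _ * X).
have I0 : 0 <= I by apply: integral_ge0 => s _; rewrite mule_ge0.
rewrite -ge0_integralZr//; last 2 first.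
- by apply/measurable_EFinP; exact: measurable_beta_weight.
- by move=> v _; rewrite lee_fin beta_weight_ge0.
apply: eq_integral => v _.
have mKv : measurable_fun setT (K^~ v).
  exact: (measurableT_comp mK (measurable_pair2 v)).
have [v0|v0] := ltP 0%R v; last first.
  rewrite integral0_eq; first by rewrite /beta_weight ltNge v0 mul0e.
  move=> x _; rewrite /K.
  have [x0|x0] := ltP 0%R x; last by rewrite {1}/gamma_kernel ltNge x0/= !mul0r mul0e.
  have xv : (x * v <= 0)%R by rewrite pmulr_rle0.
  by rewrite {2}/gamma_kernel ltNge xv/= mulr0 mul0e.
have v1 : (0 < 1 + v)%R by rewrite addr_gt0.
rewrite (@ge0_integralZ_lebesgue _ ((1 + v)^-1)%R)//; last by rewrite invr_gt0.
rewrite -[LHS]ge0_integralZl//; last 2 first.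
- by apply: (measurableT_comp mKv); exact: measurable_funM.
- by rewrite lee_fin invr_ge0 ltW.
rewrite /I -[RHS]ge0_integralZl//; last 3 first.
- by apply: emeasurable_funM => //; exact: mg.
- by move=> s _; rewrite mule_ge0.
- by rewrite lee_fin beta_weight_ge0.
apply: eq_integral => s _; rewrite /K !muleA -!EFinM.
have -> : ((1 + v)^-1 * s * (1 + v) = s)%R by field; rewrite gt_eqF.
congr (_%:E * _).
have [s0|s0] := ltP 0%R s; first exact: gamma_kernel_subst.
have cs : ((1 + v)^-1 * s <= 0)%R by rewrite pmulr_rle0// invr_gt0.
by rewrite {1 3}/gamma_kernel ![(0 < _)%R]ltNge s0 cs/= !mul0r !mulr0.
Qed.

Lemma gamma_pdf_conv (a b : R) (h : R -> \bar R) :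
  (0 < a)%R -> (0 < b)%R -> (a + b <= 1)%R -> nonneg_meas h ->
  \int[mu]_x \int[mu]_y ((gamma_pdf a x)%:E * ((gamma_pdf b y)%:E * h (x + y)%R)) =
  \int[mu]_s ((gamma_pdf (a + b) s)%:E * h s).
Proof.
move=> a0 b0 ab1 [mh h0].
have a01 : (0 < a <= 1)%R by rewrite a0; lra.
have b01 : (0 < b <= 1)%R by rewrite b0; lra.
have ab01 : (0 < a + b <= 1)%R by rewrite addr_gt0.
have [Ea ga] := integral_gamma_kernel a01.
have [Eb gb] := integral_gamma_kernel b01.
have [Eab gab] := integral_gamma_kernel ab01.
have := @gamma_pdfE R.
move: Ea ga Eb gb Eab gab; move: (@gamma_fun R) => gf Ea ga Eb gb Eab gab pdfE.
have mg c : measurable_fun setT (fun x => (gamma_kernel c x)%:E).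
  by apply/measurable_EFinP; exact: measurable_gamma_kernel.
have g0 c x : 0 <= (gamma_kernel c x)%:E by rewrite lee_fin gamma_kernel_ge0.
have C0 : 0 <= \int[mu]_v (beta_weight a b v)%:E.
  by apply: integral_ge0 => v _; rewrite lee_fin beta_weight_ge0.
(* Taking [h] = 1 in the kernel identity evaluates the beta integral. *)
have CE : \int[mu]_v (beta_weight a b v)%:E =
    (gf a * gf b / gf (a + b))%:E.
  have H : (gf a)%:E * (gf b)%:E =
      \int[mu]_v (beta_weight a b v)%:E * (gf (a + b))%:E.
    have n1 : nonneg_meas (cst (1 : \bar R)) by split => //; exact: lee01.
    transitivity (\int[mu]_x \int[mu]_y ((gamma_kernel a x)%:E *
      (gamma_kernel b y)%:E * cst (1 : \bar R) (x + y)%R)).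
      rewrite -Ea -Eb -ge0_integralZr//; last 2 first.
      - exact: mg.
      - by apply: integral_ge0 => y _; exact: g0.
      apply: eq_integral => x _; rewrite -ge0_integralZl//; last exact: mg.
      by apply: eq_integral => y _; rewrite mule1.
    apply: (eq_trans (gamma_kernel_conv a b n1)); rewrite -Eab; congr (_ * _).
    by apply: eq_integral => x _; rewrite mule1.
  move: C0 H; case: (\int[mu]_v (beta_weight a b v)%:E) => [r| |]// _.
    by rewrite -!EFinM => -[->]; rewrite mulfK// gt_eqF.
  by rewrite gt0_mulye ?lte_fin// -EFinM.
transitivity (((gf a)^-1 * (gf b)^-1)%:E *
  \int[mu]_x \int[mu]_y ((gamma_kernel a x)%:E * (gamma_kernel b y)%:E * h (x + y)%R)).
  have mF : measurable_fun setT (fun z : R * R =>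
     (gamma_kernel a z.1)%:E * (gamma_kernel b z.2)%:E * h (z.1 + z.2)%R).
    apply: emeasurable_funM.
      by apply: emeasurable_funM; apply/measurable_EFinP;
        apply: measurableT_comp => //; exact: measurable_gamma_kernel.
    by apply: measurableT_comp => //; exact: measurable_funD.
  rewrite -ge0_integralZl//; last 3 first.
  - apply: (@measurable_fun_fubini_tonelli_F _ _ (measurableTypeR R)
      (measurableTypeR R) R mu _ mF) => z.
    by rewrite !mule_ge0.
  - by move=> x _; apply: integral_ge0 => y _; rewrite !mule_ge0.
  - by rewrite lee_fin mulr_ge0// invr_ge0 ltW.
  apply: eq_integral => x _; rewrite -ge0_integralZl//; last 3 first.
  - exact: (measurableT_comp mF (measurable_pair1 x)).
  - by move=> y _; rewrite !mule_ge0.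
  - by rewrite lee_fin mulr_ge0// invr_ge0 ltW.
  apply: eq_integral => y _; rewrite !pdfE !muleA -!EFinM.
  by congr (_%:E * _); ring.
rewrite (gamma_kernel_conv a b (conj mh h0)) CE muleA -EFinM -ge0_integralZl//; last 3 first.
- by apply: emeasurable_funM => //; exact: mg.
- by move=> s _; rewrite mule_ge0.
- by rewrite lee_fin !mulr_ge0// ?invr_ge0 ltW.
apply: eq_integral => s _; rewrite pdfE muleA -EFinM.
by congr (_%:E * _); field; rewrite !gt_eqF.
Qed.

(** The operator [mop] of exp(c - p G) with G of law Gamma(a, 1). Writing it through the density
    gives it a meaning for the intermediate shapes m/k, for which no random variable is at hand. *)
Definition gop (a p c : R) (f : R -> \bar R) (y : R) : \bar R :=
  \int[mu]_x ((gamma_pdf a x)%:E * f (y * expR (c - p * x))%R).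

Lemma measurable_expR_affine (p c : R) :
  measurable_fun setT (fun x : R => expR (c - p * x)%R).
Proof.
apply: measurableT_comp; first exact: measurable_expR.
by apply: measurable_funB => //; exact: measurable_funM.
Qed.

Lemma nonneg_meas_expR_affine (p c y : R) f :
  nonneg_meas f -> nonneg_meas (fun x => f (y * expR (c - p * x))%R).
Proof.
move=> [mf f0]; split => //; apply: measurableT_comp => //.
by apply: measurable_funM => //; exact: measurable_expR_affine.
Qed.

Lemma gop_comp (a b p c c' : R) f :
  (0 < a)%R -> (0 < b)%R -> (a + b <= 1)%R -> nonneg_meas f ->
  gop a p c (gop b p c' f) = gop (a + b) p (c + c') f.
Proof.
move=> a0 b0 ab1 nf; apply/funext => y; rewrite /gop.
have a01 : (0 < a <= 1)%R by rewrite a0; lra.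
have b01 : (0 < b <= 1)%R by rewrite b0; lra.
apply: (eq_trans _ (@gamma_pdf_conv a b _ a0 b0 ab1
  (nonneg_meas_expR_affine p (c + c') y nf))).
have := fun x => gamma_pdf_ge0 x a01; have := fun x => gamma_pdf_ge0 x b01.
have := @measurable_gamma_pdf R b.
move: (gamma_pdf a) (gamma_pdf b) => pa pb mb pb0 pa0.
apply: eq_integral => x _; rewrite -[LHS]ge0_integralZl; first last.
- by rewrite lee_fin.
- by move=> z _; rewrite mule_ge0 ?lee_fin//; case: nf.
- apply: emeasurable_funM; first exact/measurable_EFinP.
  by have [] := nonneg_meas_expR_affine p c' (y * expR (c - p * x))%R nf.
- exact: measurableT.
apply: eq_integral => z _; congr (_ * (_ * f _)).
by rewrite -mulrA -expRD; congr (_ * expR _)%R; ring.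
Qed.

Lemma ge0_integral_gamma d (T : measurableType d) (P : probability T R) a
    (G : T -> R) h : (0 < a <= 1)%R -> measurable_fun setT G ->
  is_gamma P a G -> nonneg_meas h ->
  \int[P]_w h (G w) = \int[mu]_x ((gamma_pdf a x)%:E * h x).
Proof.
move=> a01 mG gG [mh h0].
pose m := pushforward P (G : T -> measurableTypeR R) : {measure set _ -> \bar R}.
transitivity (\int[m mG]_x h x).
  by rewrite [RHS]ge0_integral_pushforward.
apply: (@ge0_integral_density _ (measurableTypeR R) R mu (m mG)) => //.
  exact: measurable_gamma_pdf.
by move=> x; exact: gamma_pdf_ge0.
Qed.

Lemma mop_gamma d (T : measurableType d) (P : probability T R) a p c
    (G : T -> R) f : (0 < a <= 1)%R -> measurable_fun setT G ->
  is_gamma P a G -> nonneg_meas f ->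
  mop P (fun w => expR (c - p * G w)%R) f = gop a p c f.
Proof.
move=> a01 mG gG nf; apply/funext => y.
rewrite /mop (ge0_integral_gamma (h := fun x => f (y * expR (c - p * x))%R) a01)//.
exact: nonneg_meas_expR_affine.
Qed.

Lemma iter_mop_gamma d (T : measurableType d) (P : probability T R) (k : nat)
    p c (G : T -> R) f : (0 < k)%N -> measurable_fun setT G ->
  is_gamma P (k%:R^-1)%R G -> nonneg_meas f ->
  iter k (mop P (fun w => expR (c - p * G w)%R)) f = gop 1 p (k%:R * c) f.
Proof.
move=> k0 mG gG nf.
have k0R : (0 < k%:R :> R)%R by rewrite ltr0n.
have k01 : (0 < (k%:R^-1 : R) <= 1)%R.
  by rewrite invr_gt0 k0R/= invf_le1// ler1n.
suff H m : (m < k)%N -> iter m.+1 (mop P (fun w => expR (c - p * G w)%R)) f =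
    gop (m.+1%:R * k%:R^-1) p (m.+1%:R * c) f.
  have := H k.-1; rewrite prednK// => ->; last exact: leqnn.
  by rewrite divff ?gt_eqF.
elim: m => [_|m IH mk].
  by rewrite [iter 1 _ _]/= (mop_gamma _ _ k01 mG gG nf) !mul1r.
have mE : measurable_fun setT (fun w => expR (c - p * G w)%R).
  exact: (measurableT_comp (measurable_expR_affine p c)).
have nIH : nonneg_meas (gop (m.+1%:R * k%:R^-1) p (m.+1%:R * c) f).
  rewrite -IH; last exact: ltnW.
  by elim: m.+1 => [|n]; [exact: nf|exact: nonneg_meas_mop].
rewrite iterS IH; last exact: ltnW.
rewrite (mop_gamma _ _ k01 mG gG nIH) gop_comp; first last.
- exact: nf.
- rewrite -{1}(mul1r (k%:R^-1)%R) -mulrDl ler_pdivrMr// mul1r.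
  by rewrite nat1r ler_nat.
- by rewrite mulr_gt0// invr_gt0.
- by rewrite invr_gt0.
have -> : (k%:R^-1 + m.+1%:R * k%:R^-1 = m.+2%:R * k%:R^-1 :> R)%R.
  by rewrite -[in RHS]natr1; ring.
have -> : (c + m.+1%:R * c = m.+2%:R * c)%R by rewrite -[in RHS]natr1; ring.
by [].
Qed.

End gamma_convolution.

Section density_measure.
Local Open Scope ereal_scope.
Context d (X : measurableType d) (R : realType).

Lemma density_measure (mu : {measure set X -> \bar R}) (g : X -> R) :
  measurable_fun setT g -> (forall x, (0 <= g x)%R) ->
  exists nu : {measure set X -> \bar R},
    forall A, nu A = \int[mu]_(x in A) (g x)%:E.
Proof.
move=> mg g0.
pose nu A := \int[mu]_(x in A) (g x)%:E.
have nu0 : nu set0 = 0 by exact: integral_set0.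
have nu_ge0 A : 0 <= nu A by apply: integral_ge0 => x _; rewrite lee_fin.
have nuS : semi_sigma_additive nu.
  apply: semi_sigma_additive_nng_induced; first exact/measurable_EFinP.
  by move=> x; rewrite lee_fin.
pose nu' : {measure set X -> \bar R} :=
  HB.pack nu (isMeasure.Build _ _ _ nu nu0 nu_ge0 nuS).
by exists nu'.
Qed.

End density_measure.

(** * Exponentials of exponential variables as power densities *)

Section exponential_power.
Local Open Scope ereal_scope.
Context {R : realType}.
Local Notation mu := (@lebesgue_measure R).

Lemma gamma_pdf1 (x : R) :
  gamma_pdf 1 x = (if (0 < x)%R then expR (- x) else 0)%R.
Proof. by rewrite gamma_pdfE gamma_fun1 invr1 mul1r gamma_kernel1. Qed.

(** The density of U^(1/q) with U uniform on [0, 1], equivalently of exp(-E/q) with E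
    exponential. *)
Definition power_pdf (q : nat) (u : R) : R :=
  if (0 < u < 1)%R then (q%:R * u ^+ q.-1)%R else 0%R.

Lemma power_pdf_ge0 q u : (0 <= power_pdf q u)%R.
Proof.
by rewrite /power_pdf; case: ifP => // /andP[u0 _]; rewrite mulr_ge0// exprn_ge0// ltW.
Qed.

Lemma measurable_power_pdf q : measurable_fun setT (power_pdf q).
Proof.
apply: measurable_fun_ifT => //.
  by apply: measurable_and => //; exact: measurable_fun_ltr.
exact: measurable_funM.
Qed.

Lemma integral_power_pdf (q : nat) (t : R) : (0 < q)%N -> (0 < t <= 1)%R ->
  \int[mu]_(u in `]-oo, t]) (power_pdf q u)%:E = (t ^+ q)%:E.
Proof.
move=> q0 /andP[t0 t1].
have := @continuous_is_derive_FTC2 R (fun u => q%:R * u ^+ q.-1)%R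
  (fun u => u ^+ q)%R 0%R t t0.
rewrite expr0n gtn_eqF// subr0 => <-.
- rewrite integral_itv_bndoo; last first.
    by apply/measurable_EFinP; apply: measurable_funTS; exact: measurable_funM.
  rewrite -integral_itv_bndo_bndc; last first.
    apply/measurable_EFinP; apply: measurable_funTS.
    exact: measurable_power_pdf.
  rewrite [LHS]integral_mkcond [RHS]integral_mkcond.
  apply: eq_integral => u _; rewrite !patchE !mem_setE !in_itv/= /power_pdf.
  have [ut|tu] := ltP u t; rewrite ?andbF// andbT.
  by rewrite (lt_le_trans ut t1) andbT; case: ifP.
- move=> u _; split; first exact: exprn_derivable.
  by rewrite exp_derive1.
- move=> u _; apply: (@continuousM _ R^o); first exact: cst_continuous.
  exact: exprn_continuous.
Qed.

(** Both sides are integrals against image measures on the line, which are compared on rays: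
    P(exp(-E/q) <= t) = P(E >= - q ln t) = t^q for 0 < t < 1. *)
Lemma ge0_integral_expR_power (q : nat) (F : R -> \bar R) : (0 < q)%N ->
  nonneg_meas F ->
  \int[mu]_x ((gamma_pdf 1 x)%:E * F (expR (- (q%:R^-1 * x)))%R) =
  \int[mu]_u ((power_pdf q u)%:E * F u).
Proof.
move=> q0 [mF F0].
have qR : (0 < q%:R :> R)%R by rewrite ltr0n.
have g0 (x : R) : (0 <= gamma_pdf 1 x)%R by apply: gamma_pdf_ge0; rewrite ltr01 lexx.
have [nu1 nu1E] := @density_measure _ (measurableTypeR R) R mu (gamma_pdf 1)
  (@measurable_gamma_pdf R 1) g0.
have [nu2 nu2E] := @density_measure _ (measurableTypeR R) R mu (power_pdf q)
  (measurable_power_pdf q) (power_pdf_ge0 q).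
have mphi : measurable_fun setT (fun x : measurableTypeR R => expR (- (q%:R^-1 * x)) : R)%R.
  apply: measurableT_comp; first exact: measurable_expR.
  by apply: measurableT_comp => //; exact: measurable_funM.
have mid : measurable_fun setT (fun x : measurableTypeR R => x : R) by [].
pose m1 := pushforward nu1 (fun x : measurableTypeR R => expR (- (q%:R^-1 * x)) : R)%R
  : {measure set _ -> \bar R}.
pose m2 := pushforward nu2 (fun x : measurableTypeR R => x : R)
  : {measure set _ -> \bar R}.
have mFphi : measurable_fun setT (fun x : R => F (expR (- (q%:R^-1 * x)))%R).
  exact: (measurableT_comp mF mphi).
transitivity (\int[m1 mphi]_u F u).
  rewrite [RHS]ge0_integral_pushforward//.
  apply/esym; exact: (@ge0_integral_density _ (measurableTypeR R) R mu nu1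
    (gamma_pdf 1) (fun x => F (expR (- (q%:R^-1 * x)))%R)
    (@measurable_gamma_pdf R 1) g0 (fun A _ => nu1E A) mFphi (fun x => F0 _)).
transitivity (\int[m2 mid]_u F u); last first.
  rewrite [LHS]ge0_integral_pushforward//.
  exact: (@ge0_integral_density _ (measurableTypeR R) R mu nu2
    (power_pdf q) F (measurable_power_pdf q) (power_pdf_ge0 q)
    (fun A _ => nu2E A) mF F0).
have m1T : m1 mphi setT = 1.
  rewrite /m1/= /pushforward preimage_setT [LHS]nu1E.
  by rewrite integral_gamma_pdf// ltr01 lexx.
have ray (t : R) : (0 < t < 1)%R -> m1 mphi `]-oo, t]%classic = (t ^+ q)%:E.
  move=> /andP[t0 t1].
  rewrite /m1/= /pushforward [LHS]nu1E.
  pose b : R := (- (q%:R * ln t))%R.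
  have b0 : (0 < b)%R by rewrite oppr_gt0 pmulr_rlt0// ln_lt0// t0.
  have -> : (fun x : measurableTypeR R => expR (- (q%:R^-1 * x)) : R)%R @^-1`
      `]-oo, t]%classic = `[b, +oo[%classic.
    have E (x : R) : (expR (- (q%:R^-1 * x)) <= t)%R = (b <= x)%R.
      rewrite -[X in (_ <= X)%R = _](lnK (x := t)) ?posrE// ler_expR.
      by rewrite lerNl ler_pdivlMl// mulrN.
    by apply/seteqP; split => x /=; rewrite !in_itv/= andbT E.
  rewrite -integral_itv_obnd_cbnd; last first.
    by apply/measurable_EFinP; apply: measurable_funTS; exact: measurable_gamma_pdf.
  have dE (x : R) : is_derive x (1:R)%R (fun x => - expR (- x))%R (expR (- x))%R.
    by apply: is_derive_eq; rewrite /GRing.scale/=; ring.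
  have := @ge0_is_derive_FTC2y R (fun x => expR (- x)) (fun x => - expR (- x))%R b 0%R.
  rewrite sub0r opprK /b opprK expRM_natl lnK ?posrE// => <-.
  - rewrite [LHS]integral_mkcond; apply: eq_integral => x _.
    rewrite patchE mem_setE in_itv/= andbT gamma_pdf1.
    by case: ifPn => // bx; rewrite (lt_trans b0 bx).
  - by move=> x _; exact: expR_ge0.
  - by move=> x _; apply: is_derive_has_derivative.
  - move=> x _; apply: (@has_derivative_continuous _ _ _ (- expR (- x))%R).
    apply: is_derive_has_derivative.
    by apply: is_derive_eq; rewrite /GRing.scale/=; ring.
  - by rewrite -oppr0; apply: cvgN; exact: cvgr_expR.
have m2T : m2 mid `]-oo, 1%R]%classic = 1.
  by rewrite /m2/= /pushforward [LHS]nu2E integral_power_pdf ?ltr01 ?lexx// expr1n.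
have m2out : m2 mid `]1%R, +oo[%classic = 0.
  rewrite /m2/= /pushforward [LHS]nu2E integral0_eq// => u /=.
  by rewrite in_itv/= andbT /power_pdf => u1; rewrite [(u < 1)%R]ltNge ltW// andbF.
have m2TT : m2 mid setT = 1.
  rewrite -(setUv `]-oo, 1%R]%classic) setCitvl measureU//.
    by rewrite [X in X + _]m2T [X in _ + X]m2out adde0.
  by rewrite -setCitvl setICr.
apply: eq_measure_integral => A mA _.
apply: finite_measure_eq_rays => //.
- by rewrite [X in X < _]m1T ltry.
- by rewrite [LHS]m1T [RHS]m2TT.
move=> t.
have [t0|t0] := leP t 0%R.
  rewrite /m1 /m2/= /pushforward [LHS]nu1E [RHS]nu2E.
  rewrite !integral0_eq// => x /=; rewrite in_itv/=.
    by move=> xt; rewrite /power_pdf [(0 < x)%R]ltNge (le_trans xt t0).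
  by rewrite leNgt (le_lt_trans t0 (expR_gt0 _)).
have [t1|t1] := ltP t 1%R.
  rewrite ray ?t0// /m2/= /pushforward [RHS]nu2E integral_power_pdf// t0 ltW//.
(* For t >= 1 both rays carry the full mass 1. *)
apply/eqP; rewrite eq_le; apply/andP; split.
  apply: (@le_trans _ _ (m1 mphi setT)).
    by apply: le_measure; rewrite ?inE.
  rewrite [X in X <= _]m1T -[X in X <= _]m2T; apply: le_measure; rewrite ?inE//.
  by apply: subset_itvl; rewrite bnd_simp.
apply: (@le_trans _ _ (m2 mid setT)).
  by apply: le_measure; rewrite ?inE.
rewrite [X in X <= _]m2TT -[X in X <= _]m1T.
rewrite /m1/= /pushforward [X in X <= _]nu1E [X in _ <= X]nu1E preimage_setT.
rewrite (_ : _ @^-1` `]-oo, t]%classic = [set x : R | expR (- (q%:R^-1 * x)) <= t]%R); last first.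
  by apply/seteqP; split => x /=; rewrite in_itv.
rewrite [leRHS]integral_mkcond.
apply: ge0_le_integral => //.
- by move=> x _; rewrite lee_fin.
- by apply/measurable_EFinP; exact: measurable_gamma_pdf.
- apply/measurable_restrict => //.
    rewrite (_ : [set x | _] = (fun x : measurableTypeR R => expR (- (q%:R^-1 * x)) : R)%R
      @^-1` `]-oo, t]%classic).
      by rewrite -[X in measurable X]setTI; apply: (mphi) => //; exact: measurable_itv.
    by apply/seteqP; split => x /=; rewrite in_itv.
  by apply/measurable_EFinP; apply: measurable_funTS; exact: measurable_gamma_pdf.
- move=> x _; rewrite patchE gamma_pdf1; case: ifPn => x0; last by case: ifP.
  rewrite ifT ?lexx//; apply/mem_set => /=; apply: (le_trans _ t1).
  by rewrite expR_le1 oppr_le0 mulr_ge0 ?invr_ge0 ?(ltW x0)// ltW.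
Qed.

Lemma gop1_power (q : nat) (c : R) f y : (0 < q)%N -> nonneg_meas f ->
  gop 1 (q%:R^-1)%R c f y =
  \int[mu]_u ((power_pdf q u)%:E * f (y * (expR c * u))%R).
Proof.
move=> q0 [mf f0]; rewrite /gop.
have nF : nonneg_meas (fun u => f (y * (expR c * u))%R).
  split => //; apply: measurableT_comp => //.
  by apply: measurable_funM => //; exact: measurable_funM.
apply: (eq_trans _ (ge0_integral_expR_power q0 nF)).
by apply: eq_integral => x _; rewrite expRD.
Qed.

End exponential_power.

(** * Coordinates of a uniform point on a sphere *)

Section sphere_density.
Local Open Scope ereal_scope.
Context {R : realType}.
Local Notation mu := (@lebesgue_measure R).

(** Up to a constant, the density of one coordinate of a uniform point on the sphere of squared
    radius 2(m+1) in dimension 2m+3. *)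
Definition sphere_fun (m : nat) (x : R) : R :=
  if (x ^+ 2 < m.+1.*2%:R)%R then ((1 - x ^+ 2 / m.+1.*2%:R) ^+ m)%R else 0%R.

Lemma sphere_fun_ge0 m x : (0 <= sphere_fun m x)%R.
Proof.
rewrite /sphere_fun; case: ifP => // x2; rewrite exprn_ge0// subr_ge0.
by rewrite ler_pdivrMr// mul1r ltW.
Qed.

Lemma measurable_sphere_fun m : measurable_fun setT (sphere_fun m).
Proof.
apply: measurable_fun_ifT => //.
  by apply: measurable_fun_ltr => //; exact: measurable_funX.
apply: measurable_funX; apply: measurable_funB => //.
by apply: measurable_funM => //; exact: measurable_funX.
Qed.

Lemma measurable_invr : measurable_fun setT (@GRing.inv R).
Proof.
rewrite (_ : GRing.inv = fun x : R =>
    if (0 < x)%R then (x `^ (-1))%R else (- (- x) `^ (-1))%R).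
  apply: measurable_fun_ifT; first exact: measurable_fun_ltr.
    exact: measurable_powR.
  apply: measurableT_comp => //.
  by apply: (measurableT_comp (measurable_powR _)).
apply/funext => x; have [x0|x0] := ltP 0%R x.
  by rewrite powR_inv1// ltW.
by rewrite powR_inv1 ?oppr_ge0// invrN opprK.
Qed.

(** The operator of a Rademacher sign; [mop_rademacher] makes the link. *)
Definition rop (f : R -> \bar R) (y : R) : \bar R :=
  2^-1%:E * (f y + f (- y)%R).

Lemma ge0_integralN_lebesgue (f : R -> \bar R) : nonneg_meas f ->
  \int[mu]_x f x = \int[mu]_x f (- x)%R.
Proof.
move=> [mf f0].
have mo : measurable_fun setT (-%R : measurableTypeR R -> measurableTypeR R) by [].
pose m := pushforward mu (-%R : measurableTypeR R -> measurableTypeR R)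
  : {measure set _ -> \bar R}.
transitivity (\int[m mo]_x f x).
  by apply: eq_measure_integral => A mA _; apply/esym; exact: lebesgue_measureN.
by rewrite [LHS]ge0_integral_pushforward.
Qed.

(** For q = 1 the power density is uniform, so a sign times a uniform variable on ]0, sqrt
    2[ is uniform on ]-sqrt 2, sqrt 2[: the coordinate law on the ordinary sphere of three-space
    (Archimedes). *)
Lemma rop_gop_sphere0 (c : R) f : (expR c ^+ 2 = 2)%R -> nonneg_meas f ->
  rop (gop 1 (1%N%:R^-1) c f) 1 =
  ((2 * expR c)^-1)%:E * \int[mu]_x ((sphere_fun 0 x)%:E * f x).
Proof.
move=> c2 nf; have [mf f0] := nf.
set e := expR c in c2 *; have e0 : (0 < e)%R by exact: expR_gt0.
pose I (x : R) : R := if (0 < x < e)%R then 1%R else 0%R.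
have mI : measurable_fun setT I.
  by apply: measurable_fun_ifT => //; apply: measurable_and => //; exact: measurable_fun_ltr.
have I0 x : (0 <= I x)%R by rewrite /I; case: ifP.
have nI g : nonneg_meas g -> nonneg_meas (fun x => (I x)%:E * g x).
  move=> [mg g0]; split; last by move=> x; rewrite mule_ge0// lee_fin.
  by apply: emeasurable_funM => //; exact/measurable_EFinP.
have gE y g : nonneg_meas g -> (forall u, g u = f (y * u)%R) ->
    gop 1 (1%N%:R^-1) c f y = (e^-1)%:E * \int[mu]_x ((I x)%:E * g x).
  move=> ng gE; rewrite gop1_power//.
  have [mIg Ig0] := nI _ ng.
  rewrite [X in _ = _ * X](@ge0_integralZ_lebesgue _ e)//.
  rewrite [RHS]muleA -EFinM mulVf ?gt_eqF// mul1e.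
  apply: eq_integral => u _; rewrite gE; congr (_%:E * _).
  rewrite /power_pdf /I expr0 mulr1 pmulr_rgt0//.
  by rewrite -{2}(mulr1 e) ltr_pM2l.
have nf' : nonneg_meas (fun u => f (- u)%R).
  by split => //; apply: measurableT_comp.
rewrite /rop (gE 1%R f)//; last by move=> u; rewrite mul1r.
rewrite (gE (-1)%R (fun u => f (- u)%R))//; last by move=> u; rewrite mulN1r.
rewrite -muleDr//; last first.
  by rewrite ge0_adde_def// inE integral_ge0// => x _; rewrite mule_ge0 ?lee_fin.
rewrite muleA -EFinM -invfM; congr (_ * _).
rewrite [X in _ + X]ge0_integralN_lebesgue; last exact: nI.
under [X in _ + X]eq_integral do rewrite opprK.
have mI' : measurable_fun setT (fun x : R => (I (- x)%R)%:E).
  by apply/measurable_EFinP; exact: (measurableT_comp mI).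
rewrite -ge0_integralD//; last 4 first.
- by move=> x _; apply (nI _ nf).2.
- exact: (nI _ nf).1.
- by move=> x _; rewrite mule_ge0// lee_fin.
- by apply: emeasurable_funM => //.
(* At 0 the two one-sided indicators vanish while [sphere_fun 0] is 1, so this null point is
   removed. *)
rewrite [RHS](_ : _ = \int[mu]_(x in setT `\ 0%R) ((sphere_fun 0 x)%:E * f x)); last first.
  rewrite integral_setD1//; first exact: measurableD.
  apply: measurable_funTS; apply: emeasurable_funM => //.
  by apply/measurable_EFinP; exact: measurable_sphere_fun.
rewrite [LHS](_ : _ = \int[mu]_(x in setT `\ 0%R) ((I x)%:E * f x + (I (- x))%:E * f x)); last first.
  rewrite integral_setD1//; first exact: measurableD.
  apply: measurable_funTS; apply: emeasurable_funD; apply: emeasurable_funM => //.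
  exact/measurable_EFinP.
apply: eq_integral => x /set_mem[_ /= /eqP x0].
rewrite -ge0_muleDl ?lee_fin//; congr (_ * _); rewrite -EFinD; congr EFin.
have xe : (x ^+ 2 < 1.*2%:R)%R = (`|x| < e)%R.
  by rewrite -[(1.*2)%:R]c2 -real_normK ?num_real// ltr_pXn2r// ?nnegrE// ltW.
rewrite /I /sphere_fun expr0 xe oppr_gt0.
have [x1|x1|x1] := ltrgt0P x; last by rewrite x1 eqxx in x0.
  by rewrite /=; case: ifP; rewrite addr0.
by rewrite /= add0r; case: ifP.
Qed.

(** The integral is, up to a constant, the density at z of a level m coordinate times e
    U^(1/(2m+3)). The condition on e sends the squared radius 2(m+1) to 2(m+2). With t the square of
    z over the new squared radius, the integrand is a multiple of u (u^2 - t)^m on t < u^2 < 1, an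
    exact derivative. *)
Lemma integral_power_sphere (m : nat) (e z : R) : (0 < e)%R ->
  (e ^+ 2 = m.+2%:R / m.+1%:R)%R ->
  \int[mu]_u (power_pdf m.+1.*2.+1 u * ((e * u)^-1 * sphere_fun m ((e * u)^-1 * z)))%:E =
  (m.+1.*2.+1%:R / (m.+1.*2%:R * e) * sphere_fun m.+1 z)%:E.
Proof.
move=> e0 e2.
set t : R := (z ^+ 2 / m.+2.*2%:R)%R.
have t0 : (0 <= t)%R by rewrite divr_ge0// sqr_ge0.
have m1 : (m.+1%:R != 0 :> R)%R by rewrite pnatr_eq0.
have m2 : (m.+2%:R != 0 :> R)%R by rewrite pnatr_eq0.
have d2 n : (n.*2%:R = 2 * n%:R :> R)%R by rewrite -mul2n natrM.
pose f (u : R) : R := (m.+1.*2.+1%:R / e * (u * (u ^+ 2 - t) ^+ m))%R.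
have E (u : R) : (0 < u)%R -> (((e * u)^-1 * z) ^+ 2 = t / u ^+ 2 * m.+1.*2%:R)%R.
  move=> u0; rewrite exprMn exprVn exprMn e2 /t !d2.
  move: (m.+1%:R : R)%R (m.+2%:R : R)%R m1 m2 => a b a0 b0.
  by field; rewrite ?a0 ?b0 ?gt_eqF.
have integrand (u : R) :
    (power_pdf m.+1.*2.+1 u * ((e * u)^-1 * sphere_fun m ((e * u)^-1 * z)) =
    if (0 < u < 1) && (t < u ^+ 2) then f u else 0)%R.
  rewrite /power_pdf; case: ifPn => [/andP[u0 u1]|]; last by rewrite mul0r.
  rewrite /sphere_fun E// gtr_pMl// ltr_pdivrMr ?exprn_gt0// mul1r.
  case: ifPn => tu; last by rewrite !mulr0.
  rewrite mulfK ?pnatr_eq0// /f [_.-1]/=.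
  have -> : (u ^+ 2 - t = u ^+ 2 * (1 - t / u ^+ 2))%R.
    by field; rewrite gt_eqF.
  (* The part (u^2)^m clears the denominators of (1 - t/u^2)^m; the remaining u * u, divided by e u,
     leaves the single u that makes [f] a derivative. *)
  have -> : (u ^+ m.+1.*2 = u * u * (u ^+ 2) ^+ m)%R.
    by rewrite doubleS exprS exprS mulrA -mul2n exprM.
  rewrite [in RHS]exprMn.
  move: (m.+1.*2.+1%:R)%R ((u ^+ 2) ^+ m)%R ((1 - t / u ^+ 2) ^+ m)%R => a b b' /=.
  by field; rewrite !gt_eqF.
have zt : (z ^+ 2 < m.+2.*2%:R)%R = (t < 1)%R by rewrite ltr_pdivrMr// mul1r.
rewrite [sphere_fun m.+1 z]/sphere_fun -/t zt.
have [t1|t1] := ltP t 1%R; last first.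
  rewrite mulr0 integral0_eq// => u _; rewrite integrand ifF//.
  apply/negP => /andP[/andP[u0 u1] tu].
  by move: t1; rewrite leNgt (lt_trans tu)// expr_lt1// ltW.
pose s := Num.sqrt t.
have s0 : (0 <= s)%R by exact: sqrtr_ge0.
have s2 : (s ^+ 2 = t)%R by rewrite sqr_sqrtr.
have s1 : (s < 1)%R by rewrite -(ltr_pXn2r (n := 2))// ?nnegrE// s2 expr1n.
have cf u : {for u, continuous f}.
  rewrite /f; apply: (@continuousM _ R^o); first exact: cst_continuous.
  apply: (@continuousM _ R^o) => //.
  apply: (@continuous_comp _ R^o R^o (fun u : R => u ^+ 2 - t)%R (fun x : R => x ^+ m)%R).
    apply: (@continuousB _ _ R^o); [exact: exprn_continuous|exact: cst_continuous].
  exact: exprn_continuous.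
have mf : measurable_fun setT f by exact: continuous_measurable_fun.
have := @continuous_is_derive_FTC2 R f
  (fun u => m.+1.*2.+1%:R / (m.+1.*2%:R * e) * (u ^+ 2 - t) ^+ m.+1)%R s 1%R s1.
rewrite s2 subrr expr0n mulr0 subr0 expr1n => <-.
- rewrite integral_itv_bndoo; last exact/measurable_EFinP/measurable_funTS.
  rewrite [RHS]integral_mkcond; apply: eq_integral => u _.
  rewrite patchE mem_setE in_itv/= integrand.
  have [u0|u0] := ltP 0%R u; last first.
    by rewrite [(s < u)%R]ltNge (le_trans u0 s0).
  have -> : (t < u ^+ 2)%R = (s < u)%R by rewrite -s2 ltr_pXn2r ?nnegrE// ltW.
  by rewrite andTb andbC; case: ifP.
- move=> u _; apply: is_derive_has_derivative.
  have du : is_derive u (1:R)%R (fun u : R => u ^+ 2 - t)%R (2 * u)%R.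
    have h : is_derive u (1:R)%R (fun u : R => u * u - t)%R (2 * u)%R.
      by apply: is_derive_eq; rewrite /GRing.scale/=; ring.
    exact: h.
  have dX := @is_deriveX _ _ (fun u : R => u ^+ 2 - t)%R m.+1 u (1:R)%R _ du.
  have dX' : is_derive u (1:R)%R (fun u : R => (u ^+ 2 - t) ^+ m.+1)%R
      (m.+1%:R * (u ^+ 2 - t) ^+ m * (2 * u))%R.
    rewrite (_ : (fun u : R => (u ^+ 2 - t) ^+ m.+1)%R =
      ((fun u : R => u ^+ 2 - t) ^+ m.+1)%R); first exact: dX.
    by apply/funext => v; rewrite fctE.
  apply: is_derive_eq; rewrite /GRing.scale/= /f d2.
  move: ((u ^+ 2 - t) ^+ m)%R => p.
  move: (m.+1.*2.+1%:R)%R (m.+1%:R : R)%R m1 => a b b0.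
  by field; rewrite ?b0 ?gt_eqF.
- by move=> u _; exact: cf.
Qed.

(** At fixed u the substitution x = z/(e u) frees the argument of [f] from u; after a second Tonelli
    exchange the inner integral is [integral_power_sphere]. *)
Lemma gop_sphere (m : nat) (c : R) f :
  (expR c ^+ 2 = m.+2%:R / m.+1%:R)%R -> nonneg_meas f ->
  \int[mu]_x ((sphere_fun m x)%:E * gop 1 (m.+1.*2.+1%:R^-1)%R c f x) =
  (m.+1.*2.+1%:R / (m.+1.*2%:R * expR c))%:E *
    \int[mu]_x ((sphere_fun m.+1 x)%:E * f x).
Proof.
move=> c2 nf; have [mf f0] := nf.
have e0 : (0 < expR c :> R)%R by exact: expR_gt0.
set e := expR c in c2 e0 *.
have ms := @measurable_sphere_fun; have mp := @measurable_power_pdf R.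
pose q := m.+1.*2.+1.
have p0 u : (0 <= power_pdf q u)%R by exact: power_pdf_ge0.
have K0 : (0 <= m.+1.*2.+1%:R / (m.+1.*2%:R * e))%R.
  by rewrite divr_ge0// mulr_ge0// ltW.
transitivity (\int[mu]_x \int[mu]_u
   ((power_pdf q u)%:E * ((sphere_fun m x)%:E * f (x * (e * u))%R))).
  apply: eq_integral => x _; rewrite gop1_power// -ge0_integralZl.
  - by apply: eq_integral => u _; rewrite muleCA.
  - exact: measurableT.
  - apply: emeasurable_funM; first by apply/measurable_EFinP; exact: mp.
    by apply: measurableT_comp => //; apply: measurable_funM => //; exact: measurable_funM.
  - by move=> u _; apply: mule_ge0; [rewrite lee_fin; exact: p0|exact: f0].
  - by rewrite lee_fin sphere_fun_ge0.
rewrite [LHS](@fubini_tonelli _ _ (measurableTypeR R) (measurableTypeR R) R mu mu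
  (fun z : R * R => (power_pdf q z.2)%:E *
    ((sphere_fun m z.1)%:E * f (z.1 * (e * z.2))%R)))/=; last 2 first.
- apply: emeasurable_funM; first by apply/measurable_EFinP; exact: measurableT_comp (mp q) _.
  apply: emeasurable_funM.
    by apply/measurable_EFinP; exact: measurableT_comp (ms m) _.
  by apply: measurableT_comp => //; apply: measurable_funM => //; exact: measurable_funM.
- by move=> z; apply: mule_ge0; [rewrite lee_fin; exact: p0|
      apply: mule_ge0; [rewrite lee_fin; exact: sphere_fun_ge0|exact: f0]].
transitivity (\int[mu]_u \int[mu]_z
  ((power_pdf q u * ((e * u)^-1 * sphere_fun m ((e * u)^-1 * z)))%:E * f z)).
  apply: eq_integral => u _.
  have [u0|u0] := ltP 0%R u; last first.
    have -> : power_pdf q u = 0%R by rewrite /power_pdf ltNge u0.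
    by rewrite !integral0_eq// => x _; rewrite ?mul0r mul0e.
  have eu : (0 < (e * u)^-1)%R by rewrite invr_gt0 mulr_gt0.
  rewrite [LHS](@ge0_integralZ_lebesgue _ ((e * u)^-1)%R)//; last 2 first.
  - apply: measurable_funeM; apply: emeasurable_funM.
      by apply/measurable_EFinP; exact: ms.
    by apply: measurableT_comp => //; exact: measurable_funM.
  - by move=> x; apply: mule_ge0; [rewrite lee_fin; exact: p0|
      apply: mule_ge0; [rewrite lee_fin; exact: sphere_fun_ge0|exact: f0]].
  rewrite -ge0_integralZl//.
  - apply: eq_integral => x _; rewrite !muleA -!EFinM.
    have -> : ((e * u)^-1 * x * (e * u) = x)%R by field; rewrite !gt_eqF.
    by congr (_%:E * _); ring.
  - apply: measurable_funeM; apply: emeasurable_funM.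
      apply/measurable_EFinP; apply: (measurableT_comp (ms m)).
      exact: measurable_funM.
    by apply: measurableT_comp => //; apply: measurable_funM => //; exact: measurable_funM.
  - by move=> x _; apply: mule_ge0; [rewrite lee_fin; exact: p0|
      apply: mule_ge0; [rewrite lee_fin; exact: sphere_fun_ge0|exact: f0]].
  - by rewrite lee_fin ltW.
have m_inv : measurable_fun setT (fun u : R => (e * u)^-1)%R.
  by apply: (measurableT_comp measurable_invr); exact: measurable_funM.
have pos u z : (0 <= power_pdf q u * ((e * u)^-1 * sphere_fun m ((e * u)^-1 * z)))%R.
  have [u0|u0] := ltP 0%R u; last first.
    by rewrite /power_pdf ltNge u0/= mul0r.
  apply: mulr_ge0; [exact: p0|apply: mulr_ge0; last exact: sphere_fun_ge0].
  by rewrite invr_ge0 mulr_ge0 ?ltW.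
have mps : measurable_fun setT (fun z : R * R =>
    (power_pdf q z.1 * ((e * z.1)^-1 * sphere_fun m ((e * z.1)^-1 * z.2)))%R).
  apply: measurable_funM; first exact: measurableT_comp (mp q) _.
  have m1 : measurable_fun setT (fun z : R * R => (e * z.1)^-1)%R.
    exact: measurableT_comp m_inv _.
  apply: measurable_funM => //; apply: (measurableT_comp (ms m)).
  exact: measurable_funM.
rewrite [LHS](@fubini_tonelli _ _ (measurableTypeR R) (measurableTypeR R) R mu mu
  (fun z : R * R =>
  (power_pdf q z.1 * ((e * z.1)^-1 * sphere_fun m ((e * z.1)^-1 * z.2)))%:E * f z.2))/=; last 2 first.
- by apply: emeasurable_funM; [exact/measurable_EFinP|exact: measurableT_comp].
- by move=> z; apply: mule_ge0; [rewrite lee_fin; exact: pos|exact: f0].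
rewrite -[RHS]ge0_integralZl//.
- apply: eq_integral => z _; rewrite ge0_integralZr//.
  + by rewrite integral_power_sphere// muleA EFinM.
  + by apply/measurable_EFinP; exact: (measurableT_comp mps (measurable_pair2 z)).
  + by move=> u _; rewrite lee_fin; exact: pos.
- by apply: emeasurable_funM => //; apply/measurable_EFinP; exact: ms.
- by move=> z _; apply: mule_ge0; [rewrite lee_fin; exact: sphere_fun_ge0|exact: f0].
Qed.

End sphere_density.

(** * Convergence of the sphere densities to the Gaussian *)

Section sphere_limit.
Local Open Scope ereal_scope.
Context {R : realType}.
Local Notation mu := (@lebesgue_measure R).

Lemma nonneg_meas_gop (a p c : R) f : (0 < a <= 1)%R ->
  nonneg_meas f -> nonneg_meas (gop a p c f).
Proof.
move=> a01 [mf f0]; rewrite /gop.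
have := @measurable_gamma_pdf R a; have := fun x => @gamma_pdf_ge0 R a x a01.
move: (gamma_pdf a) => g g0 mg; split; last first.
  by move=> x; apply: integral_ge0 => y _; rewrite mule_ge0 ?lee_fin.
apply: (@measurable_fun_fubini_tonelli_F _ _ R (measurableTypeR R) R mu
  (fun z : R * R => (g z.2)%:E * f (z.1 * expR (c - p * z.2))%R)).
- apply: emeasurable_funM.
    by apply/measurable_EFinP; exact: (measurableT_comp mg).
  apply: measurableT_comp => //; apply: measurable_funM => //.
  exact: (measurableT_comp (measurable_expR_affine p c)).
- by move=> z; rewrite mule_ge0 ?lee_fin.
Qed.

Lemma gop_cst1 (a p c : R) : (0 < a <= 1)%R -> gop a p c (cst 1) = cst 1.
Proof.
move=> a01; apply/funext => y; rewrite /gop.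
under eq_integral do rewrite mule1.
exact: integral_gamma_pdf.
Qed.

(** exp(2 [half_log] j) is the ratio (j+1)/j of consecutive squared radii, and for j = 0 the first
    squared radius 2. Divided by k, these are the logarithmic constants in the law of W. *)
Definition half_log (j : nat) : R :=
  (if j is 0%N then ln 2 / 2 else ln (1 + j%:R^-1) / 2)%R.

Definition sphere_op (m : nat) (f : R -> \bar R) : \bar R :=
  rop (foldr (fun j => gop 1 (j.*2.+1%:R^-1)%R (half_log j)) f (iota 0 m.+1)) 1%R.

Let one01 : (0 < (1 : R) <= 1)%R. Proof. by rewrite ltr01 lexx. Qed.

Lemma sphere_op_cst1 m : sphere_op m (cst 1) = 1.
Proof.
rewrite /sphere_op (_ : foldr _ _ _ = cst 1).
  by rewrite /rop/= -EFinD -EFinM; congr EFin; field.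
by elim: (iota 0 m.+1) => //= j s ->; exact: gop_cst1.
Qed.

(** The constant stays unspecified until [sphere_op_cst1] identifies it as the inverse of the total
    mass of [sphere_fun m]. The new factor sits at the end of the list, so it acts on [f] first and
    the induction hypothesis is used at its image. *)
Lemma sphere_opE m : exists2 C : R, (0 <= C)%R &
  forall f, nonneg_meas f ->
  sphere_op m f = C%:E * \int[mu]_x ((sphere_fun m x)%:E * f x).
Proof.
elim: m => [|m [C C0 IH]].
  exists ((2 * expR (half_log 0))^-1)%R.
    by rewrite invr_ge0 mulr_ge0// expR_ge0.
  move=> f nf; rewrite -rop_gop_sphere0//.
  by rewrite -expRM_natl /half_log mulrC divfK// lnK// posrE.
exists (C * (m.+1.*2.+1%:R / (m.+1.*2%:R * expR (half_log m.+1))))%R.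
  by rewrite mulr_ge0// divr_ge0// mulr_ge0// expR_ge0.
move=> f nf.
rewrite EFinM -muleA -gop_sphere//; last first.
  rewrite -expRM_natl /half_log mulrC divfK// lnK.
    have := @pnatr_eq0 R m.+1; rewrite -[m.+2%:R]nat1r.
    by move: (m.+1%:R : R)%R => a h; field; rewrite h.
  by rewrite posrE addr_gt0// invr_gt0.
rewrite -IH; last exact: nonneg_meas_gop.
by rewrite /sphere_op -[in LHS](addn1 m.+1) iotaD foldr_cat add0n.
Qed.

(** With s = x^2/(2(m+1)), so that m s = x^2/2 - s, the inequality 1 + y <= exp y at y = -s and at y
    = s/(1-s) gives exp(-m s/(1-s)) <= (1-s)^m <= exp(-m s). *)
Lemma cvg_sphere_fun (x : R) :
  sphere_fun m x @[m --> \oo] --> expR (- (x ^+ 2 / 2))%R.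
Proof.
pose s (m : nat) : R := (x ^+ 2 / 2 * (m.+1%:R)^-1)%R.
have s0 : s m @[m --> \oo] --> (0:R)%R.
  rewrite -[X in _ --> X](mulr0 (x ^+ 2 / 2)%R).
  by apply: cvgMr; exact: cvg_harmonic.
have sx m : (x ^+ 2 / m.+1.*2%:R = s m)%R.
  rewrite /s -mul2n natrM; have := @pnatr_eq0 R m.+1.
  by move: (m.+1%:R)%R => a h; field; rewrite h.
have ms m : (m%:R * s m = x ^+ 2 / 2 - s m)%R.
  rewrite /s; have := @pnatr_eq0 R m.+1; rewrite -natr1.
  by move: (m%:R)%R => a h; field; rewrite h.
have s_ge0 m : (0 <= s m)%R by rewrite mulr_ge0 ?divr_ge0 ?sqr_ge0 ?invr_ge0.
have cexp (u : nat -> R) (l : R) : u m @[m --> \oo] --> l ->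
    expR (u m) @[m --> \oo] --> expR l.
  by move=> ul; apply: continuous_cvg => //; exact: continuous_expR.
apply: (@squeeze_cvgr _ _ _ _
  (fun m => expR (- ((x ^+ 2 / 2 - s m) / (1 - s m))))%R
  (fun m => expR (- (x ^+ 2 / 2 - s m)))%R).
- have : \forall m \near \oo, (s m < 2^-1)%R.
    by apply: (cvgr_lt _ s0); rewrite invr_gt0.
  apply: filterS => m sm.
  have s1 : (0 < 1 - s m)%R by lra.
  rewrite /sphere_fun sx.
  rewrite (_ : (x ^+ 2 < m.+1.*2%:R)%R); last first.
    by rewrite -[ltRHS]mul1r -ltr_pdivrMr// sx; lra.
  rewrite -ms; apply/andP; split; last first.
    rewrite -[(- (m%:R * s m))%R]mulrN expRM_natl lerXn2r ?nnegrE ?expR_ge0 ?(ltW s1)//.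
    by rewrite (le_trans _ (expR_ge1Dx _)).
  rewrite (_ : (- (m%:R * s m / (1 - s m)) = m%:R * - (s m / (1 - s m)))%R);
    last by move: (s m) => z; rewrite [RHS]mulrN [in RHS]mulrA.
  rewrite expRM_natl lerXn2r ?nnegrE ?expR_ge0 ?(ltW s1)//.
  rewrite expRN -[leRHS]invrK lef_pV2 ?posrE ?expR_gt0 ?invr_gt0//.
  rewrite (le_trans _ (expR_ge1Dx _))//.
  by rewrite le_eqVlt; apply/orP; left; apply/eqP; field; rewrite gt_eqF.
- apply: cexp; apply: cvgN.
  rewrite -[X in _ --> X]divr1; apply: cvgM.
    rewrite -[X in _ --> X]subr0; apply: cvgB => //; exact: cvg_cst.
  have c1 : (1 - s m)%R @[m --> \oo] --> (1 : R)%R.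
    by rewrite -[X in _ --> X](subr0 (1:R)%R); apply: cvgB => //; exact: cvg_cst.
  by apply: cvgV => //; exact: oner_neq0.
- apply: cexp; apply: cvgN.
  by rewrite -[X in _ --> X]subr0; apply: cvgB => //; exact: cvg_cst.
Qed.

(** A bound uniform in m, for dominated convergence. For m >= 1 it rests on m/(2(m+1)) >= 1/4; for m
    = 0 the factor exp(1/2) compensates exp(-x^2/4) on the support x^2 < 2. *)
Lemma sphere_fun_le (m : nat) (x : R) :
  (sphere_fun m x <= expR 2^-1 * expR (- (x ^+ 2 / 4)))%R.
Proof.
rewrite -expRD /sphere_fun; case: ifPn => x2; last exact: expR_ge0.
case: m x2 => [|m] x2.
  rewrite expr0 -[leLHS]expR0 ler_expR.
  by have : (x ^+ 2 < 2)%R by []; lra.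
have m0 : (0 < m.+2.*2%:R :> R)%R by rewrite ltr0n.
apply: (@le_trans _ _ (expR (- (x ^+ 2 / m.+2.*2%:R)) ^+ m.+1)%R).
  rewrite lerXn2r ?nnegrE ?expR_ge0//.
    by rewrite subr_ge0 ler_pdivrMr// mul1r ltW.
  by rewrite (le_trans _ (expR_ge1Dx _)).
rewrite -expRM_natl ler_expR mulrN.
have h : (x ^+ 2 / 4 <= m.+1%:R * (x ^+ 2 / m.+2.*2%:R))%R.
  rewrite mulrCA ler_wpM2l ?sqr_ge0// ler_pdivlMr//.
  rewrite -mul2n natrM -[m.+2%:R]natr1.
  have : (1 <= m.+1%:R :> R)%R by rewrite ler1n.
  lra.
by have : (0 <= 2^-1 :> R)%R by []; lra.
Qed.

Lemma integrable_gauss_bound :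
  mu.-integrable setT (fun x : R => (expR 2^-1 * expR (- (x ^+ 2 / 4)))%:E).
Proof.
have s2 : (Num.sqrt 2 ^+ 2 = 2 :> R)%R by rewrite sqr_sqrtr.
have s0 : (Num.sqrt 2 != 0 :> R)%R by rewrite gt_eqF// sqrtr_gt0.
have p0 := normal_peak_gt0 s0.
(* Up to a constant, the bound is the normal density of variance 2. *)
have := @integrable_normal_pdf R 0 (Num.sqrt 2).
move=> /(integrableZl measurableT (expR 2^-1 / normal_peak (Num.sqrt 2) : R)%R).
apply: eq_integrable => // x _.
rewrite -EFinM normal_pdfE// /normal_fun subr0 s2; congr EFin.
rewrite mulrA divfK ?gt_eqF//; congr (_ * expR _)%R.
by rewrite mulNr -mulr_natr; congr (- (_ / _))%R; ring.
Qed.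

Lemma cvg_integral_sphere_fun (A : set R) : measurable A ->
  \int[mu]_(x in A) (sphere_fun m x)%:E @[m --> \oo] -->
  \int[mu]_(x in A) (expR (- (x ^+ 2 / 2)))%:E.
Proof.
move=> mA.
have D1 n : measurable_fun A (fun x : measurableTypeR R => (sphere_fun n x)%:E).
  apply: measurable_funTS; apply/measurable_EFinP.
  exact: measurable_sphere_fun.
have D2 : measurable_fun A (fun x : measurableTypeR R => (expR (- (x ^+ 2 / 2)))%:E).
  apply: measurable_funTS; apply/measurable_EFinP.
  apply: measurableT_comp; first exact: measurable_expR.
  by apply: measurableT_comp => //; apply: measurable_funM => //; exact: measurable_funX.
have D3 : {ae mu, forall x : R, A x ->
    (sphere_fun n x)%:E @[n --> \oo] --> (expR (- (x ^+ 2 / 2)))%:E}.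
  apply/aeW => x _; apply: cvg_EFin; first exact: nearW.
  exact: cvg_sphere_fun.
have D4 : mu.-integrable (A : set (measurableTypeR R))
    (fun x : R => (expR 2^-1 * expR (- (x ^+ 2 / 4)))%:E).
  exact: (@integrableS _ (measurableTypeR R) R mu setT A _ measurableT mA
    (subsetT _) integrable_gauss_bound).
have D5 : {ae mu, forall (x : R) n, A x ->
    `|(sphere_fun n x)%:E| <= (expR 2^-1 * expR (- (x ^+ 2 / 4)))%:E}.
  apply/aeW => x n _; rewrite gee0_abs ?lee_fin ?sphere_fun_ge0//.
  exact: sphere_fun_le.
by have [] := @dominated_convergence _ (measurableTypeR R) R mu A mA
  (fun m x => (sphere_fun m x)%:E) (fun x : R => (expR (- (x ^+ 2 / 2)))%:E)
  (fun x : R => (expR 2^-1 * expR (- (x ^+ 2 / 4)))%:E) D1 D2 D3 D4 D5.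
Qed.

(** [sphere_op m] of an indicator is the mass of [A] under [sphere_fun m] over the total mass. Both
    masses converge, and the Gaussian constant cancels in the limit of the quotient. *)
Lemma cvg_sphere_op (A : set R) : measurable A ->
  sphere_op m (fun x => (\1_A x)%:E) @[m --> \oo] --> normal_prob 0 1 A.
Proof.
move=> mA.
have p0 : (0 < normal_peak (1:R))%R by apply: normal_peak_gt0; exact: oner_neq0.
set pk := normal_peak (1 : R) in p0.
have gE (x : R) : expR (- (x ^+ 2 / 2)) = (pk^-1 * normal_pdf 0 1 x)%R.
  rewrite normal_pdfE ?oner_neq0// mulrA mulVf ?gt_eqF// mul1r /normal_fun.
  by rewrite subr0 expr1n mulNr.
have mn : measurable_fun setT (fun x : R => (normal_pdf 0 1 x)%:E).
  by apply/measurable_EFinP; exact: measurable_normal_pdf.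
have intE B : measurable B -> \int[mu]_(x in B) (expR (- (x ^+ 2 / 2)))%:E =
    (pk^-1)%:E * normal_prob 0 1 B.
  move=> mB; under eq_integral do rewrite gE EFinM.
  rewrite ge0_integralZl//.
  - exact: measurable_funTS.
  - by move=> x _; rewrite lee_fin normal_pdf_ge0.
  - by rewrite lee_fin invr_ge0 ltW.
have sle B m : measurable B -> \int[mu]_(x in B) (sphere_fun m x)%:E \is a fin_num.
  move=> mB; apply: integrable_fin_num => //.
  apply: (@le_integrable _ (measurableTypeR R) R mu B mB
    _ (fun x : R => (expR 2^-1 * expR (- (x ^+ 2 / 4)))%:E)).
  - by apply: measurable_funTS; apply/measurable_EFinP; exact: measurable_sphere_fun.
  - move=> x _ /=; rewrite lee_fin !ger0_norm ?sphere_fun_ge0//.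
      exact: sphere_fun_le.
  - exact: (integrableS measurableT mB (subsetT _) integrable_gauss_bound).
have nfin B : measurable B -> (normal_prob 0 1 B : \bar R) \is a fin_num.
  move=> mB; exact: fin_num_measure.
pose a m := fine (\int[mu]_(x in A) (sphere_fun m x)%:E).
pose b m := fine (\int[mu]_x (sphere_fun m x)%:E).
have ca : a m @[m --> \oo] --> (pk^-1 * fine (normal_prob 0 1 A))%R.
  have := cvg_integral_sphere_fun mA; rewrite intE// -(fineK (nfin _ mA)) -EFinM.
  by move/fine_cvg.
have cb : b m @[m --> \oo] --> (pk^-1)%R.
  have := cvg_integral_sphere_fun measurableT; rewrite intE//.
  rewrite [normal_prob 0 1 setT]probability_setT mule1.
  by move/fine_cvg.
have E m : sphere_op m (fun x => (\1_A x)%:E) = (a m / b m)%:E.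
  have [C C0 CE] := sphere_opE m.
  have n1 : nonneg_meas (cst (1 : \bar R)) by split.
  have := CE _ n1; rewrite sphere_op_cst1.
  under eq_integral do rewrite mule1.
  rewrite -(fineK (sle _ m measurableT)) -/(b m) -EFinM => -[].
  move=> Cb; rewrite CE; last exact: nonneg_meas_indic.
  have b0 : (b m != 0)%R.
    by apply/eqP => b0; move: Cb => /eqP; rewrite b0 mulr0 oner_eq0.
  have -> : C = ((b m)^-1)%R by rewrite -[C](mulfK b0) -Cb mul1r.
  rewrite [(a m / b m)%R]mulrC EFinM; congr (_ * _).
  rewrite /a fineK ?sle// [RHS]integral_mkcond; apply: eq_integral => x _.
  by rewrite patchE indicE; case: ifP; rewrite ?mule1 ?mule0.
rewrite (_ : (fun m => _) = (fun m => (a m / b m)%:E)); last first.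
  by apply/funext => m; exact: E.
rewrite -(fineK (nfin _ mA)).
apply: cvg_EFin; first exact: nearW.
rewrite (_ : fine _ = ((pk^-1 * fine (normal_prob 0 1 A)) / pk^-1)%R); last first.
  by rewrite mulrAC divff ?mul1r// invr_eq0 gt_eqF.
apply: cvgM => //; apply: cvgV => //.
by rewrite invr_eq0 gt_eqF.
Qed.

End sphere_limit.

(** * Passage to the limit *)

Section limits_in_law.
Local Open Scope ereal_scope.
Context {R : realType}.

Lemma product_probability d1 d2 (T1 : measurableType d1) (T2 : measurableType d2)
    (P1 : probability T1 R) (P2 : probability T2 R) :
  exists P : probability (T1 * T2)%type R, forall f,
    measurable_fun setT f -> (forall z, 0 <= f z) ->
    \int[P]_z f z = \int[P1]_x \int[P2]_y f (x, y).
Proof.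
have PT : (P1 \x P2) setT = 1.
  rewrite -setXTT product_measure1E//.
  by rewrite [X in X * _]probability_setT [X in _ * X]probability_setT mule1.
pose P : probability (T1 * T2)%type R := HB.pack (P1 \x P2)
  (Measure_isProbability.Build _ _ _ (P1 \x P2) PT).
exists P => f mf f0; exact: fubini_tonelli1.
Qed.

(** A power of an operator is realised as the operator of one variable on a product space. The same
    space serves every n and the limit, so pointwise convergence is preserved, which is what
    [cvg_law_eq] takes as input. *)
Lemma iter_mop_limit d (T : measurableType d) (P : probability T R)
    (X : nat -> T -> R) (X' : T -> R) (k : nat) :
  (forall n, measurable_fun setT (X n)) -> measurable_fun setT X' ->
  (forall w, X n w @[n --> \oo] --> X' w) ->
  exists (d' : measure_display) (T' : measurableType d') (P' : probability T' R)
    (Y : nat -> T' -> R) (Y' : T' -> R),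
  [/\ forall n, measurable_fun setT (Y n), measurable_fun setT Y',
      (forall w, Y n w @[n --> \oo] --> Y' w),
      (forall n f, nonneg_meas f -> mop P' (Y n) f = iter k (mop P (X n)) f) &
      (forall f, nonneg_meas f -> mop P' Y' f = iter k (mop P X') f)].
Proof.
move=> mX mX' XX'; elim: k => [|k [d' [T' [P' [Y [Y' [mY mY' YY' YE Y'E]]]]]]].
  exists d, T, P, (fun _ _ => 1%R), (fun _ => 1%R).
  have E f : nonneg_meas f -> mop P (fun _ => 1%R) f = f.
    move=> nf; apply/funext => y; rewrite /mop mulr1 integral_cst//=.
    by rewrite [P _]probability_setT mule1.
  by split => // w; exact: cvg_cst.
have [PP PPE] := product_probability P P'.
have E (U : T -> R) (V : T' -> R) f : measurable_fun setT U ->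
    measurable_fun setT V -> nonneg_meas f ->
    mop PP (fun z => U z.1 * V z.2)%R f = mop P U (mop P' V f).
  move=> mU mV [mf f0]; apply/funext => y; rewrite /mop PPE//=.
    by apply: eq_integral => w _; apply: eq_integral => v _; rewrite mulrA.
  apply: measurableT_comp => //; apply: measurable_funM => //.
  by apply: measurable_funM => //; exact: measurableT_comp.
exists _, (T * T')%type, PP, (fun n z => X n z.1 * Y n z.2)%R, (fun z => X' z.1 * Y' z.2)%R.
split.
- by move=> n; apply: measurable_funM; exact: measurableT_comp.
- by apply: measurable_funM; exact: measurableT_comp.
- by move=> w; apply: cvgM.
- by move=> n f nf; rewrite E// YE.
- by move=> f nf; rewrite E// Y'E.
Qed.

(** Fatou's lemma: when Y' w lies in the open set U, so does Y n w for all large n, hence the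
    indicator at Y' is at most the lower limit of the indicators at Y n. *)
Lemma cvg_open_le d (T : measurableType d) (P : probability T R)
    (Y : nat -> T -> R) (Y' : T -> R) (U : set R) (l : \bar R) :
  (forall n, measurable_fun setT (Y n)) -> measurable_fun setT Y' ->
  (forall w, Y n w @[n --> \oo] --> Y' w) -> open U ->
  P (Y n @^-1` U) @[n --> \oo] --> l -> P (Y' @^-1` U) <= l.
Proof.
move=> mY mY' YY' oU Pl.
have mU : measurable U by exact: open_measurable.
have mYU n : measurable (Y n @^-1` U).
  by rewrite -[X in measurable X]setTI; exact: mY.
have mY'U : measurable (Y' @^-1` U).
  by rewrite -[X in measurable X]setTI; exact: mY'.
have -> : P (Y' @^-1` U) = \int[P]_w (\1_(Y' @^-1` U) w)%:E.
  by rewrite integral_indic// setIT.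
have mI n : measurable_fun setT (fun w => (\1_(Y n @^-1` U) w)%:E : \bar R).
  by apply/measurable_EFinP; exact: measurable_indic.
have := @fatou _ T R P setT measurableT (fun n w => (\1_(Y n @^-1` U) w)%:E) mI.
have -> : limn_einf (fun n => \int[P]_w (\1_(Y n @^-1` U) w)%:E) = l.
  rewrite (_ : (fun n => _) = (fun n => P (Y n @^-1` U))); last first.
    by apply/funext => n; rewrite integral_indic// setIT.
  have := is_cvg_limn_einfE (cvgP _ Pl); rewrite (cvg_lim _ Pl)//.
move=> h; apply: (le_trans _ (h _)); last by move=> n w _; rewrite lee_fin.
apply: ge0_le_integral => //.
- by apply/measurable_EFinP; exact: measurable_indic.
- rewrite (_ : (fun w => _) =
      (fun w => - limn_esup (-%E \o (fun n => (\1_(Y n @^-1` U) w)%:E)))); last first.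
    by apply/funext => w; rewrite limn_esupN oppeK.
  apply: measurableT_comp => //; apply: measurable_fun_limn_esup => n.
  exact: measurableT_comp.
- move=> w _.
  have ge0 : 0 <= limn_einf (fun n => (\1_(Y n @^-1` U) w)%:E : \bar R).
    rewrite limn_einf_lim; apply: lime_ge; first exact: is_cvg_einfs.
    by apply: nearW => n; apply: le_ereal_inf_tmp => _ [i _ <-]; rewrite lee_fin.
  rewrite indicE; case: (boolP (w \in _)) => // /set_mem/= Uw.
  have : \forall n \near \oo, (\1_(Y n @^-1` U) w)%:E = 1 :> \bar R.
    have : \forall n \near \oo, U (Y n w).
      by apply: (YY' w); exact: open_nbhs_nbhs.
    by apply: filterS => n Un; rewrite indicE mem_set.
  move=> near1.
  have c1 : (\1_(Y n @^-1` U) w)%:E @[n --> \oo] --> (1 : \bar R).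
    exact: cvg_near_cst.
  by have := is_cvg_limn_einfE (cvgP _ c1); rewrite (cvg_lim _ c1)// => ->.
Qed.

(** Upper bounds on open sets suffice on the line: ]-oo, x] is approached from outside by the open
    rays ending at x + 1/(n+1), and ]x, +oo[ is open. Two such inequalities between pairs with the
    same sum 1 are equalities. *)
Lemma cvg_law_eq d (T : measurableType d) (P : probability T R)
    (N : {measure set R -> \bar R}) (Y : nat -> T -> R) (Y' : T -> R) :
  (forall n, measurable_fun setT (Y n)) -> measurable_fun setT Y' ->
  (forall w, Y n w @[n --> \oo] --> Y' w) -> N setT = 1 ->
  (forall A, measurable A -> P (Y n @^-1` A) @[n --> \oo] --> N A) ->
  forall A, measurable A -> P (Y' @^-1` A) = N A.
Proof.
move=> mY mY' YY' NT PN A mA.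
have open_le U : open U -> P (Y' @^-1` U) <= N U.
  move=> oU; apply: (cvg_open_le mY mY' YY' oU); apply: PN.
  exact: open_measurable.
have Nfin B : measurable B -> N B \is a fin_num.
  move=> mB; rewrite ge0_fin_numE//.
  apply: (@le_lt_trans _ _ (N setT)); first by apply: le_measure; rewrite ?inE.
  by rewrite NT ltry.
have mY'B B : measurable B -> measurable (Y' @^-1` B).
  by move=> mB; rewrite -[X in measurable X]setTI; exact: mY'.
pose m := pushforward P Y' : {measure set _ -> \bar R}.
apply: (finite_measure_eq_rays (m1 := m mY')) => //.
- by rewrite /m/= /pushforward preimage_setT [P _]probability_setT ltry.
- by rewrite /m/= /pushforward preimage_setT [P _]probability_setT NT.
move=> x; rewrite [LHS](_ : _ = P (Y' @^-1` `]-oo, x]%classic))//.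
have le1 : P (Y' @^-1` `]-oo, x]%classic) <= N `]-oo, x]%classic.
  have cN : N `]-oo, (x + n.+1%:R^-1)%R]%classic @[n --> \oo] --> N `]-oo, x]%classic.
    rewrite [X in _ --> N X](@itvNycEbigcap R false x).
    apply: nonincreasing_cvg_mu => //.
    - by rewrite -ge0_fin_numE// Nfin.
    - exact: bigcap_measurable.
    - move=> i j ij; apply/subsetPset; apply: subset_itvl.
      by rewrite bnd_simp lerD2l lef_pV2 ?posrE// ler_nat.
  rewrite -(cvg_lim _ cN)//; apply: lime_ge; first by apply/cvg_ex; eexists; exact: cN.
  apply: nearW => n.
  apply: (@le_trans _ _ (P (Y' @^-1` `]-oo, (x + n.+1%:R^-1)%R[%classic))).
    apply: le_measure; rewrite ?inE; [exact: mY'B|exact: mY'B|].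
    by apply: preimage_subset; apply: subset_itvl; rewrite bnd_simp ltrDl.
  apply: (le_trans (open_le _ _)); first exact: interval_open.
  by apply: le_measure; rewrite ?inE//; apply: subset_itvl; rewrite bnd_simp.
have le2 : P (Y' @^-1` `]x, +oo[%classic) <= N `]x, +oo[%classic.
  by apply: open_le; exact: interval_open.
have sumN : N `]-oo, x]%classic + N `]x, +oo[%classic = 1.
  by rewrite -NT -(setUv `]-oo, x]%classic) setCitvl measureU// -setCitvl setICr.
have sumP : P (Y' @^-1` `]-oo, x]%classic) + P (Y' @^-1` `]x, +oo[%classic) = 1.
  rewrite -measureU//; [|exact: mY'B|exact: mY'B|].
    by rewrite -preimage_setU -setCitvl setUv preimage_setT [LHS]probability_setT.
  by rewrite -preimage_setI -setCitvl setICr preimage_set0.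
have P1 := @fin_num_measure _ _ _ P _ (mY'B _ (measurable_itv `]-oo, x])).
have P2 := @fin_num_measure _ _ _ P _ (mY'B _ (measurable_itv `]x, +oo[)).
have N1 := Nfin _ (measurable_itv `]-oo, x]).
have N2 := Nfin _ (measurable_itv `]x, +oo[).
move: le1 le2 sumN sumP.
rewrite -(fineK P1) -(fineK P2) -(fineK N1) -(fineK N2) -!EFinD !lee_fin.
by move=> h1 h2 [h3] [h4]; congr EFin; lra.
Qed.

End limits_in_law.

(** * Almost sure convergence of the series *)

Section deterministic_convergence.
Context {R : realType}.

Lemma bounded_cvg_series (u : nat -> R) (M : R) :
  (forall n, \sum_(0 <= j < n) `|u j| <= M) -> cvgn (series u).
Proof.
move=> uM; apply: normed_cvg; apply: nondecreasing_is_cvgn.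
  by apply: nondecreasing_series => n _ _; exact: normr_ge0.
by exists M => _ [n _ <-]; exact: uM.
Qed.

Lemma sum_inv_sqr_le (n : nat) : \sum_(0 <= m < n) (m.+1%:R ^+ 2)^-1 <= 2 :> R.
Proof.
(* The slack 2/(n+1) makes the bound inductive. *)
suff : \sum_(0 <= m < n) (m.+1%:R ^+ 2)^-1 <= 2 - 2 * n.+1%:R^-1 :> R.
  by move/le_trans; apply; rewrite gerBl mulr_ge0// invr_ge0.
elim: n => [|n IH]; first by rewrite big_nil invr1 mulr1 subrr.
rewrite big_nat_recr//=; apply: (le_trans (lerD IH (lexx _))).
have : 1 <= n.+1%:R :> R by rewrite ler1n.
rewrite -[n.+2%:R]natr1; move: (n.+1%:R : R) => x x1.
have x0 : 0 < x by lra.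
rewrite -subr_ge0 (_ : _ - _ = (x - 1) / (x ^+ 2 * (x + 1))).
  by rewrite divr_ge0 ?subr_ge0// mulr_ge0 ?exprn_ge0 ?addr_ge0// ltW.
by field; rewrite !gt_eqF// addr_gt0.
Qed.

Lemma sum_ln_telescope (n : nat) :
  \sum_(1 <= j < n.+1) ln (1 + j%:R^-1) = ln n.+1%:R :> R.
Proof.
elim: n => [|n IH]; first by rewrite big_geq// ln1.
rewrite big_nat_recr//= IH -lnM ?posrE ?addr_gt0 ?invr_gt0//.
congr ln; rewrite mulrDr mulr1 divff ?pnatr_eq0//.
by rewrite natr1.
Qed.

(** Both bounds are ln(1 + y) <= y, at y = 1/j and at y = -1/(j+1), since 1 + 1/j is the inverse of
    1 - 1/(j+1). *)
Lemma ln_inv_bounds (j : nat) : (0 < j)%N ->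
  (j.+1%:R^-1 : R) <= ln (1 + j%:R^-1 : R) <= j%:R^-1.
Proof.
move=> j0; have j0R : 0 < j%:R :> R by rewrite ltr0n.
have jV : 0 < j%:R^-1 :> R by rewrite invr_gt0.
apply/andP; split; last first.
  by apply: le_ln1Dx; rewrite (lt_trans _ jV)// ltrN10.
have E : 1 + j%:R^-1 = (1 - j.+1%:R^-1)^-1 :> R.
  have := @pnatr_eq0 R j; have := @pnatr_eq0 R j.+1; rewrite -natr1.
  rewrite gtn_eqF//; move: (j%:R : R) => x h1 h2.
  have -> : 1 - (x + 1)^-1 = x / (x + 1) by field; rewrite h1.
  by rewrite invf_div; field; rewrite h2 -lt0n.
have p : 0 < 1 - j.+1%:R^-1 :> R by rewrite -invr_gt0 -E addr_gt0.
rewrite E lnV ?posrE// lerNr.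
by apply: le_ln1Dx; rewrite ltrN2 invf_lt1 ?ltr1n// ltnS.
Qed.

(** k times the mean of the j-th term [W_term], because [G j] has mean 1/k. *)
Definition half_log_defect (j : nat) : R :=
  j.*2.+1%:R^-1 - 2^-1 * ln (1 + j%:R^-1).

(** Both terms of the defect lie between 1/(2(j+1)) and 1/(2j); the lengths of these intervals
    telescope. *)
Lemma half_log_defect_le (j : nat) : (0 < j)%N ->
  `|half_log_defect j| <= 2^-1 * (j%:R^-1 - j.+1%:R^-1).
Proof.
move=> j0; have /andP[l u] := ln_inv_bounds j0.
have j0R : 0 < j%:R :> R by rewrite ltr0n.
have dE : j.*2.+1%:R = 2 * j%:R + 1 :> R by rewrite -natr1 -mul2n natrM.
have h1 : 2^-1 * j.+1%:R^-1 <= j.*2.+1%:R^-1 :> R.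
  rewrite -invfM lef_pV2 ?posrE ?mulr_gt0// dE -[j.+1%:R]natr1; lra.
have h2 : j.*2.+1%:R^-1 <= 2^-1 * j%:R^-1 :> R.
  rewrite -invfM lef_pV2 ?posrE ?mulr_gt0// dE; lra.
rewrite /half_log_defect ler_norml.
move: {dE} l u h1 h2; move: (ln _) => y.
move: (j.*2.+1%:R^-1) (j.+1%:R^-1) (j%:R^-1) => p q r l u h1 h2.
by apply/andP; split; lra.
Qed.

Lemma cvg_half_log_defect :
  cvgn (fun n => \sum_(1 <= j < n.+1) half_log_defect j).
Proof.
have H : cvgn (series (fun j => half_log_defect j.+1)).
  apply: (@bounded_cvg_series _ 2^-1) => n.
  apply: (@le_trans _ _ (\sum_(0 <= j < n) 2^-1 * (j.+1%:R^-1 - j.+2%:R^-1))).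
    by apply: ler_sum => j _; exact: half_log_defect_le.
  rewrite -mulr_sumr -[leRHS]mulr1 ler_wpM2l ?invr_ge0//.
  rewrite (eq_bigr (fun j => - (j.+2%:R^-1) - - (j.+1%:R^-1))); last first.
    by move=> j _; rewrite opprK addrC.
  by rewrite telescope_sumr// invr1 opprK addrC gerBl invr_ge0.
rewrite (_ : (fun n => \sum_(1 <= j < n.+1) half_log_defect j) =
  series (fun j => half_log_defect j.+1))//.
by apply/funext => n; rewrite big_add1.
Qed.

Lemma cube_floor (n : nat) : exists m, (m ^ 3 <= n < m.+1 ^ 3)%N.
Proof.
elim: n => [|n [m /andP[h1 h2]]]; first by exists 0%N.
have [h|h] := ltnP n.+1 (m.+1 ^ 3); first by exists m; rewrite h leqW.
exists m.+1; rewrite h/= (leq_ltn_trans h2)// ltn_exp2r//.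
Qed.

(** Between (m+1)^3 and (m+2)^3 the sequence [t] is monotone and a ln grows by at most 3a/(m+1), so
    the values at the two cubes enclose the intermediate ones up to a vanishing error. *)
Lemma cvg_cubes (a : R) (t : nat -> R) : 0 <= a ->
  (forall n, t n <= t n.+1) ->
  cvgn (fun m => t (m.+1 ^ 3)%N - a * ln (m.+1 ^ 3)%:R) ->
  cvgn (fun n => t n.+1 - a * ln n.+1%:R).
Proof.
move=> a0 tS /cvg_ex[/= l tl]; apply/cvg_ex; exists l.
have tnd := @homo_leq R t <=%R (@lexx _ R) (@le_trans _ R) tS.
apply/cvgrPdist_lt => e e0.
have e4 : 0 < e / 4 by rewrite divr_gt0.
move/cvgrPdist_lt : tl => /(_ _ e4)[M _ Ml].
have ln3 (m : nat) : ln (m.+2 ^ 3)%:R - ln (m.+1 ^ 3)%:R <= 3 * m.+1%:R^-1 :> R.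
  rewrite !natrX !lnXn// -mulrnBl -[leLHS]mulr_natl ler_wpM2l//.
  rewrite -ln_div ?posrE//.
  have -> : m.+2%:R / m.+1%:R = 1 + m.+1%:R^-1 :> R.
    by rewrite -[m.+2%:R]natr1 mulrDl divff ?pnatr_eq0// mul1r.
  by have /andP[_] := @ln_inv_bounds m.+1 isT.
(* 12 = 3 * 4: from this rank on, the logarithmic increment 3a/(m+1) is at most e/4. *)
pose M' := maxn M (Num.truncn (a * 12 / e)).+1.
near=> n.
have nM : (M'.+1 ^ 3 <= n.+1)%N.
  near: n; exists (M'.+1 ^ 3)%N => // n /= h; exact: leqW.
have [m /andP[mn nm]] := cube_floor n.+1.
have M'm : (M' < m)%N.
  rewrite ltnNge; apply/negP => mM'.
  have : (m.+1 ^ 3 <= M'.+1 ^ 3)%N by rewrite leq_exp2r.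
  by move/leq_trans => /(_ _ nM); rewrite leqNgt nm.
case: m mn nm M'm => // m mn nm; rewrite ltnS => M'm.
have Mm : (M <= m)%N by apply: leq_trans M'm; exact: leq_maxl.
have am : a * (3 * m.+1%:R^-1) <= e / 4.
  have : a * 12 / e <= m.+1%:R.
    apply: ltW; apply: (lt_le_trans (truncnS_gt _)); rewrite ler_nat.
    by apply: (leq_trans (leq_maxr M _)); exact: leqW.
  rewrite ler_pdivrMr// mulrA ler_pdivrMr//.
  move: (m.+1%:R : R) => x; lra.
have := Ml _ Mm; have := Ml _ (leqW Mm) => /=.
rewrite !ltr_distlC => /andP[h1 h2] /andP[h3 h4].
have t1 := tnd _ _ mn; have t2 := tnd _ _ (ltnW nm).
have n1 : ln (m.+1 ^ 3)%:R <= ln n.+1%:R :> R.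
  by rewrite ler_ln ?posrE ?ltr0n ?expn_gt0// ler_nat.
have n2 : ln n.+1%:R <= ln (m.+2 ^ 3)%:R :> R.
  by rewrite ler_ln ?posrE ?ltr0n ?expn_gt0// ler_nat ltnW.
have n3 : a * (ln (m.+2 ^ 3)%:R - ln (m.+1 ^ 3)%:R) <= e / 4.
  by apply: le_trans am; rewrite ler_wpM2l.
have n4 : a * ln (m.+1 ^ 3)%:R <= a * ln n.+1%:R by rewrite ler_wpM2l.
have n5 : a * ln n.+1%:R <= a * ln (m.+2 ^ 3)%:R by rewrite ler_wpM2l.
move: n3 h1 h2 h3 h4; rewrite mulrBr => n3 h1 h2 h3 h4.
apply/andP; split; lra.
Unshelve. all: by end_near. Qed.

Lemma cvg_W_partial (T : Type) (k : nat) (G : nat -> T -> R) (w : T) (M : R) :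
  (0 < k)%N -> (forall j, 0 <= G j w) ->
  (forall n, \sum_(0 <= m < n) m.+1%:R ^+ 2 *
    (\sum_(m ^ 3 <= j < m.+1 ^ 3) (G j w - k%:R^-1) / j.*2.+1%:R) ^+ 2 <= M) ->
  cvgn (W_partial k G w).
Proof.
move=> k0 G0 GM.
pose a : R := k%:R^-1.
have a0 : 0 <= a by rewrite invr_ge0.
have k2 : (k.*2)%:R^-1 = a / 2 :> R by rewrite -mul2n natrM invfM mulrC.
pose u m := \sum_(m ^ 3 <= j < m.+1 ^ 3) (G j w - a) / j.*2.+1%:R.
(* With x = m+1, |u| = |x u| x^-1 <= x^2 u^2 + x^-2: the bound on the weighted squares becomes
   absolute summability of the block sums. *)
have cu : cvgn (series u).
  apply: (@bounded_cvg_series _ (M + 2)) => n.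
  apply: (@le_trans _ _ (\sum_(0 <= m < n) (m.+1%:R ^+ 2 * u m ^+ 2 + (m.+1%:R ^+ 2)^-1))).
    apply: ler_sum => m _.
    have : 0 < m.+1%:R :> R by [].
    rewrite -exprMn -exprVn; move: (m.+1%:R : R) => x x0.
    have -> : `|u m| = `|x * u m| * x^-1.
      by rewrite normrM (gtr0_norm x0); field; rewrite gt_eqF.
    rewrite -(real_normK (num_real (x * u m))).
    have := sqr_ge0 (`|x * u m| - x^-1).
    have : 0 <= `|x * u m| * x^-1 by rewrite mulr_ge0// invr_ge0 ltW.
    rewrite sqrrB; lra.
  by rewrite big_split/= lerD// sum_inv_sqr_le.
pose t n := \sum_(1 <= j < n) G j w / j.*2.+1%:R.
have tS n : t n <= t n.+1.
  rewrite /t; case: n => [|n]; first by rewrite !big_geq.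
  by rewrite [leRHS]big_nat_recr//= lerDl divr_ge0.
have WE n : W_partial k G w n.+1 = t n.+1 - a / 2 * ln n.+1%:R.
  by rewrite /W_partial /t -sum_ln_telescope mulr_sumr -sumrB -k2.
suff : cvgn (fun n => W_partial k G w n.+1).
  by case/cvg_ex => l Wl; apply/cvg_ex; exists l; rewrite -cvg_shiftS.
rewrite (_ : (fun n => _) = (fun n => t n.+1 - a / 2 * ln n.+1%:R)); last first.
  by apply/funext => n; exact: WE.
apply: cvg_cubes => //; first by rewrite divr_ge0.
have uE n : series u n = \sum_(0 <= j < n ^ 3) (G j w - a) / j.*2.+1%:R.
  rewrite /series/=; elim: n => [|n IH]; first by rewrite !big_geq.
  by rewrite big_nat_recr//= IH -big_cat_nat// leq_exp2r.
have cubeS m : (m.+1 ^ 3)%N = ((m.+1 ^ 3).-1).+1 by rewrite prednK// expn_gt0.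
pose D n := \sum_(1 <= j < n.+1) half_log_defect j.
have E m : t (m.+1 ^ 3)%N - a / 2 * ln (m.+1 ^ 3)%:R =
    (* Block 0 consists of j = 0 alone, which [W_partial] omits, so its term is subtracted; [D]
       accounts for centring by a/(2j+1) instead of by the logarithms. *)
    series u m.+1 - (G 0 w - a) + a * D (m.+1 ^ 3).-1.
  rewrite uE /D /t cubeS -sum_ln_telescope.
  rewrite [_.+1.-1]/= [X in _ = X - _ + _]big_ltn//.
  rewrite (_ : (0.*2.+1)%:R = 1 :> R)// divr1 [X in _ = X + _]addrAC subrr add0r.
  rewrite !mulr_sumr -sumrB -big_split/=; apply: eq_bigr => j _.
  rewrite /half_log_defect.
  by move: (j.*2.+1%:R^-1) (ln (1 + j%:R^-1)) => x y; field.
under eq_fun do rewrite E.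
apply: is_cvgD.
  apply: is_cvgB; last exact: is_cvg_cst.
  by case/cvg_ex : cu => l cu; apply/cvg_ex; exists l; rewrite (cvg_shiftS (series u)).
apply: is_cvgMr; have /cvg_ex[l hl] := cvg_half_log_defect.
apply/cvg_ex; exists l; apply: (@cvg_comp _ _ _ (fun m => (m.+1 ^ 3).-1) D _ \oo) => //.
apply/cvgnyPge => A; near=> m.
have : (A <= m)%N by near: m; exact: nbhs_infty_ge.
move/leq_trans; apply; rewrite -ltnS -cubeS.
by rewrite -[ltnLHS]expn1 (leq_trans _ (leq_pexp2l _ (_ : 1 <= 3)%N))// expn1.
Unshelve. all: by end_near. Qed.

End deterministic_convergence.

(** * Moments of gamma variables and of their block sums *)

Section gamma_sums.
Local Open Scope ereal_scope.
Context {R : realType} d (T : measurableType d) (P : probability T R).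
Variables (k : nat) (G : nat -> T -> R).
Hypothesis k0 : (0 < k)%N.
Hypothesis mG : forall j, measurable_fun setT (G j).
Hypothesis gG : forall j, is_gamma P (k%:R^-1)%R (G j).
Hypothesis iG : mutually_independent P G.
Local Notation mu := (@lebesgue_measure R).

Let k01 : (0 < (k%:R^-1 : R) <= 1)%R.
Proof. by rewrite invr_gt0 ltr0n k0/= invf_le1 ?ltr0n// ler1n. Qed.

Lemma foldr_mop_iter (I : Type) (X : I -> T -> R) (F : (R -> \bar R) -> R -> \bar R)
    (s : seq I) f : nonneg_meas f ->
  (forall g, nonneg_meas g -> nonneg_meas (F g)) ->
  (forall i g, nonneg_meas g -> mop P (X i) g = F g) ->
  foldr (fun i => mop P (X i)) f s = iter (size s) F f.
Proof.
move=> nf nF XF.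
suff : foldr (fun i => mop P (X i)) f s = iter (size s) F f /\
    nonneg_meas (iter (size s) F f) by case.
elim: s => //= i s [-> n]; split; first exact: XF.
exact: nF.
Qed.

(** The sum is read multiplicatively, through the factors exp(-G i) and the test function h(- ln u),
    so that [mop_prod] and [iter_mop_gamma] apply. *)
Lemma ge0_integral_gamma_sum (h : R -> \bar R) : nonneg_meas h ->
  \int[P]_w h (\sum_(0 <= i < k) G i w)%R = \int[mu]_x ((gamma_pdf 1 x)%:E * h x).
Proof.
move=> [mh h0].
pose X i w : R := expR (0 - 1 * G i w)%R.
have mX i : measurable_fun setT (X i).
  exact: (measurableT_comp (measurable_expR_affine 1 0) (mG i)).
have iX : mutually_independent P X.
  move=> J uJ A mA.
  have := iG uJ (A := fun j => (fun x => expR (0 - 1 * x)%R) @^-1` A j).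
  apply => j; rewrite -[X in measurable X]setTI.
  exact: measurable_expR_affine.
pose f u := h (- ln u)%R.
have nf : nonneg_meas f.
  split => [|x]; last exact: h0.
  by apply: measurableT_comp => //; apply: measurableT_comp.
have := mop_prod mX iX (iota_uniq 0 k) nf.
rewrite (foldr_mop_iter (F := mop P (X 0%N))) => //; first last.
- move=> i g ng; apply: (eq_trans (mop_gamma 1 0 k01 (mG i) (gG i) ng)).
  by apply/esym; exact: (mop_gamma 1 0 k01 (mG 0%N) (gG 0%N) ng).
- by move=> g ng; apply: nonneg_meas_mop.
rewrite size_iota (iter_mop_gamma 1 0 k0 (mG 0%N) (gG 0%N) nf).
move=> /(congr1 (fun F => F 1%R)); rewrite /mop /gop => E.
transitivity (\int[P]_w f (1 * \prod_(i <- iota 0 k) X i w)%R).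
  apply: eq_integral => w _; rewrite /f mul1r.
  rewrite /X -expR_sum expRK -sumrN /index_iota subn0; congr h.
  by apply: eq_bigr => i _; rewrite mul1r sub0r opprK.
rewrite E; apply: eq_integral => x _; congr (_ * _).
by rewrite /f mul1r expRK mulr0 mul1r sub0r opprK.
Qed.

Lemma gamma_ge0_ae : {ae P, forall w, forall j, (0 <= G j w)%R}.
Proof.
apply: ae_foralln => j.
exists (G j @^-1` `]-oo, 0%R[%classic); split.
- by rewrite -[X in measurable X]setTI; apply: (mG j).
- apply: (eq_trans (gG j (measurable_itv `]-oo, (0:R)%R[))).
  rewrite integral0_eq// => x /=; rewrite in_itv/= => x0.
  by rewrite /gamma_pdf ltNge (ltW x0).
- by move=> w /= /negP; rewrite -ltNge in_itv.
Qed.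

(** The absolute value makes every integrand nonnegative at every point, whereas [G j] is
    nonnegative only almost surely. *)
Let A j w : R := `|G j w|%R.

Let mA j : measurable_fun setT (A j).
Proof. exact: measurableT_comp. Qed.

Let mAE j : measurable_fun setT (fun w => (A j w)%:E).
Proof. exact/measurable_EFinP. Qed.

Let A0 j w : 0 <= (A j w)%:E.
Proof. by rewrite lee_fin normr_ge0. Qed.

Lemma gamma_moment_const (h : R -> \bar R) i j : nonneg_meas h ->
  \int[P]_w h (G i w) = \int[P]_w h (G j w).
Proof.
by move=> nh; rewrite !(ge0_integral_gamma k01 _ _ nh).
Qed.

(** The k variables [G 0], ..., [G (k-1)] have equal means, and their sum is exponential with mean
    1. *)
Lemma gamma_mean j : \int[P]_w (A j w)%:E = (k%:R^-1)%:E.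
Proof.
have nh : nonneg_meas (fun x : R => `|x|%:E).
  split => [|x]; last by rewrite lee_fin.
  by apply/measurable_EFinP; exact: normr_measurable.
have S1 : \int[P]_w `|\sum_(0 <= i < k) G i w|%:E = 1.
  rewrite (ge0_integral_gamma_sum nh) -[RHS](@integral_idM_expRN R).
  apply: eq_integral => x _; rewrite gamma_pdf1 -EFinM.
  by case: ifPn => x0; rewrite ?mul0r// gtr0_norm// mulrC.
have : \int[P]_w (\sum_(0 <= i < k) (A i w)%:E) = 1.
  rewrite -S1; apply: ge0_ae_eq_integral => //.
  - by apply: emeasurable_sum => i.
  - apply/measurable_EFinP; apply: measurableT_comp => //.
    exact: measurable_sum.
  - by move=> w _; apply: sume_ge0.
  - apply: filterS gamma_ge0_ae => w Gw _.
    rewrite sumEFin; congr EFin; rewrite ger0_norm ?sumr_ge0//.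
    by apply: eq_bigr => i _; rewrite /A ger0_norm.
rewrite ge0_integral_sum//.
rewrite (eq_bigr (fun=> \int[P]_w (A j w)%:E)); last first.
  by move=> i _; exact: (gamma_moment_const i j nh).
have := A0 j; have : 0 <= \int[P]_w (A j w)%:E by exact: integral_ge0.
rewrite sumr_const_nat subn0.
case: (\int[P]_w (A j w)%:E) => [r| |]// r0 _.
  have -> n : (r%:E *+ n)%R = (r *+ n)%:E.
    by elim: n => // n IHn; rewrite !mulrS IHn.
  move=> -[] E; congr EFin.
  by rewrite -[RHS]mul1r -[X in _ = (X * _)%R]E -[(r *+ k)%R]mulr_natr mulfK// pnatr_eq0 -lt0n.
have E n : (+oo%E *+ n.+1)%R = +oo :> \bar R.
  by elim: n => // n IHn; rewrite mulrS IHn.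
by rewrite -(prednK k0) E.
Qed.

(** Almost surely [G 0] is at most the sum of the first k variables, which is exponential and has a
    finite second moment. *)
Lemma gamma_second_moment : exists2 v : R, (0 <= v)%R &
  forall j, \int[P]_w ((A j w) ^+ 2)%:E <= v%:E.
Proof.
have nh : nonneg_meas (fun x : R => (`|x| ^+ 2)%:E).
  split => [|x]; last by rewrite lee_fin sqr_ge0.
  by apply/measurable_EFinP; apply: measurable_funX; exact: normr_measurable.
have S1 : \int[P]_w (`|\sum_(0 <= i < k) G i w| ^+ 2)%:E < +oo.
  rewrite (ge0_integral_gamma_sum nh); apply: le_lt_trans (@integral_sqrM_expRN_lty R).
  rewrite le_eqVlt; apply/orP; left; apply/eqP.
  apply: eq_integral => x _; rewrite gamma_pdf1 -EFinM real_normK ?num_real//.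
  by case: ifPn => x0; rewrite ?mul0r// mulrC.
have fin : \int[P]_w ((A 0 w) ^+ 2)%:E < +oo.
  apply: le_lt_trans S1; apply: ae_ge0_le_integral => //.
  - by move=> w _; rewrite lee_fin sqr_ge0.
  - by apply/measurable_EFinP; exact: measurable_funX.
  - apply/measurable_EFinP; apply: measurable_funX; apply: measurableT_comp => //.
    exact: measurable_sum.
  - apply: filterS gamma_ge0_ae => w Gw _.
    rewrite lee_fin lerXn2r ?nnegrE// /A ger0_norm// ger0_norm ?sumr_ge0//.
    by rewrite big_ltn// lerDl sumr_ge0.
exists (fine (\int[P]_w ((A 0 w) ^+ 2)%:E)).
  by apply: fine_ge0; apply: integral_ge0 => w _; rewrite lee_fin sqr_ge0.
move=> j; rewrite fineK; first by rewrite (gamma_moment_const j 0 nh).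
by rewrite ge0_fin_numE// integral_ge0// => w _; rewrite lee_fin sqr_ge0.
Qed.

Lemma gamma_cross_moment i j : i != j ->
  \int[P]_w (A i w * A j w)%:E = (k%:R^-1 * k%:R^-1)%:E.
Proof.
move=> ij.
rewrite (@ge0_integral_indep2 _ _ _ _ _ _ _ P (G i) (G j)
  (fun z : R * R => (`|z.1| * `|z.2|)%:E))//=.
- transitivity (\int[P]_w ((A i w)%:E * (k%:R^-1)%:E)).
    apply: eq_integral => w _; under eq_integral do rewrite EFinM.
    rewrite ge0_integralZl; [|exact: measurableT|exact: (mAE j)|
      by move=> v _; exact: (A0 j)|exact: (A0 i)].
    by congr (_ * _); exact: gamma_mean.
  rewrite ge0_integralZr; [|exact: measurableT|exact: (mAE i)|
      by move=> v _; exact: (A0 i)|by rewrite lee_fin invr_ge0].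
  by rewrite gamma_mean.
- move=> B C mB mC.
  have := iG (J := [:: i; j]) _ (A := fun l => if l == i then B else C).
  rewrite /= !big_cons !big_nil inE ij eqxx eq_sym (negbTE ij) setIT mule1.
  by apply => // l; case: ifP.
- apply/measurable_EFinP; apply: measurable_funM; exact: measurableT_comp.
Qed.

Lemma gamma_block_variance (s : seq nat) (b : nat -> R) (v : R) :
  uniq s -> (forall j, (0 <= b j)%R) ->
  (forall j, \int[P]_w ((A j w) ^+ 2)%:E <= v%:E) ->
  \int[P]_w ((\sum_(j <- s) (A j w - k%:R^-1) * b j) ^+ 2)%:E <=
  (v * \sum_(j <- s) b j ^+ 2)%:E.
Proof.
move=> us b0 hv.
pose a : R := (k%:R^-1)%R; have a0 : (0 <= a)%R by rewrite invr_ge0.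
pose be : R := (\sum_(j <- s) b j)%R.
have be0 : (0 <= be)%R by apply: sumr_ge0.
pose Z w : R := (\sum_(j <- s) b j * A j w)%R.
have mZ : measurable_fun setT Z.
  by apply: measurable_sum => j; exact: measurable_funM.
have Z0 w : (0 <= Z w)%R by apply: sumr_ge0 => j _; rewrite mulr_ge0// normr_ge0.
have EZ : \int[P]_w (Z w)%:E = (a * be)%:E.
  under eq_integral do rewrite /Z -sumEFin.
  rewrite ge0_integral_sum//; last 2 first.
  - by move=> j; apply/measurable_EFinP; exact: measurable_funM.
  - by move=> j w _; rewrite lee_fin mulr_ge0// normr_ge0.
  rewrite /be mulr_sumr -sumEFin; apply: eq_bigr => j _.
  under eq_integral do rewrite EFinM.
  by rewrite ge0_integralZl// ?lee_fin// gamma_mean -EFinM mulrC.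
have EZ2 : \int[P]_w (Z w ^+ 2)%:E <= (a ^+ 2 * be ^+ 2 + v * \sum_(j <- s) b j ^+ 2)%:E.
  have ZE w : (Z w ^+ 2)%:E =
      \sum_(i <- s) \sum_(j <- s) (b i * b j * (A i w * A j w))%:E.
    rewrite expr2 /Z mulr_suml -sumEFin; apply: eq_bigr => i _.
    rewrite mulr_sumr -sumEFin; apply: eq_bigr => j _.
    by congr EFin; ring.
  have mAA i j : measurable_fun setT (fun w => (b i * b j * (A i w * A j w))%:E).
    by apply/measurable_EFinP; apply: measurable_funM => //; exact: measurable_funM.
  have AA0 i j w : 0 <= (b i * b j * (A i w * A j w))%:E.
    by rewrite lee_fin !mulr_ge0 ?normr_ge0.
  under eq_integral do rewrite ZE.
  rewrite ge0_integral_sum//; last 2 first.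
  - by move=> i; apply: emeasurable_sum.
  - by move=> i w _; apply: sume_ge0.
  have -> : (a ^+ 2 * be ^+ 2 + v * \sum_(j <- s) b j ^+ 2)%R =
      (\sum_(i <- s) (\sum_(j <- s) b i * b j * a ^+ 2 + v * b i ^+ 2))%R.
    rewrite big_split/= mulr_sumr; congr (_ + _)%R.
    rewrite [(be ^+ 2)%R]expr2 {1}/be mulr_suml mulr_sumr; apply: eq_bigr => i _.
    by rewrite /be !mulr_sumr; apply: eq_bigr => j _; ring.
  rewrite -sumEFin big_seq [leRHS]big_seq; apply: lee_sum => i si.
  rewrite ge0_integral_sum// EFinD -sumEFin.
  have E j : \int[P]_w (b i * b j * (A i w * A j w))%:E =
      (b i * b j)%:E * \int[P]_w (A i w * A j w)%:E.
    under eq_integral do rewrite EFinM.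
    rewrite ge0_integralZl ?lee_fin ?mulr_ge0//.
    - by apply/measurable_EFinP; exact: measurable_funM.
    - by move=> w _; rewrite lee_fin mulr_ge0 ?normr_ge0.
  rewrite (bigD1_seq i)//= [X in _ <= X + _](bigD1_seq i)//=.
  (* The diagonal term is bounded by v b i^2 alone; the extra b i^2 a^2 available on the right is
     nonnegative. *)
  rewrite [leRHS]addeAC; apply: leeD.
    rewrite E; under eq_integral do rewrite -expr2.
    apply: (@le_trans _ _ ((b i * b i)%:E * v%:E)).
      by rewrite lee_wpmul2l ?lee_fin ?mulr_ge0.
    rewrite -EFinM -EFinD lee_fin [leLHS]mulrC [(b i ^+ 2)%R]expr2 lerDr.
    by rewrite !mulr_ge0.
  apply: lee_sum => j ji; have ij : i != j by rewrite eq_sym.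
  by rewrite E (gamma_cross_moment ij) -EFinM lee_fin -/a expr2.
(* The negative cross term of the centred square is moved to the other side, so that only
   nonnegative functions are integrated; it is subtracted after integration, where it is finite. *)
have EQ w : ((\sum_(j <- s) (A j w - k%:R^-1) * b j) ^+ 2)%:E + (2 * a * be)%:E * (Z w)%:E =
    (Z w ^+ 2)%:E + (a ^+ 2 * be ^+ 2)%:E.
  have -> : (\sum_(j <- s) (A j w - k%:R^-1) * b j = Z w - a * be)%R.
    rewrite /Z /be mulr_sumr -sumrB; apply: eq_bigr => j _.
    by rewrite mulrBl mulrC.
  by rewrite -EFinM -!EFinD; congr EFin; ring.
have mD : measurable_fun setT (fun w => ((\sum_(j <- s) (A j w - k%:R^-1) * b j) ^+ 2)%:E).
  apply/measurable_EFinP; apply: measurable_funX; apply: measurable_sum => j.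
  by apply: measurable_funM => //; exact: measurable_funB.
have c0 : (0 <= 2 * a * be)%R by rewrite !mulr_ge0.
have : \int[P]_w (((\sum_(j <- s) (A j w - k%:R^-1) * b j) ^+ 2)%:E +
    (2 * a * be)%:E * (Z w)%:E) = \int[P]_w ((Z w ^+ 2)%:E + (a ^+ 2 * be ^+ 2)%:E).
  by apply: eq_integral => w _; exact: EQ.
rewrite ge0_integralD//; last 3 first.
- by move=> w _; rewrite lee_fin sqr_ge0.
- by move=> w _; rewrite mule_ge0 ?lee_fin.
- by apply: measurable_funeM; exact/measurable_EFinP.
rewrite ge0_integralD; [|exact: measurableT|by move=> w _; rewrite lee_fin sqr_ge0
  |by apply/measurable_EFinP; exact: measurable_funX
  |by move=> w _; rewrite lee_fin mulr_ge0 ?sqr_ge0|exact: measurable_cst].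
rewrite ge0_integralZl; [|exact: measurableT|exact/measurable_EFinP
  |by move=> w _; rewrite lee_fin|by rewrite lee_fin].
rewrite EZ integral_cst// [X in _ = _ + _ * X -> _]probability_setT mule1 => H.
have : \int[P]_w ((\sum_(j <- s) (A j w - k%:R^-1) * b j) ^+ 2)%:E +
    (2 * a * be)%:E * (a * be)%:E <=
  (a ^+ 2 * be ^+ 2 + v * \sum_(j <- s) b j ^+ 2)%:E + (a ^+ 2 * be ^+ 2)%:E.
  by rewrite [leLHS]H leeD2r.
rewrite -EFinM -EFinD -leeBrDr// -EFinB; move/le_trans; apply.
by rewrite lee_fin le_eqVlt; apply/orP; left; apply/eqP; ring.
Qed.

End gamma_sums.

(** * Construction of independent variables *)

Section bit_splitting.
Context {R : realType}.

(** N is read as n base-4 digits; this keeps the high bit of each digit, and [odd_bits] the low bit.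
    Applied to the first n base-4 digits of x, they are the binary digits of x at alternate
    places. *)
Fixpoint even_bits (n N : nat) : nat :=
  if n is n'.+1 then (even_bits n' (N %/ 4)).*2 + (N %/ 2) %% 2 else 0%N.
Fixpoint odd_bits (n N : nat) : nat :=
  if n is n'.+1 then (odd_bits n' (N %/ 4)).*2 + N %% 2 else 0%N.
Fixpoint interleave (n i j : nat) : nat :=
  if n is n'.+1 then 4 * interleave n' (i %/ 2) (j %/ 2) + 2 * (i %% 2) + j %% 2
  else 0%N.

Lemma interleave_lt n i j : (interleave n i j < 4 ^ n)%N.
Proof.
elim: n i j => // n IH i j /=; have := IH (i %/ 2)%N (j %/ 2)%N.
have := ltn_pmod i (isT : 0 < 2)%N; have := ltn_pmod j (isT : 0 < 2)%N.
rewrite expnS; lia.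
Qed.

Lemma bits_interleaveP n N i j : (N < 4 ^ n)%N -> (i < 2 ^ n)%N -> (j < 2 ^ n)%N ->
  (even_bits n N == i) && (odd_bits n N == j) = (N == interleave n i j).
Proof.
elim: n N i j => [|n IH] N i j.
  by rewrite !expn0 !ltnS !leqn0 => /eqP-> /eqP-> /eqP->.
rewrite !expnS => hN hi hj /=.
have hN' : (N %/ 4 < 4 ^ n)%N by rewrite ltn_divLR// mulnC.
have hi' : (i %/ 2 < 2 ^ n)%N by rewrite ltn_divLR// mulnC.
have hj' : (j %/ 2 < 2 ^ n)%N by rewrite ltn_divLR// mulnC.
have := IH _ _ _ hN' hi' hj'.
move: (even_bits n _) (odd_bits n _) (interleave n _ _) => e o q E.
apply/andP/eqP.
  move=> [/eqP ei /eqP oj].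
  have e2 : e = (i %/ 2)%N by rewrite -ei; lia.
  have o2 : o = (j %/ 2)%N by rewrite -oj; lia.
  have : (N %/ 4)%N == q by rewrite -E e2 o2 !eqxx.
  move/eqP => Nq; lia.
move=> NE.
have : (N %/ 4)%N == q by apply/eqP; lia.
rewrite -E => /andP[/eqP e2 /eqP o2].
by split; apply/eqP; lia.
Qed.

Lemma even_bits_lt n N : (even_bits n N < 2 ^ n)%N.
Proof.
elim: n N => //= n IH N; have := IH (N %/ 4)%N; rewrite expnS.
by have := ltn_pmod (N %/ 2)%N (isT : 0 < 2)%N; lia.
Qed.

Lemma odd_bits_lt n N : (odd_bits n N < 2 ^ n)%N.
Proof.
elim: n N => //= n IH N; have := IH (N %/ 4)%N; rewrite expnS.
by have := ltn_pmod N (isT : 0 < 2)%N; lia.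
Qed.

Definition digits (n : nat) (x : R) : nat := Num.truncn (4 ^+ n * x).

Lemma digitsP n (x : R) N : 0 <= x ->
  (digits n x == N) = (N%:R <= 4 ^+ n * x < N.+1%:R).
Proof.
by move=> x0; rewrite /digits truncn_eq// mulr_ge0// exprn_ge0.
Qed.

Lemma digits_lt n (x : R) : 0 <= x < 1 -> (digits n x < 4 ^ n)%N.
Proof.
move=> /andP[x0 x1].
have := eqxx (digits n x); rewrite digitsP// => /andP[h _].
have : (digits n x)%:R < (4 ^ n)%:R :> R.
  by rewrite (le_lt_trans h)// natrX gtr_pMr// exprn_gt0.
by rewrite ltr_nat.
Qed.

Lemma digitsS n (x : R) : 0 <= x -> (digits n.+1 x %/ 4)%N = digits n x.
Proof.
move=> x0; apply/esym/eqP; rewrite digitsP//.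
have := eqxx (digits n.+1 x); rewrite digitsP// exprS -mulrA.
move: (digits n.+1 x) (4 ^+ n * x) => N y /andP[h1 h2].
have q1 : (4 * (N %/ 4) <= N)%N by lia.
have q2 : (N.+1 <= 4 * (N %/ 4).+1)%N by lia.
have q1R : 4 * (N %/ 4)%:R <= N%:R :> R by rewrite -natrM ler_nat.
have q2R : N.+1%:R <= 4 * (N %/ 4).+1%:R :> R by rewrite -natrM ler_nat.
apply/andP; split; lra.
Qed.

(** [digits n] is monotone, hence measurable, and takes countably many values. *)
Lemma measurable_digits_fun n (f : nat -> R) :
  measurable_fun setT (fun x : measurableTypeR R => f (digits n x)).
Proof.
have mr : measurable_fun setT (fun x : R => (digits n x)%:R : R).
  apply: nondecreasing_measurable => // x y xy; rewrite ler_nat.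
  by apply: le_truncn; rewrite ler_wpM2l// exprn_ge0.
move=> _ Y mY; rewrite setTI.
rewrite (_ : _ @^-1` Y = \bigcup_(N in [set N | Y (f N)])
    ((fun x : R => (digits n x)%:R : R) @^-1` [set N%:R])); last first.
  apply/seteqP; split => x /=; first by move=> Yx; exists (digits n x).
  by case=> N YN /= /eqP; rewrite eqr_nat => /eqP ->.
apply: bigcup_measurable => N _; rewrite -[X in measurable X]setTI.
by apply: mr => //; exact: measurable_set1.
Qed.

Local Notation mu := (@lebesgue_measure R).
Let T := measurableTypeR R.

(** The uniform law is carried by the whole line rather than by a subtype, so the splitting maps go
    from the type to itself and can be iterated; pointwise facts are then needed only on [0, 1[. *)
Lemma uniform01_exists : exists P : probability T R,
  forall A : set T, P A = mu (A `&` `[0%R, 1%R[%classic).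
Proof.
pose m := mrestr mu (measurable_itv `[(0:R), (1:R)[).
have m1 : m setT = 1%E.
  rewrite /m/= /mrestr/= setTI lebesgue_measure_itv/= lte_fin ltr01.
  by rewrite oppr0 adde0.
pose P : probability T R := HB.pack m (Measure_isProbability.Build _ _ _ m m1).
by exists P.
Qed.

Variable P : probability T R.
Hypothesis PE : forall A : set T, P A = mu (A `&` `[0%R, 1%R[%classic).

Let ev n (x : T) := even_bits n (digits n x).
Let od n (x : T) := odd_bits n (digits n x).

Let mset n (S : nat -> bool) : measurable [set x : T | S (digits n x)].
Proof.
have := @measurable_digits_fun n (fun N => if S N then 1 else 0) measurableT
  _ (measurable_set1 (1:R)).
rewrite setTI (_ : _ @^-1` _ = [set x : T | S (digits n x)])//.
apply/seteqP; split => x /=; case: (S _) => //.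
by move=> /esym/eqP; rewrite oner_eq0.
Qed.

(** Prescribing both bit strings prescribes all n base-4 digits, that is, an interval of length
    4^-n. *)
Lemma bits_cell n i j : P [set x : T | (ev n x == i) && (od n x == j)] =
  (if (i < 2 ^ n)%N && (j < 2 ^ n)%N then ((4 ^+ n)^-1)%:E else 0%E).
Proof.
case: ifPn => [/andP[hi hj]|hij]; last first.
  rewrite (_ : [set x | _] = set0) ?measure0//.
  apply/seteqP; split => x //= /andP[/eqP hi /eqP hj].
  by move: hij; rewrite -hi -hj even_bits_lt odd_bits_lt.
have p4 : 0 < 4 ^+ n :> R by rewrite exprn_gt0.
have q4 := @interleave_lt n i j.
set q := interleave n i j in q4 *.
rewrite PE (_ : _ `&` _ = `[(q%:R / 4 ^+ n)%R, (q.+1%:R / 4 ^+ n)%R[%classic).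
  rewrite lebesgue_measure_itv/= lte_fin ltr_pM2r ?invr_gt0// ltr_nat ltnSn.
  by rewrite -EFinB -mulrBl -natr1 addrAC subrr add0r mul1r.
have key (x : R) : 0 <= x < 1 -> (ev n x == i) && (od n x == j) =
    (q%:R / 4 ^+ n <= x < q.+1%:R / 4 ^+ n).
  move=> x01; have /andP[x0 _] := x01.
  rewrite /ev /od bits_interleaveP ?digits_lt// digitsP//.
  by rewrite ler_pdivrMr// ltr_pdivlMr// mulrC.
apply/seteqP; split => x /=; rewrite !in_itv/=.
  by case=> h x01; rewrite -key.
move=> h; have x01 : 0 <= x < 1.
  case/andP: h => h1 h2; rewrite (le_trans _ h1)/= ?divr_ge0 ?exprn_ge0//.
  rewrite (lt_le_trans h2)// ler_pdivrMr// mul1r -natrX ler_nat.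
  exact: q4.
by split => //; rewrite key.
Qed.

Lemma bits_row n i j : P [set x : T | (ev n x == i) && (od n x < j)%N] =
  (if (i < 2 ^ n)%N then ((minn j (2 ^ n))%:R / 4 ^+ n)%:E else 0%E).
Proof.
elim: j => [|j IH].
  rewrite min0n mul0r (_ : [set x | _] = set0) ?measure0 ?if_same//.
  by apply/seteqP; split => x //=; rewrite ltn0 andbF.
rewrite (_ : [set x | _] = [set x : T | (ev n x == i) && (od n x < j)%N] `|`
    [set x : T | (ev n x == i) && (od n x == j)]); last first.
  apply/seteqP; split => x /=.
    by case/andP => ->; rewrite ltnS leq_eqVlt => /orP[->|->]; [right|left].
  by case=> /andP[->] /=; [exact: leqW|move/eqP => ->].
rewrite measureU//.
- apply: (eq_trans (congr2 _ IH (bits_cell n i j))); case: (ltnP i (2 ^ n)) => //= _; last by rewrite adde0.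
  case: ltnP => jn.
    rewrite -EFinD; congr EFin; rewrite (minn_idPl jn).
    by rewrite -[j.+1%:R]natr1 mulrDl mul1r.
  by rewrite adde0 (minn_idPr (leqW jn)).
- exact: (mset n (fun N => (even_bits n N == i) && (odd_bits n N < j)%N)).
- exact: (mset n (fun N => (even_bits n N == i) && (odd_bits n N == j))).
- apply/seteqP; split => x //= [/andP[_ h] /andP[_ /eqP h']].
  by rewrite h' ltnn in h.
Qed.

Lemma bits_rect n i j : P [set x : T | (ev n x < i)%N && (od n x < j)%N] =
  ((minn i (2 ^ n))%:R * (minn j (2 ^ n))%:R / 4 ^+ n)%:E.
Proof.
elim: i => [|i IH].
  rewrite min0n !mul0r (_ : [set x | _] = set0) ?measure0//.
  by apply/seteqP; split => x //=.
rewrite (_ : [set x | _] = [set x : T | (ev n x < i)%N && (od n x < j)%N] `|`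
    [set x : T | (ev n x == i) && (od n x < j)%N]); last first.
  apply/seteqP; split => x /=.
    by case/andP; rewrite ltnS leq_eqVlt => /orP[->|->] ->; [right|left].
  by case=> /andP[h ->]; rewrite andbT; [exact: leqW|move/eqP : h => ->].
rewrite measureU//.
- apply: (eq_trans (congr2 _ IH (bits_row n i j))); case: (ltnP i (2 ^ n)) => hi.
    rewrite -EFinD; congr EFin; rewrite (minn_idPl hi).
    by rewrite -[i.+1%:R]natr1 mulrDl mul1r mulrDl.
  by rewrite adde0 (minn_idPr (leqW hi)).
- exact: (mset n (fun N => (even_bits n N < i)%N && (odd_bits n N < j)%N)).
- exact: (mset n (fun N => (even_bits n N == i) && (odd_bits n N < j)%N)).
- apply/seteqP; split => x //= [/andP[h _] /andP[/eqP h' _]].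
  by rewrite h' ltnn in h.
Qed.

(** The prefixes define nested dyadic intervals, and [A] is the limit of their left ends. The upper
    bound is weak because a string ending in ones reaches the right end. *)
Lemma cvg_bits (bits : nat -> nat -> nat) (bit : nat -> nat) :
  (forall n N, bits n.+1 N = (bits n (N %/ 4)).*2 + bit N)%N ->
  (forall N, bit N < 2)%N -> (forall n N, bits n N < 2 ^ n)%N ->
  exists2 A : T -> T, measurable_fun setT A &
    forall (x : T) n, 0 <= x ->
      (bits n (digits n x))%:R / 2 ^+ n <= A x <= (bits n (digits n x)).+1%:R / 2 ^+ n.
Proof.
move=> bitsS bit2 bits_lt.
pose a n (x : R) : R := (bits n (digits n x))%:R / 2 ^+ n.
pose b n (x : R) : R := (bits n (digits n x)).+1%:R / 2 ^+ n.
(* Clamping at 0 makes the sequence monotone and convergent at every real, as the measurability of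
   the limit requires. *)
pose x' (x : R) := Num.max x 0.
have x'0 x : 0 <= x' x by rewrite le_max lexx orbT.
have ab x n : 0 <= x -> a n x <= a n.+1 x /\ b n.+1 x <= b n x.
  move=> x0; rewrite /a /b bitsS digitsS// exprS invfM mulrA.
  have p2 : 0 < 2 ^+ n :> R by rewrite exprn_gt0.
  move: (bits n _) (bit2 (digits n.+1 x)) => e; move: (bit _) => c c2.
  rewrite !ler_pM2r ?invr_gt0//.
  split; first by rewrite ler_pdivlMr// -natrM ler_nat; lia.
  by rewrite mulrA ler_pM2r ?invr_gt0// ler_pdivrMr// -natrM ler_nat; lia.
have nda x : 0 <= x -> nondecreasing_seq (a ^~ x).
  by move=> x0; apply/nondecreasing_seqP => n; case: (ab x n x0).
have nib x : 0 <= x -> nonincreasing_seq (b ^~ x).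
  by move=> x0; apply/nonincreasing_seqP => n; case: (ab x n x0).
have leab x n : a n x <= b n x.
  by rewrite /a /b ler_pM2r ?invr_gt0 ?exprn_gt0// ler_nat.
have a_le x n m : 0 <= x -> a n x <= b m x.
  move=> x0; apply: (@le_trans _ _ (a (maxn n m) x)).
    by apply: nda => //; exact: leq_maxl.
  by apply: (le_trans (leab _ _)); apply: nib => //; exact: leq_maxr.
have ca x : 0 <= x -> cvgn (a ^~ x).
  move=> x0; apply: nondecreasing_is_cvgn; first exact: nda.
  by exists (b 0%N x) => _ [n _ <-]; exact: a_le.
exists (fun x => limn (a ^~ (x' x))).
  apply: (@measurable_fun_cvg _ _ _ _ (fun n x => a n (x' x))) => //.
    move=> n.
    have mx' : measurable_fun setT (x' : T -> T).
      by apply: measurable_maxr.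
    have := @measurable_digits_fun n (fun N => (bits n N)%:R / 2 ^+ n).
    by move=> h; exact: (measurableT_comp h mx').
  by move=> x _; exact: ca.
move=> x n x0; rewrite (_ : x' x = x); last by rewrite /x' (max_idPl x0).
apply/andP; split.
  by apply: nondecreasing_cvgn_le; [exact: nda|exact: ca].
apply: limr_le; first exact: ca.
by apply: nearW => m; exact: a_le.
Qed.

(** Both sides are finite measures in C, so rays determine them. Used once for each coordinate, this
    extends independence from rays to all measurable sets. *)
Lemma rays_indep (X : T -> R) (D : set T) : measurable_fun setT X -> measurable D ->
  (forall x, P (X @^-1` `]-oo, x]%classic `&` D) = (P `]-oo, x]%classic * P D)%E) ->
  forall C : set R, measurable C -> P (X @^-1` C `&` D) = (P C * P D)%E.
Proof.
move=> mX mD H.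
pose m1' := pushforward (mrestr P mD) X : {measure set _ -> \bar R}.
pose m1 := m1' mX.
have mid : measurable_fun setT (fun x : T => x : R) by exact: measurable_id.
have D0 : (0 <= fine (P D))%R by exact: fine_ge0.
pose m2' := pushforward P (fun x : T => x : R) : {measure set _ -> \bar R}.
pose m2 := mscale (NngNum D0) (m2' mid).
have fD : P D \is a fin_num by exact: fin_num_measure.
have m1E C : m1 C = P (X @^-1` C `&` D) by [].
have m2E C : m2 C = (P C * P D)%E.
  by rewrite /m2 /mscale/= fineK// muleC.
have m1T : m1 setT = P D by rewrite m1E preimage_setT setTI.
have fin : (m1 setT < +oo)%E by rewrite m1T ltey_eq fD.
have m12 : m1 setT = m2 setT by rewrite m1T m2E [X in (X * _)%E]probability_setT mul1e.
move=> C mC; rewrite -m1E -m2E; apply: (finite_measure_eq_rays fin m12) => //.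
by move=> x; exact: (eq_trans (H x) (esym (m2E _))).
Qed.

(** The product formula says two things at once: each map preserves P (take the other set full), and
    the two maps are independent. *)
Lemma uniform01_split : exists AB : (T -> T) * (T -> T),
  [/\ measurable_fun setT AB.1, measurable_fun setT AB.2 &
  forall C D, measurable C -> measurable D ->
    P (AB.1 @^-1` C `&` AB.2 @^-1` D) = (P C * P D)%E].
Proof.
have [A mA AE] := @cvg_bits even_bits (fun N => (N %/ 2) %% 2)%N
  (fun n N => erefl) (fun N => ltn_pmod _ (isT : 0 < 2)%N) even_bits_lt.
have [B mB BE] := @cvg_bits odd_bits (fun N => N %% 2)%N
  (fun n N => erefl) (fun N => ltn_pmod _ (isT : 0 < 2)%N) odd_bits_lt.
exists (A, B); split => //=.
have mI (S : set R) : measurable S -> measurable (A @^-1` S) /\ measurable (B @^-1` S).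
  by move=> mS; split; rewrite -[X in measurable X]setTI; [exact: mA|exact: mB].
have Pae (S S' : set T) : measurable S -> measurable S' ->
    (forall x, 0 <= x < 1 -> S x -> S' x) -> (P S <= P S')%E.
  move=> mS mS' SS'; rewrite !PE; apply: le_measure; rewrite ?inE.
  - exact: measurableI.
  - exact: measurableI.
  - by move=> x /= [Sx x01]; split => //; apply: SS' => //; move: x01; rewrite in_itv.
have PaeE (S S' : set T) : measurable S -> measurable S' ->
    (forall x, 0 <= x < 1 -> S x <-> S' x) -> P S = P S'.
  move=> mS mS' SS'; apply/eqP; rewrite eq_le !Pae// => x x01; apply SS'; exact: x01.
have ray x : 0 <= x <= 1 -> P `]-oo, x]%classic = x%:E.
  move=> /andP[x0 x1].
  rewrite PE; apply/eqP; rewrite eq_le; apply/andP; split.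
    apply: (@le_trans _ _ (mu `[0%R, x]%classic)).
      apply: le_measure; rewrite ?inE//; first exact: measurableI.
      by move=> z /=; rewrite !in_itv/= => -[-> /andP[->]].
    rewrite lebesgue_measure_itv/= lte_fin; case: ifPn => h; rewrite ?oppr0 ?adde0//.
  apply: (@le_trans _ _ (mu `[0%R, x[%classic)).
    rewrite lebesgue_measure_itv/= lte_fin; case: ifPn => h; rewrite ?oppr0 ?adde0//.
    by rewrite lee_fin leNgt.
  apply: le_measure; rewrite ?inE//; first exact: measurableI.
  move=> z /=; rewrite !in_itv/= => /andP[z0 zx].
  by rewrite z0 (ltW zx) (lt_le_trans zx x1).
have joint01 x y : 0 <= x <= 1 -> 0 <= y <= 1 ->
    P (A @^-1` `]-oo, x]%classic `&` B @^-1` `]-oo, y]%classic) = (x * y)%:E.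
  move=> x01 y01.
  have [mAx _] := mI `]-oo, x]%classic (measurable_itv _).
  have [_ mBy] := mI `]-oo, y]%classic (measurable_itv _).
  set E := A @^-1` _ `&` _.
  have mE : measurable E by exact: measurableI.
  have fE : P E \is a fin_num by exact: fin_num_measure.
  rewrite -(fineK fE); congr EFin.
  have /andP[x0 x1] := x01; have /andP[y0 y1] := y01.
  (* With s = 2^n and i, j the floors of s x and s y, both s^2 P(E) and s^2 x y lie between i j and
     (i+1)(j+1), whose gap i + j + 1 is at most 3 s. *)
  suff H n : `|fine (P E) - x * y| * 2 ^+ n <= 3.
    apply/eqP; rewrite -subr_eq0 -normr_eq0 eq_le normr_ge0 andbT leNgt.
    apply/negP; move: `|_| H => e H e0.
    have := H (Num.truncn (3 / e)); apply/negP; rewrite -ltNge mulrC -ltr_pdivrMr//.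
    apply: (lt_le_trans (truncnS_gt _)).
    by rewrite -natrX ler_nat ltn_expl.
  pose s : R := 2 ^+ n; have s1 : 1 <= s by rewrite exprn_ege1// ler1n.
  have s0 : 0 < s by exact: lt_le_trans s1.
  have s4 : 4 ^+ n = s * s :> R by rewrite -exprMn -natrM.
  pose i := Num.truncn (s * x); pose j := Num.truncn (s * y).
  have /andP[ix xi] : i%:R <= s * x < i.+1%:R by apply: truncn_itv; rewrite mulr_ge0// ltW.
  have /andP[jy yj] : j%:R <= s * y < j.+1%:R by apply: truncn_itv; rewrite mulr_ge0// ltW.
  have le_s (u : R) (l : nat) : u <= 1 -> l%:R <= s * u -> (l <= 2 ^ n)%N.
    move=> u1 h; rewrite -(ler_nat R) natrX -/s (le_trans h)//.
    by rewrite ger_pMr.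
  have is_ := le_s _ _ x1 ix; have js := le_s _ _ y1 jy.
  have lo : ((i%:R * j%:R / (s * s))%:E <= P E)%E.
    rewrite -s4 -[X in X%:R * _](minn_idPl is_) -[X in _ * X%:R](minn_idPl js).
    rewrite -bits_rect; apply: Pae => //.
      exact: (mset n (fun N => (even_bits n N < i)%N && (odd_bits n N < j)%N)).
    move=> z /andP[z0 _] /andP[ei oj]; split; rewrite /= in_itv/=.
      have /andP[_ h] := AE z n z0; apply: (le_trans h).
      rewrite ler_pdivrMr// -/s mulrC (le_trans _ ix)// ler_nat; exact: ei.
    have /andP[_ h] := BE z n z0; apply: (le_trans h).
    rewrite ler_pdivrMr// -/s mulrC (le_trans _ jy)// ler_nat; exact: oj.
  have hi : (P E <= (i.+1%:R * j.+1%:R / (s * s))%:E)%E.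
    apply: (@le_trans _ _ (P [set z : T | (ev n z < i.+1)%N && (od n z < j.+1)%N])).
      apply: Pae => //.
        exact: (mset n (fun N => (even_bits n N < i.+1)%N && (odd_bits n N < j.+1)%N)).
      move=> z /andP[z0 _] [/= Az Bz]; move: Az Bz; rewrite !in_itv/= => Az Bz.
      apply/andP; split; rewrite -(ltr_nat R).
        apply: le_lt_trans xi; have /andP[h _] := AE z n z0.
        by rewrite mulrC -ler_pdivrMr// (le_trans h).
      apply: le_lt_trans yj; have /andP[h _] := BE z n z0.
      by rewrite mulrC -ler_pdivrMr// (le_trans h).
    rewrite bits_rect s4 lee_fin ler_pM2r ?invr_gt0 ?mulr_gt0//.
    by rewrite ler_pM ?ler0n// ler_nat geq_minl.
  have lo' : i%:R * j%:R / (s * s) <= fine (P E) by rewrite -lee_fin fineK.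
  have hi' : fine (P E) <= i.+1%:R * j.+1%:R / (s * s) by rewrite -lee_fin fineK.
  move: lo' hi' => {lo hi}; rewrite -/s ler_pdivrMr ?ler_pdivlMr ?mulr_gt0//.
  have i0 : 0 <= i%:R :> R by []. have j0 : 0 <= j%:R :> R by [].
  move: ix xi jy yj; rewrite -![i.+1%:R]natr1 -![j.+1%:R]natr1.
  have sx : s * x <= s by rewrite ger_pMr.
  have sy : s * y <= s by rewrite ger_pMr.
  move: (fine _) (i%:R : R) (j%:R : R) i0 j0 sx sy => p I J I0 J0.
  have -> : `|p - x * y| * s = `|p * (s * s) - (s * x) * (s * y)| / s.
    have -> : p * (s * s) - (s * x) * (s * y) = (p - x * y) * (s * s) by ring.
    by rewrite normrM (gtr0_norm (mulr_gt0 s0 s0)) mulrA mulfK// gt_eqF.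
  rewrite ler_pdivrMr//.
  move: (s * x) (s * y) (p * (s * s)) => u v q us vs Iu uI Jv vJ lo hi.
  have uv1 : I * J <= u * v by rewrite ler_pM.
  have uv2 : u * v <= (I + 1) * (J + 1).
    by apply: ler_pM; [exact: le_trans Iu|exact: le_trans Jv|exact: ltW|exact: ltW].
  rewrite ler_norml; apply/andP; split; nra.
(* Up to null sets, a ray ending outside [0, 1] is either empty or the ray ending at 1. *)
have clip (F : T -> R) (mF : measurable_fun setT F) (D : set T) (mD : measurable D) :
    (forall z, 0 <= z < 1 -> 0 <= F z <= 1) ->
    (forall x, 0 <= x <= 1 ->
      P (F @^-1` `]-oo, x]%classic `&` D) = (P `]-oo, x]%classic * P D)%E) ->
    forall x, P (F @^-1` `]-oo, x]%classic `&` D) = (P `]-oo, x]%classic * P D)%E.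
  move=> F01 H x.
  have mFr u : measurable (F @^-1` `]-oo, u]%classic `&` D).
    apply: measurableI => //; rewrite -[X in measurable X]setTI.
    by apply: mF => //; exact: measurable_itv.
  have [x0|x0] := ltP x 0.
    rewrite (PaeE _ set0)//; last first.
      move=> z z01; split => // -[] /=; rewrite in_itv/= => h _.
      by have /andP[h' _] := F01 z z01; have := le_lt_trans (le_trans h' h) x0; rewrite ltxx.
    rewrite measure0 (PaeE `]-oo, x]%classic set0) ?measure0 ?mul0e//.
    move=> z /andP[z0 _]; split => //=; rewrite in_itv/= => h.
    by have := le_lt_trans (le_trans z0 h) x0; rewrite ltxx.
  have [x1|x1] := leP x 1; first by apply: H; rewrite x0.
  rewrite (PaeE _ (F @^-1` `]-oo, 1]%classic `&` D))//; last first.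
    move=> z z01; have /andP[_ h] := F01 z z01; rewrite /= !in_itv/=.
    by rewrite h (le_trans h (ltW x1)).
  rewrite (PaeE `]-oo, x]%classic `]-oo, 1]%classic)//; last first.
    move=> z /andP[_ h]; rewrite /= !in_itv/=.
    by rewrite (ltW h) (le_trans (ltW h) (ltW x1)).
  by apply: H; rewrite ler01 lexx.
have A01 z : 0 <= z < 1 -> 0 <= A z <= 1.
  move=> /andP[z0 _]; have /andP[h1 h2] := AE z 0%N z0.
  by move: h1 h2; rewrite /= mul0r expr0 divr1 => -> ->.
have B01 z : 0 <= z < 1 -> 0 <= B z <= 1.
  move=> /andP[z0 _]; have /andP[h1 h2] := BE z 0%N z0.
  by move: h1 h2; rewrite /= mul0r expr0 divr1 => -> ->.
have i1 : 0 <= (1 : R) <= 1 by rewrite ler01 lexx.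
have full (F : T -> R) (D : set T) : measurable_fun setT F -> measurable D ->
    (forall z, 0 <= z < 1 -> 0 <= F z <= 1) ->
    P (F @^-1` `]-oo, 1]%classic `&` D) = P D.
  move=> mF mD F01; apply: PaeE => //.
    apply: measurableI => //; rewrite -[X in measurable X]setTI.
    by apply: mF => //; exact: measurable_itv.
  move=> z z01; have /andP[_ h] := F01 z z01.
  by split => [[]//|Dz]; split => //; rewrite /= in_itv.
have mAy y : measurable (A @^-1` `]-oo, y]%classic).
  by have [] := mI `]-oo, y]%classic (measurable_itv _).
have mBy y : measurable (B @^-1` `]-oo, y]%classic).
  by have [] := mI `]-oo, y]%classic (measurable_itv _).
have PB01 y : 0 <= y <= 1 -> P (B @^-1` `]-oo, y]%classic) = y%:E.
  by move=> y01; rewrite -(full A _ mA (mBy y) A01) joint01// mul1r.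
have stepA y : 0 <= y <= 1 -> forall C, measurable C ->
    P (A @^-1` C `&` B @^-1` `]-oo, y]%classic) = (P C * y%:E)%E.
  move=> y01 C mC; rewrite -(PB01 y y01); apply: (rays_indep mA (mBy y)) => //.
  apply: clip => // x x01; rewrite joint01// PB01// ray//.
move=> C D mC mD.
have [mAC _] := mI C mC.
have PAC : P (A @^-1` C) = P C.
  by rewrite -(full B _ mB mAC B01) setIC stepA// mule1.
rewrite -PAC setIC muleC; apply: (rays_indep mB mAC) => //.
apply: clip => // y y01.
by rewrite setIC stepA// ray// PAC muleC.
Qed.

End bit_splitting.

(** * Quantile functions *)

Section quantile.
Context {R : realType}.
Local Notation mu := (@lebesgue_measure R).
Let T := measurableTypeR R.
Variable P : probability T R.
Hypothesis PE : forall A : set T, P A = mu (A `&` `[0%R, 1%R[%classic).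

(* [q] is the generalised inverse of the distribution function of [N]. *)
Lemma quantile (N : probability R R) : exists2 q : T -> R,
  measurable_fun setT q & forall A, measurable A -> P (q @^-1` A) = N A.
Proof.
pose X : {RV N >-> R} := HB.pack (fun x : R => x)
  (@isMeasurableFun.Build _ _ R R (fun x : R => x) (@measurable_id _ _ setT)).
pose F x := fine (cdf X x).
have FE x : cdf X x = (F x)%:E.
  by rewrite fineK// ge0_fin_numE ?cdf_ge0// (le_lt_trans (cdf_le1 X x))// ltry.
have F0 x : 0 <= F x by rewrite -lee_fin -FE cdf_ge0.
have Fle1 x : F x <= 1 by rewrite -lee_fin -FE cdf_le1.
have Fnd x y : x <= y -> F x <= F y.
  by move=> xy; rewrite -lee_fin -!FE; exact: cdf_nondecreasing.
have Fy : F x @[x --> +oo] --> (1 : R) by apply: fine_cvg; exact: cvg_cdfy1.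
have FNy : F x @[x --> -oo] --> (0 : R) by apply: fine_cvg; exact: cvg_cdfNy0.
have Fr x : F y @[y --> x^'+] --> F x.
  by apply: fine_cvg; rewrite -FE; exact: cdf_right_continuous.
pose S u := [set x | u <= F x].
have S0 u : u < 1 -> S u !=set0.
  move=> u1; have /filter_ex[x /ltW ux] : \forall x \near +oo, u < F x by exact: (cvgr_gt _ Fy).
  by exists x.
have Slb u : 0 < u -> has_lbound (S u).
  move=> u0; have /filter_ex[x xu] : \forall x \near -oo, F x < u by exact: (cvgr_lt _ FNy).
  exists x => y uy; rewrite leNgt; apply/negP => yx.
  have := le_lt_trans (le_trans uy (Fnd _ _ (ltW yx))) xu.
  by rewrite ltxx.
(* The Galois connection between q and F; the direct implication uses right-continuity of F at the
   infimum. *)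
have key u x : 0 < u < 1 -> (inf (S u) <= x) = (u <= F x).
  move=> /andP[u0 u1]; apply/idP/idP => [h|h]; last exact: (ge_inf (Slb u u0) h).
  apply: (le_trans _ (Fnd _ _ h)); rewrite leNgt; apply/negP => Fu.
  have near_lt : \forall y \near (inf (S u))^'+, F y < u by exact: (cvgr_lt _ (Fr _)).
  have near_gt := @nbhs_right_gt R (inf (S u)).
  have near_both : \forall y \near (inf (S u))^'+, F y < u /\ inf (S u) < y.
    exact: filterI near_lt near_gt.
  have [y [yu Sy]] :=
    @filter_ex _ _ (at_right_proper_filter (inf (S u))) _ near_both.
  have [s us sy] := inf_lt (S0 u u1) Sy.
  have := le_lt_trans (le_trans us (Fnd _ _ (ltW sy))) yu.
  by rewrite ltxx.
(* The default 0 outside ]0, 1[ concerns only a null set of u. *)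
pose q (u : T) : R := if (0 < u) && (u < 1) then inf (S u) else 0.
have mq : measurable_fun setT q.
  apply: (measurability (@RGenOInfty.G R)); first exact: RGenOInfty.measurableE.
  move=> /= _ [_] [x ->] <-; rewrite setTI.
  rewrite (_ : _ @^-1` _ = (`]0, 1[%classic `&` `]F x, +oo[%classic) `|`
      (~` `]0, 1[%classic `&` [set _ : R | x < 0])); last first.
    apply/seteqP; split => u /=; rewrite /q !in_itv/= !andbT.
      case: ifPn => u01; last by move=> x0; right; split => //; exact/negP.
      by rewrite ltNge key// -ltNge => ?; left; split.
    case=> [[u01 Fu]|[/negP/negbTE -> //]].
    by rewrite u01 ltNge key// -ltNge.
  apply: measurableU.
    by apply: measurableI; exact: measurable_itv.
  apply: measurableI; first by apply: measurableC; exact: measurable_itv.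
  have [x0|x0] := ltP x 0.
    by rewrite (_ : [set _ | _] = setT)//; apply/seteqP; split.
  by rewrite (_ : [set _ | _] = set0)//; apply/seteqP; split.
exists q => //.
have mqray x : measurable (q @^-1` `]-oo, x]%classic).
  by rewrite -[X in measurable X]setTI; apply: mq => //; exact: measurable_itv.
pose m' := pushforward P q : {measure set _ -> \bar R}.
have mT : m' mq setT = 1%E by exact: probability_setT.
move=> A mA; apply: (@finite_measure_eq_rays R (m' mq) N) => //.
- by rewrite mT ltry.
- by rewrite mT; apply/esym; exact: probability_setT.
move=> x.
transitivity ((F x)%:E); last by rewrite -FE.
rewrite /m'/= /pushforward PE; apply/eqP; rewrite eq_le; apply/andP; split.
  apply: (@le_trans _ _ (mu `[0%R, F x]%classic)).
    apply: le_measure; rewrite ?inE.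
    - apply: measurableI; last exact: measurable_itv.
      exact: mqray.
    - exact: measurable_itv.
    move=> u /=; rewrite !in_itv/= /q => -[h /andP[u0 u1]]; rewrite u0/=.
    move: u0; rewrite le_eqVlt => /orP[/eqP <-//|u0].
    by move: h; rewrite u0 u1/= key// u0.
  rewrite lebesgue_measure_itv/= lte_fin; case: ifPn => h; last by rewrite lee_fin.
  by rewrite oppr0 adde0.
apply: (@le_trans _ _ (mu `]0%R, F x[%classic)).
  rewrite lebesgue_measure_itv/= lte_fin; case: ifPn => h; rewrite ?oppr0 ?adde0//.
  by rewrite lee_fin leNgt.
apply: le_measure; rewrite ?inE.
- exact: measurable_itv.
- apply: measurableI; last exact: measurable_itv.
  exact: mqray.
move=> u /=; rewrite !in_itv/= => /andP[u0 uF].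
have u1 : u < 1 := lt_le_trans uF (Fle1 x).
by rewrite /q u0 u1/= key ?u0// (ltW uF) (ltW u0).
Qed.

End quantile.

(** * Independent families with prescribed laws *)

Section independent_laws.
Context {R : realType}.
Local Notation mu := (@lebesgue_measure R).
Let T := measurableTypeR R.

Lemma preimage_bigsetI (aT rT : Type) (I : Type) (f : aT -> rT) (s : seq I)
    (D : I -> set rT) :
  f @^-1` (\big[setI/setT]_(i <- s) D i) = \big[setI/setT]_(i <- s) (f @^-1` D i).
Proof. by elim: s => [|i s IH]; rewrite ?big_nil ?big_cons// preimage_setI IH. Qed.

(** The variables are A, A after B, A after B twice, and so on. Since [B] preserves [P] and is
    independent of [A], the sequence from its second term on is a copy of the whole one, independent
    of [A]. *)
Lemma uniform_sequence (P : probability T R) (A B : T -> T) :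
  measurable_fun setT A -> measurable_fun setT B ->
  (forall C D, measurable C -> measurable D ->
    P (A @^-1` C `&` B @^-1` D) = (P C * P D)%E) ->
  forall s (C : nat -> set T), uniq s -> (forall j, measurable (C j)) ->
  P (\big[setI/setT]_(j <- s) ((fun w => A (iter j B w)) @^-1` C j)) =
  (\prod_(j <- s) P (C j))%E.
Proof.
move=> mA mB AB.
have mI (F : T -> T) (D : set T) : measurable_fun setT F -> measurable D ->
    measurable (F @^-1` D).
  by move=> mF mD; rewrite -[X in measurable X]setTI; exact: mF.
have miter n : measurable_fun setT (iter n B).
  elim: n => [|n IH]; first exact: measurable_id.
  exact: (measurableT_comp mB IH).
have mU n D : measurable D -> measurable ((fun w => A (iter n B w)) @^-1` D).
  move=> mD; apply: mI => //; exact: (measurableT_comp mA (miter n)).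
have init n (C : nat -> set T) : (forall j, measurable (C j)) ->
    P (\big[setI/setT]_(j <- iota 0 n) ((fun w => A (iter j B w)) @^-1` C j)) =
    (\prod_(j <- iota 0 n) P (C j))%E.
  elim: n C => [|n IH] C mC; first by rewrite !big_nil [LHS]probability_setT.
  rewrite /= !big_cons -[1%N]/(1 + 0)%N iotaDl !big_map.
  transitivity (P (A @^-1` C 0%N `&` B @^-1` (\big[setI/setT]_(j <- iota 0 n)
      ((fun w => A (iter j B w)) @^-1` C j.+1)))).
    rewrite preimage_bigsetI; congr (P (_ `&` _)); apply: eq_bigr => j _.
    by apply/seteqP; split => w; rewrite /preimage/= -iterSr.
  rewrite AB//; last by apply: bigsetI_measurable => j _; exact: mU.
  by congr (_ * _)%E; exact: (IH (fun j => C j.+1)).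
move=> s C us mC.
(* An arbitrary index list is padded to an initial segment by full events. *)
pose n := (\max_(j <- s) j).+1.
have sn j : j \in s -> (j < n)%N by move=> js; rewrite ltnS; exact: leq_bigmax_seq.
have perm : perm_eq [seq j <- iota 0 n | j \in s] s.
  apply: uniq_perm => //; first exact/filter_uniq/iota_uniq.
  move=> j; rewrite mem_filter mem_iota add0n leq0n/=.
  by case: (boolP (j \in s)) => // /sn ->.
rewrite -(perm_big _ perm) -[RHS](perm_big _ perm) !big_filter.
rewrite big_mkcond [RHS]big_mkcond.
have := init n (fun j => if j \in s then C j else setT).
move=> /(_ (fun j => _)) H.
rewrite (eq_bigr (fun j => (fun w => A (iter j B w)) @^-1`
  (if j \in s then C j else setT))); last by move=> j _; case: ifP.
rewrite H; last by move=> j; case: ifP.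
by apply: eq_bigr => j _; case: ifP => // _; exact: probability_setT.
Qed.

(** [c] codes the indices by naturals, and the quantile function of [N i] is applied to the
    corresponding term of the uniform sequence. The lemma serves both the gamma variables with their
    sign and the k copies of W. *)
Lemma independent_laws (I : eqType) (c : I -> nat) (e : nat -> I)
    (N : I -> probability R R) : cancel c e ->
  exists (P : probability T R) (X : I -> T -> R),
  [/\ forall i, measurable_fun setT (X i), mutually_independent P X &
      forall i A, measurable A -> P (X i @^-1` A) = N i A].
Proof.
move=> ce; have [P PE] := @uniform01_exists R.
have [[A B]/= [mA mB AB]] := uniform01_split PE.
have US := uniform_sequence mA mB AB.
have /choice[q qP] : forall i, exists q : T -> R, measurable_fun setT q /\
    forall D, measurable D -> P (q @^-1` D) = N i D.
  by move=> i; have [q mq qN] := quantile PE (N i); exists q.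
have mq i : measurable_fun setT (q i) by case: (qP i).
have mqI i D : measurable D -> measurable (q i @^-1` D).
  by move=> mD; rewrite -[X in measurable X]setTI; exact: mq.
pose X i w := q i (A (iter (c i) B w)).
have joint (J : seq I) (D : I -> set R) : uniq J -> (forall i, measurable (D i)) ->
    P (\big[setI/setT]_(i <- J) (X i @^-1` D i)) = (\prod_(i <- J) N i (D i))%E.
  move=> uJ mD.
  have := US (map c J) (fun n => q (e n) @^-1` D (e n)).
  rewrite map_inj_uniq ?uJ; last exact: can_inj ce.
  move=> /(_ isT (fun n => mqI _ _ (mD _))); rewrite !big_map => H.
  transitivity (\prod_(j <- J) P (q (e (c j)) @^-1` D (e (c j))))%E.
    by rewrite -H; congr (P _); apply: eq_bigr => i _; rewrite ce.
  by apply: eq_bigr => i _; rewrite ce; case: (qP i) => _; apply.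
have law i D : measurable D -> P (X i @^-1` D) = N i D.
  move=> mD; have := joint [:: i] (fun=> D) isT (fun=> mD).
  by rewrite !big_cons !big_nil setIT mule1.
exists P, X; split => //.
- move=> i; apply: (measurableT_comp (mq i)); apply: (measurableT_comp mA).
  elim: (c i) => [|n IH]; first exact: measurable_id.
  exact: (measurableT_comp mB IH).
- move=> J uJ D mD; rewrite joint//.
  by apply: eq_bigr => i _; rewrite law.
Qed.

Lemma measure_probability (m : {measure set R -> \bar R}) : m setT = 1%E ->
  exists N : probability R R, forall A, N A = m A.
Proof.
move=> m1.
pose m' := mrestr m measurableT.
have m'1 : m' setT = 1%E by rewrite -m1 -[in RHS](setIT setT).
pose N : probability R R := HB.pack m' (Measure_isProbability.Build _ _ _ m' m'1).
by exists N => A; rewrite -[LHS]/(m (A `&` setT)) setIT.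
Qed.

Lemma gamma_law (a : R) : 0 < a <= 1 -> exists N : probability R R,
  forall A, measurable A -> N A = (\int[mu]_(x in A) (gamma_pdf a x)%:E)%E.
Proof.
move=> a01.
have := integral_gamma_pdf a01.
have := @measurable_gamma_pdf R a; have := fun x => @gamma_pdf_ge0 R a x a01.
move: (gamma_pdf a) => g g0 mg g1.
have [nu nuE] := @density_measure _ T R mu g mg g0.
have mid : measurable_fun setT (fun x : T => x : R) by exact: measurable_id.
pose m' := pushforward nu (fun x : T => x : R) : {measure set _ -> \bar R}.
pose m := m' mid.
have m1 : m setT = 1%E by rewrite -g1; exact: nuE.
have [N NE] := measure_probability m1.
by exists N => A mA; rewrite NE; exact: nuE.
Qed.

Lemma rademacher_law : exists N : probability R R,
  N [set 1] = (2%:R^-1)%:E /\ N [set -1] = (2%:R^-1)%:E.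
Proof.
have h0 : (0 <= 2^-1 :> R) by [].
have hh : 2^-1 + 2^-1 = 1 :> R by lra.
pose m := measure_add (mscale (NngNum h0) (@dirac _ R 1 R))
  (mscale (NngNum h0) (@dirac _ R (-1) R)).
have mE A : m A = ((2^-1)%:E * (\1_A (1:R))%:E + (2^-1)%:E * (\1_A (-1:R))%:E)%E.
  by rewrite /m measure_addE.
have m1 : m setT = 1%E.
  by rewrite mE !indicT !mule1 -EFinD hh.
have [N NE] := measure_probability m1.
have neq : (1 : R) != -1 by apply/eqP; lra.
exists N; split; rewrite NE [LHS]mE !indicE.
  by rewrite mem_set// memNset/= ?mule0 ?mule1 ?adde0// => /eqP; rewrite eq_sym (negbTE neq).
by rewrite memNset/= ?mem_set// ?mule0 ?mule1 ?add0e//; apply/eqP.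
Qed.

End independent_laws.

(** * The limit law *)

(** A block has at most 3(m+1)^2 terms, each at most c^-2 with c = 2m^3 + 1 >= (m+1)^3 / 4; hence 48
    = 3 * 4^2. *)
Lemma inv_odd_block_le (R : realType) (m : nat) :
  m.+1%:R ^+ 2 * \sum_(j <- index_iota (m ^ 3) (m.+1 ^ 3)) (j.*2.+1%:R^-1) ^+ 2 <=
  48 * (m.+1%:R ^+ 2)^-1 :> R.
Proof.
pose c : R := ((m ^ 3).*2.+1)%:R.
have c0 : 0 < c by rewrite ltr0n.
have ac : m.+1%:R ^+ 3 <= 4 * c.
  rewrite /c -natrX -natrM ler_nat.
  case: m {c c0} => // m.
  have : (m.+2 ^ 3 <= (2 * m.+1) ^ 3)%N by rewrite leq_exp2r//; lia.
  by rewrite expnMn; lia.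
have cnt : (m.+1 ^ 3 - m ^ 3 <= 3 * m.+1 ^ 2)%N.
  by rewrite !expnS expn0; nia.
have cntR : (m.+1 ^ 3 - m ^ 3)%:R <= 3 * m.+1%:R ^+ 2 :> R.
  by rewrite -natrX -natrM ler_nat.
have sum_le : \sum_(j <- index_iota (m ^ 3) (m.+1 ^ 3)) (j.*2.+1%:R^-1) ^+ 2 <=
    3 * m.+1%:R ^+ 2 * (c^-1) ^+ 2 :> R.
  apply: (@le_trans _ _ (\sum_(j <- index_iota (m ^ 3) (m.+1 ^ 3)) (c^-1) ^+ 2)).
    rewrite big_seq [leRHS]big_seq; apply: ler_sum => j; rewrite mem_index_iota => /andP[mj _].
    rewrite lerXn2r ?nnegrE ?invr_ge0 ?(ltW c0)// lef_pV2 ?posrE// ler_nat ltnS.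
    by rewrite leq_double.
  rewrite sumr_const_nat -[leLHS]mulr_natl ler_wpM2r ?sqr_ge0//.
move: (m.+1%:R : R) (ltr0n R m.+1) ac sum_le => a /= a0 ac sum_le.
have a2 : 0 < a ^+ 2 by rewrite exprn_gt0.
rewrite ler_pdivlMr// (le_trans (ler_wpM2r (ltW a2) (ler_wpM2l (ltW a2) sum_le)))//.
have -> : a ^+ 2 * (3 * a ^+ 2 * (c^-1) ^+ 2) * a ^+ 2 = 3 * (a ^+ 3 / c) ^+ 2.
  rewrite exprMn; ring.
have : (a ^+ 3 / c) ^+ 2 <= 4 ^+ 2.
  rewrite lerXn2r ?nnegrE ?divr_ge0 ?exprn_ge0 ?(ltW a0) ?(ltW c0)//.
  by rewrite ler_pdivrMr.
by move=> h; apply: (le_trans (ler_wpM2l _ h)) => //; rewrite expr2; lra.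
Qed.

Section limit_law.
Local Open Scope ereal_scope.
Context {R : realType} d (T : measurableType d) (P : probability T R).

(** Completeness turns convergence into a Cauchy condition, which is a countable combination of
    measurable sets. *)
Lemma measurable_cvgn (u : nat -> T -> R) :
  (forall n, measurable_fun setT (u n)) -> measurable [set w | cvgn (u ^~ w)].
Proof.
move=> mu.
rewrite (_ : [set w | _] = \bigcap_m \bigcup_N \bigcap_i
  [set w | `|u N w - u (N + i)%N w| < m.+1%:R^-1]%R).
  apply: bigcap_measurable => // m _; apply: bigcup_measurable => N _.
  apply: bigcap_measurable => // i _.
  have mb : measurable_fun setT (fun w => `|u N w - u (N + i)%N w| < m.+1%:R^-1)%R.
    apply: measurable_fun_ltr => //; apply: measurableT_comp => //.
    exact: measurable_funB.
  have := mb measurableT [set true]; rewrite setTI; exact.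
apply/seteqP; split => w /=.
  move=> cu m _.
  have e0 : (0 < m.+1%:R^-1 / 2 :> R)%R by rewrite divr_gt0.
  have /cvgrPdist_lt/(_ _ e0)[N _ HN] := cu.
  exists N => // i _ /=.
  have h1 := HN N (leqnn N); have h2 := HN (N + i)%N (leq_addr i N).
  move: h1 h2 => /=; move: (limn _) => l h1 h2.
  rewrite (_ : u N w - u (N + i)%N w = (l - u (N + i)%N w) - (l - u N w))%R; last by ring.
  by rewrite (le_lt_trans (ler_normB _ _))// [ltRHS]splitr ltrD.
move=> H; apply/cauchy_cvgP/cauchy_exP => e e0.
have [N _ HN] := H (Num.truncn e^-1)%R I.
exists (u N w), N => // n /= Nn.
have := HN (n - N)%N I; rewrite /= subnKC// /ball/= => /lt_trans; apply.
rewrite -[ltRHS]invrK ltf_pV2 ?posrE ?invr_gt0//.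
exact: truncnS_gt.
Qed.

Lemma mop_indic d' (T' : measurableType d') (Q : probability T' R)
    (X : T' -> R) (A : set R) : measurable_fun setT X -> measurable A ->
  mop Q X (fun x => (\1_A x)%:E) 1%R = Q (X @^-1` A).
Proof.
move=> mX mA; rewrite /mop.
transitivity (\int[Q]_w (\1_(X @^-1` A) w)%:E).
  by apply: eq_integral => w _; rewrite mul1r.
rewrite integral_indic ?setIT//.
by rewrite -[X in measurable X]setTI; exact: mX.
Qed.

(** [is_rademacher] gives only the masses at 1 and -1; as they add up to 1, the remaining event is
    null. *)
Lemma mop_rademacher (eps : T -> R) (f : R -> \bar R) : measurable_fun setT eps ->
  is_rademacher P eps -> nonneg_meas f -> mop P eps f = rop f.
Proof.
move=> me [e1 e2] [mf f0]; apply/funext => y; rewrite /mop /rop.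
set E1 := eps @^-1` _ in e1; set E2 := eps @^-1` _ in e2.
have mE1 : measurable E1 by rewrite -[X in measurable X]setTI; exact: me.
have mE2 : measurable E2 by rewrite -[X in measurable X]setTI; exact: me.
have neq : (1%R : R) <> (-1)%R by lra.
have null : P (~` (E1 `|` E2)) = 0.
  rewrite probability_setC; last exact: measurableU.
  rewrite measureU//; last first.
    by apply/seteqP; split => w //= -[h1 h2]; case: neq; exact: (etrans (esym h1) h2).
  rewrite [X in 1 - X](_ : _ = 1) ?subee//.
  apply: (eq_trans (congr2 _ e1 e2)); rewrite -EFinD; congr EFin; lra.
have mi (E : set T) : measurable E -> measurable_fun setT (fun w => (\1_E w)%:E : \bar R).
  by move=> mE; apply/measurable_EFinP; exact: measurable_indic.
transitivity (\int[P]_w (f y * (\1_E1 w)%:E + f (- y)%R * (\1_E2 w)%:E)).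
  apply: ge0_ae_eq_integral => //.
  - apply: measurableT_comp => //; exact: measurable_funM.
  - by apply: emeasurable_funD; apply: measurable_funeM; exact: mi.
  - by move=> w _; rewrite adde_ge0// mule_ge0// lee_fin.
  - exists (~` (E1 `|` E2)); split => //; first exact/measurableC/measurableU.
    apply: subsetC => w Ew _; case: Ew => Ew.
      rewrite !indicE mem_set// memNset; last by rewrite /E2/= Ew.
      by rewrite mule1 mule0 adde0 Ew mulr1.
    rewrite !indicE memNset; last by rewrite /E1/= Ew => /esym.
    by rewrite mem_set// mule1 mule0 add0e Ew mulrN1.
rewrite ge0_integralD//; last 4 first.
- by move=> w _; rewrite mule_ge0// lee_fin.
- by apply: measurable_funeM; exact: mi.
- by move=> w _; rewrite mule_ge0// lee_fin.
- by apply: measurable_funeM; exact: mi.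
rewrite !ge0_integralZl//; try exact: mi.
have I1 : \int[P]_w (\1_E1 w)%:E = (2^-1)%:E by rewrite integral_indic// setIT.
have I2 : \int[P]_w (\1_E2 w)%:E = (2^-1)%:E by rewrite integral_indic// setIT.
rewrite I1 I2.
by rewrite ge0_muleDr// muleC [X in _ + X]muleC.
Qed.

(** A product of two independent signs is again a sign, so positive powers of the sign operator
    collapse to the operator itself. *)
Lemma rop_rop (f : R -> \bar R) : (forall x, 0 <= f x) -> rop (rop f) = rop f.
Proof.
move=> f0; apply/funext => y; rewrite /rop opprK [f (- y)%R + f y]addeC.
rewrite -ge0_muleDl ?lee_fin// -EFinD (_ : 2^-1 + 2^-1 = 1 :> R)%R ?mul1e//.
by lra.
Qed.

(* Multiplicative convolutions commute, so powers distribute over composition. *)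
Lemma iter_foldr_mop (I : Type) (Z : I -> T -> R) (s : seq I) (k : nat) f :
  (forall i, measurable_fun setT (Z i)) -> nonneg_meas f ->
  iter k (fun g => foldr (fun i => mop P (Z i)) g s) f =
  foldr (fun i => iter k (mop P (Z i))) f s.
Proof.
move=> mZ; pose L s g := foldr (fun i => mop P (Z i)) g s.
have nL s' g : nonneg_meas g -> nonneg_meas (L s' g).
  by move=> ng; exact: nonneg_meas_foldr_mop.
have nit s' n g : nonneg_meas g -> nonneg_meas (iter n (L s') g).
  by move=> ng; elim: n => //= n; exact: nL.
have comm i s' g : nonneg_meas g -> mop P (Z i) (L s' g) = L s' (mop P (Z i) g).
  by move=> ng; elim: s' => //= j s' IH; rewrite -IH mopC//; exact: nL.
rewrite -/(L s); elim: s f => [|i s IH] f nf /=.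
  by elim: k => //= k ->.
rewrite -IH//.
have nm n g : nonneg_meas g -> nonneg_meas (iter n (mop P (Z i)) g).
  by move=> ng; elim: n => //= n; exact: nonneg_meas_mop.
elim: k {IH} => //= k IHk; rewrite IHk; congr (mop P (Z i)).
have swap n m g : nonneg_meas g ->
    L s (iter n (mop P (Z i)) (iter m (L s) g)) = iter n (mop P (Z i)) (L s (iter m (L s) g)).
  move=> ng; elim: n => //= n IHn.
  by rewrite -comm ?IHn//; apply: nm; exact: nit.
exact: swap.
Qed.

Variables (k : nat) (G : nat -> T -> R) (eps : T -> R).
Hypothesis k0 : (0 < k)%N.
Hypothesis mG : forall j, measurable_fun setT (G j).
Hypothesis meps : measurable_fun setT eps.
Hypothesis gG : forall j, is_gamma P (k%:R^-1)%R (G j).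
Hypothesis reps : is_rademacher P eps.
Hypothesis iE : mutually_independent P
  (fun o : option nat => match o with Some j => G j | None => eps end).

Let iG : mutually_independent P G.
Proof.
move=> J uJ A mA.
have := iE (J := map Some J) _ (A := fun o => if o is Some j then A j else setT).
rewrite map_inj_uniq ?uJ; last by move=> ? ? [].
rewrite !big_map; apply => //; by case.
Qed.

(** The series S of weighted squared block sums has finite mean, hence is almost surely finite; its
    value at w is the bound [M] required by [cvg_W_partial]. *)
Lemma W_cvg_ae : {ae P, forall w, cvgn (W_partial k G w)}.
Proof.
have [v v0 hv] := gamma_second_moment k0 mG gG iG.
pose b j : R := (j.*2.+1%:R^-1)%R.
pose B m w : R := (\sum_(j <- index_iota (m ^ 3) (m.+1 ^ 3)) (`|G j w| - k%:R^-1) * b j)%R.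
pose f m w : \bar R := (m.+1%:R ^+ 2 * B m w ^+ 2)%:E.
have mB m : measurable_fun setT (B m).
  apply: measurable_sum => j; apply: measurable_funM => //.
  by apply: measurable_funB => //; exact: measurableT_comp.
have mf m : measurable_fun setT (f m).
  by apply/measurable_EFinP; apply: measurable_funM => //; exact: measurable_funX.
have f0 m w : 0 <= f m w by rewrite lee_fin mulr_ge0 ?sqr_ge0.
have If m : \int[P]_w f m w <= (v * 48 * (m.+1%:R ^+ 2)^-1)%:E.
  rewrite /f; under eq_integral do rewrite EFinM.
  rewrite ge0_integralZl; [|exact: measurableT
    |by apply/measurable_EFinP; exact: measurable_funX
    |by move=> w _; rewrite lee_fin sqr_ge0|by rewrite lee_fin sqr_ge0].
  apply: (@le_trans _ _ ((m.+1%:R ^+ 2)%:E * (v * \sum_(j <- index_iota (m ^ 3) (m.+1 ^ 3)) b j ^+ 2)%:E)).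
    apply: lee_wpmul2l; first by rewrite lee_fin sqr_ge0.
    apply: (gamma_block_variance k0 mG gG iG (iota_uniq _ _)) => // j.
    by rewrite invr_ge0.
  rewrite -EFinM lee_fin mulrCA -[leRHS]mulrA ler_wpM2l//; exact: inv_odd_block_le.
pose S w := \sum_(m <oo) f m w.
have cS w : cvgn (fun n => \sum_(0 <= m < n) f m w).
  by apply: is_cvg_nneseries => m _ _; exact: f0.
have mS : measurable_fun setT S.
  apply: (@emeasurable_fun_cvg _ _ _ _ (fun n w => \sum_(0 <= m < n) f m w)).
    by move=> n; exact: emeasurable_sum.
  by move=> w _; exact: cS.
have S0 w : 0 <= S w by apply: nneseries_ge0 => m _ _; exact: f0.
have IS : \int[P]_w S w < +oo.
  rewrite /S integral_nneseries//.
  apply: (@le_lt_trans _ _ (\sum_(m <oo) (v * 48 * (m.+1%:R ^+ 2)^-1)%:E)).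
    by apply: lee_nneseries => // m _ _; apply: integral_ge0 => w _; exact: f0.
  apply: (@le_lt_trans _ _ (v * 48 * 2)%:E); last exact: ltry.
  have u0 m : 0 <= (v * 48 * (m.+1%:R ^+ 2)^-1 : R)%:E.
    by rewrite lee_fin !mulr_ge0// invr_ge0 sqr_ge0.
  apply: lime_le; first by apply: is_cvg_nneseries => m _ _; exact: u0.
  apply: nearW => n; rewrite sumEFin lee_fin -mulr_sumr.
  by rewrite ler_wpM2l ?mulr_ge0// sum_inv_sqr_le.
have iS : P.-integrable setT S.
  apply/integrableP; split => //.
  by under eq_integral do rewrite gee0_abs//.
have ae1 := @integrable_ae _ _ _ P setT measurableT S iS.
have ae2 := gamma_ge0_ae mG gG.
apply: filterS2 ae1 ae2 => w /(_ I) Sw Gw.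
apply: (@cvg_W_partial R T k G w (fine (S w)) k0 Gw) => n.
rewrite -lee_fin fineK// -sumEFin.
apply: (le_trans _ (@nneseries_lim_ge R (f ^~ w) xpredT 0 n _)); last first.
  by move=> m _ _; exact: f0.
apply: lee_sum => m _; rewrite /f /B.
rewrite le_eqVlt; apply/orP; left; apply/eqP; congr (_ * _ ^+ 2)%:E.
by apply: eq_bigr => j _; rewrite ger0_norm.
Qed.

(** The truncation of [W_of] after the term j = m. The convergence test of the full series is kept,
    so that X m w tends to [W_of] at every w, including those where [W_of] takes the default 0. *)
Let X m w : R := if `[< cvgn (W_partial k G w) >] then
  (eps w * expR (ln 2 / (k.*2)%:R - G 0%N w - W_partial k G w m.+1))%R else 0%R.

Let mWp n : measurable_fun setT (W_partial k G ^~ n).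
Proof.
apply: measurable_sum => j; apply: measurable_funB => //.
exact: measurable_funM.
Qed.

Let mX m : measurable_fun setT (X m).
Proof.
apply: measurable_fun_ifT => //.
  apply: (measurable_fun_bool true).
  rewrite setTI (_ : _ @^-1` _ = [set w | cvgn (W_partial k G w)]).
    exact: (@measurable_cvgn (fun n w => W_partial k G w n)).
  by apply/seteqP; split => w /=; [move/asboolP|move=> ?; apply/asboolP].
apply: measurable_funM => //; apply: measurableT_comp => //.
by apply: measurable_funB => //; exact: measurable_funB.
Qed.

Let cvgX w : X m w @[m --> \oo] --> W_of k G eps w.
Proof.
rewrite /X /W_of; case: ifPn => [/asboolP cw|_]; last exact: cvg_cst.
apply: cvgMr; apply: continuous_cvg; first exact: continuous_expR.
apply: cvgB; first exact: cvg_cst.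
by rewrite (@cvg_shiftS _ (W_partial k G w)).
Qed.

Lemma measurable_W_of : measurable_fun setT (W_of k G eps).
Proof. by apply: (measurable_fun_cvg mX) => w _; exact: cvgX. Qed.

(** As p 0 = 1, the variable [G 0] fits the same pattern exp(c j - p j G j) as the others. *)
Let p (j : nat) : R := (j.*2.+1%:R^-1)%R.
Let c (j : nat) : R := (half_log j / k%:R)%R.
Let Z (o : option nat) : T -> R :=
  if o is Some j then fun w => expR (c j - p j * G j w)%R else eps.

Let mZ o : measurable_fun setT (Z o).
Proof.
case: o => [j|] //=.
exact: (measurableT_comp (measurable_expR_affine (p j) (c j)) (mG j)).
Qed.

Let iZ : mutually_independent P Z.
Proof.
move=> J uJ A mA.
have := iE uJ (A := fun o => if o is Some j then
  (fun x => expR (c j - p j * x)%R) @^-1` A o else A o).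
have E o : Z o @^-1` A o = (if o is Some j then G j else eps) @^-1`
    (if o is Some j then (fun x => expR (c j - p j * x)%R) @^-1` A o else A o).
  by case: o.
rewrite (eq_bigr _ (fun o _ => E o)) => ->.
  by apply: eq_bigr => o _; rewrite E.
case=> [j|]//; rewrite -[X in measurable X]setTI.
exact: measurable_expR_affine.
Qed.

Let sm m := None :: map Some (iota 0 m.+1).

Let XE m w : cvgn (W_partial k G w) -> X m w = (\prod_(o <- sm m) Z o w)%R.
Proof.
move=> cw; rewrite /X asboolT// /sm big_cons big_map -expR_sum; congr (_ * expR _)%R.
have kn0 : (k%:R : R) != 0%R by rewrite pnatr_eq0 -lt0n.
have k2 : (k.*2%:R = k%:R * 2 :> R)%R by rewrite -muln2 natrM.
rewrite [iota 0 m.+1]/= big_cons /c /p /= invr1 mul1r k2.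
rewrite /W_partial /index_iota subn1/= -addrA -[in RHS]addrA; congr (_ + _)%R.
  by field.
rewrite -sumrN; congr (_ + _)%R.
rewrite big_seq [RHS]big_seq; apply: eq_bigr => j; rewrite mem_iota => /andP[j0 _].
rewrite /W_term k2 opprB mulrC; congr (_ - _)%R; last by rewrite mulrC.
by case: j j0 => // j _; rewrite /half_log invfM mulrA mulrAC.
Qed.

(** The truncation and the product of the [Z o] can differ only off the almost sure convergence set,
    which the integral ignores. *)
Let mopX m f : nonneg_meas f -> mop P (X m) f = foldr (fun o => mop P (Z o)) f (sm m).
Proof.
move=> nf; rewrite -mop_prod//; last first.
  rewrite /sm cons_uniq map_inj_uniq ?iota_uniq ?andbT; last by move=> ? ? [].
  by apply/negP => /mapP[].
have [mf f0] := nf.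
apply/funext => y; apply: ge0_ae_eq_integral => //.
- apply: measurableT_comp => //; exact: measurable_funM.
- apply: measurableT_comp => //; apply: measurable_funM => //.
  exact: measurable_prod.
- by apply: filterS W_cvg_ae => w cw _; rewrite XE.
Qed.

Let iterX m f : nonneg_meas f -> iter k (mop P (X m)) f 1%R = sphere_op m f.
Proof.
move=> nf.
have -> : iter k (mop P (X m)) f = iter k (fun g => foldr (fun o => mop P (Z o)) g (sm m)) f.
  suff : iter k (mop P (X m)) f = iter k (fun g => foldr (fun o => mop P (Z o)) g (sm m)) f /\
      nonneg_meas (iter k (mop P (X m)) f) by case.
  elim: k => //= n [<- ng]; split; first exact: mopX.
  exact: nonneg_meas_mop.
rewrite iter_foldr_mop// /sm /= foldr_map /sphere_op.
have gE : foldr (fun j => iter k (mop P (Z (Some j)))) f (iota 0 m.+1) =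
    foldr (fun j => gop 1 (j.*2.+1%:R^-1)%R (half_log j)) f (iota 0 m.+1) /\
    nonneg_meas (foldr (fun j => gop 1 (j.*2.+1%:R^-1)%R (half_log j)) f (iota 0 m.+1)).
  elim: (iota 0 m.+1) => //= j s [-> ng]; split.
    rewrite (iter_mop_gamma (p j) (c j) k0 (mG j) (gG j) ng) /c mulrC divfK//.
    by rewrite pnatr_eq0 -lt0n.
  by apply: nonneg_meas_gop => //; rewrite ltr01 lexx.
(* Only the sign remains: its k-th power is a single [rop], k being positive. *)
move: gE => /= [-> ]; move: (gop _ _ _ _) => g ng; clear -k0 ng meps reps.
case: k k0 => // n _; congr (_ 1%R).
have : iter n.+1 (mop P eps) g = rop g.
  elim: n => [|n IH]; first exact: mop_rademacher.
  rewrite iterS IH mop_rademacher//; first by rewrite rop_rop//; case: ng.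
  by rewrite -(mop_rademacher meps reps ng); exact: nonneg_meas_mop.
by [].
Qed.

(** The product variables Y n have law [sphere_op n], which tends setwise to the normal law, and
    they converge pointwise to Y'; [cvg_law_eq] then identifies the law of Y'. *)
Lemma iter_mop_W_of (A : set R) : measurable A ->
  iter k (mop P (W_of k G eps)) (fun x => (\1_A x)%:E) 1%R = normal_prob 0 1 A.
Proof.
move=> mA.
have [d' [T' [P' [Y [Y' [mY mY' YY' YE Y'E]]]]]] :=
  @iter_mop_limit R _ _ P X _ k mX measurable_W_of cvgX.
rewrite -Y'E; last exact: nonneg_meas_indic.
rewrite mop_indic//.
have mid : measurable_fun setT (fun x : measurableTypeR R => x : R) by exact: measurable_id.
pose N' := pushforward (normal_prob (0:R) (1:R)) (fun x : measurableTypeR R => x : R) :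
  {measure set _ -> \bar R}.
apply: (@cvg_law_eq R _ _ P' (N' mid) Y Y') => //.
  exact: probability_setT.
move=> B mB.
have E n : P' (Y n @^-1` B) = sphere_op n (fun x => (\1_B x)%:E).
  rewrite -iterX; last exact: nonneg_meas_indic.
  rewrite -YE; last exact: nonneg_meas_indic.
  by rewrite mop_indic.
under eq_fun do rewrite E.
exact: cvg_sphere_op.
Qed.

End limit_law.

Theorem mainTheorem2 (R : realType) (k : nat) (hk : (0 < k)%N) :
  (* existence: Z =^D W_1 ... W_k with W_i i.i.d. *)
  (exists (d' : measure_display) (T' : measurableType d')
          (P' : probability T' R) (W : 'I_k -> T' -> R),
      (forall i, measurable_fun setT (W i)) /\
      mutually_independent P' W /\
      (forall i j (A : set R), measurable A ->
          P' (W i @^-1` A) = P' (W j @^-1` A)) /\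
      is_std_normal P' (fun w => \prod_(i < k) W i w)) /\
  (* the explicit choice of the law of W_i *)
  (forall (d : measure_display) (T : measurableType d) (P : probability T R)
          (G : nat -> T -> R) (eps : T -> R),
      (forall j, measurable_fun setT (G j)) -> measurable_fun setT eps ->
      (forall j, is_gamma P (k%:R^-1) (G j)) ->
      is_rademacher P eps ->
      mutually_independent P
        (fun o : option nat => match o with Some j => G j | None => eps end) ->
      {ae P, forall w, cvgn (W_partial k G w)} /\
      forall (d' : measure_display) (T' : measurableType d')
             (P' : probability T' R) (W : 'I_k -> T' -> R),
        (forall i, measurable_fun setT (W i)) ->
        mutually_independent P' W ->
        (forall i (A : set R), measurable A ->
            P' (W i @^-1` A) = P (W_of k G eps @^-1` A)) ->
        is_std_normal P' (fun w => \prod_(i < k) W i w)).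
Proof.
(* Existence reduces to the explicit law: it remains to construct one family [G], [eps] and then k
   independent copies of the resulting W. *)
suff explicit : forall (d : measure_display) (T : measurableType d) (P : probability T R)
    (G : nat -> T -> R) (eps : T -> R),
    (forall j, measurable_fun setT (G j)) -> measurable_fun setT eps ->
    (forall j, is_gamma P (k%:R^-1) (G j)) -> is_rademacher P eps ->
    mutually_independent P
      (fun o : option nat => match o with Some j => G j | None => eps end) ->
    forall (d' : measure_display) (T' : measurableType d')
           (P' : probability T' R) (W : 'I_k -> T' -> R),
      (forall i, measurable_fun setT (W i)) -> mutually_independent P' W ->
      (forall i (A : set R), measurable A ->
          P' (W i @^-1` A) = P (W_of k G eps @^-1` A)) ->
      is_std_normal P' (fun w => \prod_(i < k) W i w).
  split; last first.
    move=> d T P G eps mG me gG re iE; split; first exact: (W_cvg_ae hk mG gG iE).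
    exact: (explicit d T P G eps).
  have k01 : 0 < (k%:R^-1 : R) <= 1.
    by rewrite invr_gt0 ltr0n hk/= invf_le1 ?ltr0n// ler1n.
  have [NG NGE] := gamma_law k01; have [NE NEE] := @rademacher_law R.
  pose c (o : option nat) := if o is Some j then j.+1 else 0%N.
  pose e n := if n is j.+1 then Some j else None.
  have ce : cancel c e by case.
  have [P [X [mX iX lX]]] :=
    independent_laws (fun o => if o is Some _ then NG else NE) ce.
  pose G j := X (Some j); pose eps := X None.
  have mG j : measurable_fun setT (G j) by exact: mX.
  have me : measurable_fun setT eps by exact: mX.
  have gG j : is_gamma P k%:R^-1 (G j).
    by move=> A mA; rewrite (lX (Some j))// NGE.
  have re : is_rademacher P eps.
    by case: NEE => h1 h2; split; rewrite (lX None).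
  have iE : mutually_independent P
      (fun o : option nat => match o with Some j => G j | None => eps end).
    by rewrite (_ : (fun o => _) = X)//; apply/funext; case.
  (* One family yields a single W, so its law is transported to the line and the k copies are drawn
     from that law on a new space. *)
  have mW := @measurable_W_of _ _ _ k _ _ mG me.
  pose m' := pushforward P (W_of k G eps) : {measure set _ -> \bar R}.
  have m1 : m' mW setT = 1%E by exact: probability_setT.
  have [N NWE] := measure_probability m1.
  have cd : cancel (val : 'I_k -> nat) (insubd (Ordinal hk)) by exact: valKd.
  have [P' [W [mW' iW lW]]] := independent_laws (fun=> N) cd.
  exists _, _, P', W; split=> //; split=> //; split.
    by move=> i j A mA; rewrite !lW.
  apply: (explicit _ _ P G eps) => // i A mA.
  by rewrite lW// NWE.
move=> d T P G eps mG me gG re iE d' T' P' W mW iW lW A mA.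
have mWof := @measurable_W_of _ _ _ k _ _ mG me.
have nA := nonneg_meas_indic mA.
have mprod : measurable_fun setT (fun w => \prod_(i < k) W i w).
  exact: measurable_prod.
rewrite -(mop_indic P' mprod mA).
rewrite (mop_prod mW iW (index_enum_uniq _) nA).
rewrite (foldr_mop_iter (F := mop P (W_of k G eps)))//.
- have -> : size (index_enum 'I_k) = k by rewrite -[RHS]card_ord cardT enumT.
  exact: (iter_mop_W_of hk mG me gG re iE mA).
- by move=> g ng; exact: nonneg_meas_mop.
- by move=> i g ng; apply: eq_mop => // B mB; exact: lW.
Qed.
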